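(* Let $G(s)=-a|s|^p+b|s|^q$ with $a,b>0$, $2<p<6$ and $p<q$. Then for every $\lambda>\lambda_*$ there exists exactly one positive function $R\in\mathcal{G}_\lambda\cap H^1_r(\mathbb{R})$.
   Context: On $H^1(\mathbb{R};\mathbb{C})$ put $$E(u)=\frac12\int_{\mathbb{R}}|u'|^2dx+\int_{\mathbb{R}}G(|u|)\,dx,\qquad M(u)=\int_{\mathbb{R}}|u|^2dx.$$ For $\lambda>0$ let $S(\lambda)=\{u\in H^1(\mathbb{R};\mathbb{C}):M(u)=\lambda\}$, $I(\lambda)=\inf_{S(\lambda)}E$ and $\mathcal{G}_\lambda=\{u\in S(\lambda):E(u)=I(\lambda)\}$. The number $\lambda_*\ge0$ is $\lambda_*=\sup\{\lambda>0: I(\lambda)=0\}$ (with $\lambda_*=0$ if this set is empty). $H^1_r(\mathbb{R})$ is the space of real-valued even functions in $H^1(\mathbb{R})$. *)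

(* Defs.v *)
From HB Require Import structures.
From mathcomp Require Import all_boot all_order all_algebra.
From mathcomp Require Import all_classical all_reals all_analysis.
From mathcomp.real_closed Require Import complex.

Set Implicit Arguments.
Unset Strict Implicit.
Unset Printing Implicit Defensive.

Import Order.TTheory GRing.Theory Num.Theory.
Import numFieldNormedType.Exports.

Local Open Scope classical_set_scope.
Local Open Scope ring_scope.
Local Open Scope complex_scope.

Section Sobolev.
Context {R : realType}.
Local Notation mu := (@lebesgue_measure R).

Definition test_function (phi : R -> R) : Prop :=
  (forall (n : nat) (x : R), derivable phi^`(n)%classic x 1) /\
  compact (closure [set x | phi x != 0]).

Definition is_weak_derivative (f g : R -> R) : Prop :=
  forall phi : R -> R, test_function phi ->
    (\int[mu]_x (f x * phi^`()%classic x)%:E = - \int[mu]_x (g x * phi x)%:E)%E.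

(* Every class of [H^1(R)] has exactly one continuous representative; an
   element of [H^1(R)] is encoded as that representative, so that Leibniz
   equality, evenness and pointwise positivity have their usual meaning. *)
Definition H1 : set (R -> R) :=
  [set f | [/\ continuous f, f \in Lfun mu 2%:E &
    exists2 g, g \in Lfun mu 2%:E & is_weak_derivative f g]].

(* The weak derivative is only determined almost everywhere: this picks an
   arbitrary representative, and is only used under an integral. *)
Definition weak_derivative (f : R -> R) : R -> R :=
  xget (cst 0)
    [set g : R -> R | g \in Lfun mu 2%:E /\ is_weak_derivative f g].

(* [H^1(R; C) = H^1(R) + i H^1(R)] *)
Definition H1C : set (R -> R[i]) :=
  [set u | H1 (fun x => complex.Re (u x)) /\ H1 (fun x => complex.Im (u x))].

Definition weak_derivativeC (u : R -> R[i]) (x : R) : R[i] :=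
  weak_derivative (fun y => complex.Re (u y)) x +i*
  weak_derivative (fun y => complex.Im (u y)) x.

(* real-valued even functions in [H^1(R; C)] *)
Definition H1r : set (R -> R[i]) :=
  [set u | [/\ H1C u, forall x, complex.Im (u x) = 0 &
    forall x, u (- x) = u x]].

End Sobolev.

Section Variational.
Context {R : realType}.
Variable G : R -> R.
Local Notation mu := (@lebesgue_measure R).
Local Open Scope ereal_scope.

(* [normc] is the modulus with values in [R] rather than [R[i]] *)
Definition energy (u : R -> R[i]) : \bar R :=
  (2^-1)%:E * \int[mu]_x ((Normc.normc (weak_derivativeC u x)) ^+ 2)%:E
  + \int[mu]_x (G (Normc.normc (u x)))%:E.

Definition mass (u : R -> R[i]) : \bar R := \int[mu]_x ((Normc.normc (u x)) ^+ 2)%:E.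

Definition mass_sphere (lambda : R) : set (R -> R[i]) :=
  [set u | H1C u /\ mass u = lambda%:E].

Definition ground_energy (lambda : R) : \bar R :=
  ereal_inf (energy @` mass_sphere lambda).

Definition ground_states (lambda : R) : set (R -> R[i]) :=
  [set u | mass_sphere lambda u /\ energy u = ground_energy lambda].

(* The set consists of positive numbers, so the maximum with [0] only matters
   when it is empty, where [ereal_sup] is [-oo]. *)
Definition lambda_star : \bar R :=
  maxe 0 (ereal_sup [set lambda%:E | lambda in
    [set lambda : R | (0 < lambda)%R /\ ground_energy lambda = 0]]).

End Variational.

Definition double_power {R : realType} (a b p q s : R) : R :=
  - a * `|s| `^ p + b * `|s| `^ q.

(* Main.v *)
(* With k = p - 2, l = q - 2, A = 2a and B = 2b one has G s = - s^2 g(s) / 2 for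
   g s = A s^k - B s^l, and g increases up to a height hmax. The modulus v of u
   in H^1 is a curve with speed at most r = |u'|. For n <= hmax with g <= g n
   along v, completing the square in r^2 + v^2 (g n - g v) bounds the energy from
   below by a calibration. Taking for n the smaller of m = max v and hmax, this
   bounds the energy from below by the reduced energy Psi of the height n. Psi' has the sign of M(m) - lambda, where M(m) is the mass of the
   profile of height m. Since k < 4, M increases from 0 to infinity on (0, hmax),
   so Psi has a unique minimum point h, with M(h) = lambda, and the profile Q of
   height h attains the bound.
   If u is a minimizer then max v = h and r = v sqrt (g h - g v) almost
   everywhere; comparing travel times gives Q (x - x1) <= v x, and equality holds
   because both sides have the same mass. Evenness of u forces x1 = 0. *)
From HB Require Import structures.
Require Import Defs.
From mathcomp Require Import all_boot all_order all_algebra.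
From mathcomp Require Import all_classical all_reals all_analysis.
From mathcomp.real_closed Require Import complex.
From mathcomp Require Import measurable_realfun ring lra.
Set Implicit Arguments.
Unset Strict Implicit.
Unset Printing Implicit Defensive.
Import Order.TTheory GRing.Theory Num.Theory.
Import numFieldNormedType.Exports.
Local Open Scope classical_set_scope.
Local Open Scope ring_scope.

(** * Primitives and monotonicity *)

Section primitive.
Context {R : realType}.
Notation mu := (@lebesgue_measure R).
Implicit Types (f F : R -> R) (a b c x : R).

(** Written in the variable s = v, the integrals over a profile of height m are singular at s = m,
    where [sqrt (pot m - pot s)] vanishes. With s = m (1 - tau^2) the root splits off a factor tau
    that cancels the Jacobian, and mass and action become integrals over [0, 1] of continuous
    functions, which can be compared and differentiated in m. The bound k < 4 enters by scaling:
    M(m) / m^(2 - k/2) is nondecreasing. M blows up at hmax because the potential is maximal there,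
    which makes the mass integrand behave like 1 / tau. The equation v' = - v sqrt (g h - g v) has
    no uniqueness at the top, since the constant h solves it as well: a minimizer could rest at
    height h before falling. This is why the comparison with the profile gives only an inequality,
    and why the equality of masses has to close the argument. *)

Definition segment_integrable f := forall a b, mu.-integrable `[a, b] (EFin \o f).

(** Signed integral from 0 to x: for nonzero x one of the two intervals is empty. *)
Definition primitive f x :=
  \int[mu]_(t in `[0, x]) f t - \int[mu]_(t in `[x, 0]) f t.

Lemma continuous_segment_integrable f : continuous f -> segment_integrable f.
Proof.
move=> cf a b; apply: continuous_compact_integrable; first exact: segment_compact.
exact: continuous_subspaceT.
Qed.

Lemma Rintegral_itv_cat f a b c : segment_integrable f -> a <= b -> b <= c ->
  \int[mu]_(t in `[a, c]) f t =
  \int[mu]_(t in `[a, b]) f t + \int[mu]_(t in `[b, c]) f t.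
Proof.
move=> fi ab bc; apply/eqP; rewrite addrC -subr_eq; apply/eqP.
rewrite (@Rintegral_itvB _ f (BLeft a) (BRight c) b) ?bnd_simp//.
rewrite Rintegral_itv_obnd_cbnd//.
apply: integrableS (fi b c) => //; exact: subset_itv_oc_cc.
Qed.

Lemma Rintegral_primitive f a b : segment_integrable f -> a <= b ->
  \int[mu]_(t in `[a, b]) f t = primitive f b - primitive f a.
Proof.
move=> fi ab; rewrite /primitive.
have E0 x y : y < x -> \int[mu]_(t in `[x, y]) f t = 0.
  by move=> yx; rewrite set_itv_ge ?Rintegral_set0// bnd_simp -ltNge.
have E1 x : \int[mu]_(t in `[x, x]) f t = 0 by rewrite set_itv1 Rintegral_set1.
have [a0|a0|a0] := ltgtP a 0; have [b0|b0|b0] := ltgtP b 0;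
  rewrite ?a0 ?b0 ?E1; try (rewrite (E0 _ _ a0)); try (rewrite (E0 _ _ b0)).
- by rewrite (Rintegral_itv_cat fi ab (ltW b0)); ring.
- by rewrite (Rintegral_itv_cat fi (ltW a0) (ltW b0)); ring.
- by ring.
- by exfalso; lra.
- by rewrite (Rintegral_itv_cat fi (ltW a0) ab); ring.
- by exfalso; lra.
- by exfalso; lra.
- by ring.
- by ring.
Qed.

Lemma primitive0 f : primitive f 0 = 0.
Proof. by rewrite /primitive subrr. Qed.

Lemma is_derive_primitive f x : segment_integrable f -> {for x, continuous f} ->
  is_derive x 1 (primitive f) (f x).
Proof.
(* A base point to the left of x whatever the sign of x; changing the base point only adds a
   constant. *)
move=> fi cf; pose a := x - 1.
have ax : a < x by rewrite /a; lra.
have xu : x < x + 1 by lra.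
have [d1 d2] := @continuous_FTC1_closed _ f a x _ xu (fi _ _) ax cf.
set F := (fun y => \int[mu]_(t in `[a, y]) f t) in d1 d2.
have nE : \near x, primitive f x = F x + primitive f a.
  near=> y; rewrite /F Rintegral_primitive//; first by ring.
  by apply/ltW; near: y; exact: lt_nbhsr.
have dF : is_derive x 1 (fun y => F y + primitive f a) (f x).
  have := DeriveDef d1 erefl; rewrite -derive1E d2 => dF.
  by rewrite -[f x]addr0; exact: (@is_deriveD _ _ _ F (cst (primitive f a))).
apply: near_eq_is_derive dF.
near do apply/esym; exact: nE.
Unshelve. all: end_near. Qed.

Lemma is_derive_continuous F (f : R -> R) : (forall x, is_derive x 1 F (f x)) ->
  continuous F.
Proof.
by move=> dF x; apply/differentiable_continuous/derivable1_diffP; case: (dF x).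
Qed.

Lemma primitive_continuous f : continuous f -> continuous (primitive f).
Proof.
move=> cf; apply: is_derive_continuous => x; apply: is_derive_primitive (cf x).
exact: continuous_segment_integrable.
Qed.

(** The derivative is asked for only in the open interval because [is_derive_virial] and the
    substitution in [primitive_calib] give their formulas only there. *)
Lemma Rintegral_FTC F f a b : a <= b -> continuous f -> continuous F ->
  (forall x, a < x < b -> is_derive x 1 F (f x)) ->
  \int[mu]_(t in `[a, b]) f t = F b - F a.
Proof.
rewrite le_eqVlt => /predU1P[->|ab] cf cF dF.
  by rewrite set_itv1 Rintegral_set1 subrr.
rewrite /Rintegral (@continuous_FTC2 _ f F)//; first exact: continuous_subspaceT.
  split; first by move=> x; rewrite in_itv => /dF [].
  - by apply: cvg_at_right_filter; exact: cF.
  - by apply: cvg_at_left_filter; exact: cF.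
by move=> x; rewrite in_itv => /dF [] _ <-; rewrite derive1E.
Qed.

End primitive.

(** * Chain rule along curves, inverse functions, integrals of even functions *)

Section monotone.
Context {R : realType}.
Notation mu := (@lebesgue_measure R).
Implicit Types (f F r : R -> R) (a b c x : R).

(** Real induction: the supremum of the points where f is at least [f a] is itself such a point, by
    the condition on its left, and it equals b, by the condition on its right. *)
Lemma locally_nondecreasing_le f a b : a <= b ->
  (forall x, a <= x <= b -> exists2 d, 0 < d & forall y, a <= y <= b ->
     `|y - x| < d -> if x <= y then f x <= f y else f y <= f x) ->
  f a <= f b.
Proof.
move=> ab loc; pose S := [set x | a <= x <= b /\ f a <= f x].
have Sa : S a by split; rewrite ?lexx ?ab.
have ubS : ubound S b by move=> x [/andP[]].
have supS : has_sup S by split; [exists a|exists b].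
set c := sup S.
have cb : c <= b by apply: ge_sup => //; exists a.
have ac : a <= c by apply: ub_le_sup => //; exists b.
have [|d d0 dP] := loc c; first by rewrite ac.
have Sc : f a <= f c.
  have [x [xab fx] cx] := sup_adherent d0 supS.
  have xc : x <= c by apply: ub_le_sup => //; exists b.
  have [xc'|xc'] := eqVneq x c; first by rewrite -xc'.
  apply: le_trans fx _; have := dP x xab.
  rewrite -/c in cx; rewrite distrC ger0_norm ?subr_ge0//.
  rewrite ltrBlDl addrC -ltrBlDl -/c.
  have /negbTE -> : ~~ (c <= x) by rewrite -ltNge lt_neqAle xc' xc.
  by apply; lra.
have [cb'|cb'] := eqVneq c b; first by rewrite -cb'.
have {cb cb'}cb : c < b by rewrite lt_neqAle cb' cb.
pose y := Num.min b (c + d / 2).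
have cy : c < y by rewrite /y lt_min cb; lra.
have yb : y <= b by rewrite /y ge_min lexx.
have yd : y <= c + d / 2 by rewrite /y ge_min lexx orbT.
have yab : a <= y <= b by rewrite yb (le_trans ac)// ltW.
have := dP y yab; rewrite (ltW cy) gtr0_norm ?subr_gt0// => fcy.
suff : y <= c by lra.
apply: ub_le_sup; first by exists b.
by split => //; apply: le_trans Sc _; apply: fcy; lra.
Qed.

Lemma continuous_bounded_itv f a b : continuous f -> [bounded f x | x in `[a, b]].
Proof.
move=> cf; have /compact_bounded : compact (f @` `[a, b]).
  apply: continuous_compact; last exact: segment_compact.
  exact: continuous_subspaceT.
by move=> [M [Mr MP]]; exists M; split => // x Mx y yab; apply: (MP x Mx); exists y.
Qed.

Lemma segment_integrableM f r : continuous f -> segment_integrable r ->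
  segment_integrable (fun x => f x * r x).
Proof.
move=> cf ri a b.
apply: (@integrableMr _ _ _ mu `[a, b] _ f (EFin \o r)) => //.
  by apply: measurable_funTS; exact: continuous_measurable_fun.
exact: continuous_bounded_itv.
Qed.

Lemma segment_integrableD f r : segment_integrable f -> segment_integrable r ->
  segment_integrable (fun x => f x + r x).
Proof.
move=> fi ri a b; apply: eq_integrable (integrableD _ (fi a b) (ri a b)) => //.
Qed.

Lemma Rintegral_itv_ge0 r a b : (forall x, 0 <= r x) ->
  0 <= \int[mu]_(t in `[a, b]) r t.
Proof. by move=> r0; exact: Rintegral_ge0. Qed.

(* A chain rule for a curve with integrable speed, in integrated form: it
   follows from the local estimate by [locally_nondecreasing_le], so that no
   almost everywhere differentiability of the curve is involved. *)
Lemma integral_chain_le (F f v r : R -> R) a b : a <= b ->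
  continuous v -> segment_integrable r -> (forall x, 0 <= r x) ->
  (forall x y, x <= y -> `|v y - v x| <= \int[mu]_(t in `[x, y]) r t) ->
  (forall x, is_derive (v x) 1 F (f (v x))) -> continuous (f \o v) ->
  `|F (v b) - F (v a)| <= \int[mu]_(t in `[a, b]) (`|f (v t)| * r t).
Proof.
move=> ab cv ri r0 vr dF cf.
have cnf : continuous (fun x => `|f (v x)|).
  by move=> x; apply: cvg_norm; exact: cf.
have ffi : segment_integrable (fun x => `|f (v x)| * r x).
  exact: segment_integrableM.
(* The sign s covers both halves of the absolute value; the slack e absorbs the error of the local
   linearization. *)
suff H (s e : R) : (s == 1) || (s == -1) -> 0 < e ->
    s * (F (v b) - F (v a)) <=
    \int[mu]_(t in `[a, b]) (`|f (v t)| * r t) +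
    e * \int[mu]_(t in `[a, b]) r t.
  have H' (s : R) : (s == 1) || (s == -1) -> s * (F (v b) - F (v a)) <=
      \int[mu]_(t in `[a, b]) (`|f (v t)| * r t).
    move=> s1; apply/ler_addgt0Pr => e e0.
    have i0 := Rintegral_itv_ge0 a b r0.
    set I := \int[mu]_(t in `[a, b]) r t in i0 *.
    have e' : 0 < e / (I + 1) by rewrite divr_gt0//; lra.
    apply: le_trans (H s _ s1 e') _; rewrite lerD2l -mulrA ger_pMr//.
    by rewrite mulrC -/I ler_pdivrMr; lra.
  rewrite ler_norml; apply/andP; split.
    by have := H' (-1); rewrite eqxx orbT mulN1r lerNl; apply.
  by have := H' 1; rewrite eqxx mul1r; apply.
move=> s1 e0.
have cg : continuous (fun x => `|f (v x)| + e).
  by move=> x; apply: cvgD; [exact: cnf|exact: cvg_cst].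
have gi : segment_integrable (fun x => (`|f (v x)| + e) * r x).
  exact: segment_integrableM.
have eri : segment_integrable (fun x => e * r x).
  by apply: segment_integrableM => // x; exact: cvg_cst.
rewrite -RintegralZl//.
rewrite -RintegralD//.
under eq_Rintegral do rewrite -mulrDl.
rewrite Rintegral_primitive//.
set W := primitive _.
suff : W a - s * F (v a) <= W b - s * F (v b) by lra.
apply: (@locally_nondecreasing_le (fun x => W x - s * F (v x))) => // x xab.
(* Differentiability of F at [v x] costs e / 2, and continuity of [f \o v] at x another e / 2. *)
have [d d0 dP] : exists2 d, 0 < d & forall y, `|y - x| < d ->
    `|F (v y) - F (v x)| <= (`|f (v x)| + e / 2) * `|v y - v x| /\
    `|f (v x)| + e / 2 <= `|f (v y)| + e.
  have [dFx eF] := dF x.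
  have /cvgrPdist_lt cFx : (fun h : R => h^-1 *: ((F \o shift (v x)) (h *: (1 : R))
      - F (v x))) @ 0^' --> f (v x) by rewrite -eF; exact: dFx.
  have e20 : 0 < e / 2 by lra.
  have := cFx _ e20; rewrite near_withinE => /nbhs_ballP[d1 /= d10 d1P].
  have /cvgrPdist_lt /(_ _ d10) /nbhs_ballP [d2 /= d20 d2P] : v y @[y --> x] --> v x.
    exact: cv.
  have /cvgrPdist_lt /(_ _ e20) /nbhs_ballP [d3 /= d30 d3P] := cnf x.
  exists (Num.min d2 d3); first by rewrite lt_min d20 d30.
  move=> y; rewrite lt_min => /andP[yd2 yd3]; split; last first.
    have := d3P y; rewrite /ball/= distrC => /(_ yd3).
    by rewrite ltr_norml; lra.
  have [->|vyx] := eqVneq (v y) (v x); first by rewrite !subrr normr0 mulr0.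
  have hd : ball 0 d1 (v y - v x).
    by rewrite /ball/= sub0r normrN distrC; apply: d2P; rewrite /ball/= distrC.
  have h0 : v y - v x != 0 by rewrite subr_eq0.
  have := d1P _ hd h0; rewrite /= [_ *: 1]mulr1 subrK => /ltW dd.
  rewrite -ler_pdivrMr ?normr_gt0// -normf_div.
  have -> : (F (v y) - F (v x)) / (v y - v x) = f (v x) -
     (f (v x) - (v y - v x)^-1 *: (F (v y) - F (v x))).
    by rewrite /GRing.scale/= subKr mulrC.
  by apply: (le_trans (ler_normB _ _)); rewrite lerD2l.
exists d => // y yab yx.
(* One of p and q is x, so p + q - x is the other one; this treats points on either side of x at
   once. *)
have key p q : p <= q -> `|p - x| < d -> `|q - x| < d -> (p = x \/ q = x) ->
    W p - s * F (v p) <= W q - s * F (v q).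
  move=> pq px qx pqx.
  have aK (u w : R) : u + w - u = w by ring.
  suff : `|F (v q) - F (v p)| <= W q - W p.
    by case/orP : s1 => /eqP ->; rewrite ler_norml; lra.
  have -> : `|F (v q) - F (v p)| = `|F (v p + v q - v x) - F (v x)|.
    by case: pqx => ->; [rewrite aK|rewrite addrK distrC].
  have -> : v p + v q - v x = v (p + q - x).
    by case: pqx => ->; rewrite ?addrK// !aK.
  have dpq : `|p + q - x - x| < d by case: pqx => [E|E]; rewrite E in px qx *;
    [move: qx|move: px]; apply: le_lt_trans; rewrite le_eqVlt; apply/orP; left;
    apply/eqP; congr (`| _ |); ring.
  have [+ _] := dP _ dpq.
  move/le_trans; apply.
  have -> : `|v (p + q - x) - v x| = `|v q - v p|.
    case: pqx => ->; first by rewrite aK.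
    by rewrite addrK distrC.
  rewrite -Rintegral_primitive//.
  apply: (@le_trans _ _ ((`|f (v x)| + e / 2) * \int[mu]_(t in `[p, q]) r t)).
    by rewrite ler_wpM2l ?vr// addr_ge0 ?normr_ge0//; lra.
  rewrite -RintegralZl//.
  apply: le_Rintegral => //.
  - apply: (@segment_integrableM (fun=> `|f (v x)| + e / 2)) => // z.
    exact: cvg_cst.
  - move=> t /=; rewrite in_itv/= => /andP[pt tq]; rewrite ler_wpM2r//.
    have /dP[] // : `|t - x| < d.
    by move: px qx; rewrite !ltr_norml; lra.
case: ifPn => [xy|]; first by apply: key => //; [rewrite subrr normr0|left].
rewrite -ltNge => /ltW yx'; apply: key => //; last by right.
by rewrite subrr normr0.
Qed.

(** The uniform lower bound c makes F onto the line, so the inverse is defined everywhere. *)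
Lemma inverse_of_pos_derivative F f (c : R) : 0 < c -> (forall x, c <= f x) ->
  (forall x, is_derive x 1 F (f x)) ->
  exists g, [/\ cancel F g, cancel g F & forall x, is_derive x 1 g (f (g x))^-1].
Proof.
move=> c0 cf dF.
have cF : continuous F by exact: is_derive_continuous dF.
have slope x y : x <= y -> c * (y - x) <= F y - F x.
  move=> xy; have [z _ ->] := MVT_segment xy (fun z _ => dF z)
    (continuous_subspaceT cF).
  by rewrite ler_wpM2r// subr_ge0.
have injF : injective F.
  move=> x y Fxy; apply/eqP; rewrite eq_le; apply/andP; split; rewrite leNgt;
    apply/negP => /[dup] xy /ltW/slope; rewrite Fxy subrr leNgt => /negP; apply;
    by rewrite mulr_gt0// subr_gt0.
have surF y : exists x, F x = y.
  pose M := `|y - F 0| / c.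
  have M0 : 0 <= M by rewrite divr_ge0// ltW.
  have cM : c * M = `|y - F 0| by rewrite mulrC divfK// gt_eqF.
  have MM : - M <= M by lra.
  have [] := @IVT R F (- M) M y MM.
  - exact: continuous_subspaceT.
  - have h1 := slope _ _ M0.
    have /slope h2 : - M <= 0 by lra.
    have := ler_norm (y - F 0); have := ler_norm (- (y - F 0)).
    rewrite normrN ge_min le_max => n1 n2.
    apply/andP; split; apply/orP; [left|right]; lra.
  - by move=> x _ <-; exists x.
have [g gK] := choice surF.
have Kg : cancel F g by move=> x; apply: injF; rewrite gK.
exists g; split => // x.
have := @is_derive_inverse R F g (f (g x)) (g x).
rewrite gK; apply.
- by near=> z; exact: Kg.
- by near=> z; exact: cF.
- by rewrite gt_eqF// (lt_le_trans c0).
Unshelve. all: end_near. Qed.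

Lemma ge0_even_integral F f (l : R) : (forall x, 0 <= f x) -> continuous f ->
  (forall x, f (- x) = f x) -> (forall x, is_derive x 1 F (f x)) ->
  F x @[x --> +oo] --> l ->
  (\int[mu]_x (f x)%:E = (2 * (l - F 0))%:E)%E.
Proof.
move=> f0 cf evf dF Fl.
rewrite ge0_symfun_integralT//; last by move=> x /=; rewrite evf.
rewrite -set_itvcy (@ge0_continuous_FTC2y _ f F 0 l)//.
- exact: continuous_subspaceT.
- by apply: cvg_at_right_filter; exact: is_derive_continuous dF _.
- by move=> x _; rewrite derive1E; case: (dF x).
Qed.

End monotone.

(** * Smooth bumps and weak derivatives *)

Section smooth.
Context {R : realType}.
Implicit Types (f g : R -> R) (x : R).

(** Recursion on the order turns closure under sums, products and affine changes of variable into
    inductions; the property for all n gives the smoothness that [test_function] asks for. *)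
Fixpoint smooth_upto (n : nat) f : Prop :=
  (forall x, derivable f x 1) /\
  (if n is m.+1 then smooth_upto m f^`()%classic else True).

Lemma smooth_upto_derivable n f x : smooth_upto n f -> derivable f x 1.
Proof. by case: n => [|n] []. Qed.

Lemma smooth_uptoW n f : smooth_upto n.+1 f -> smooth_upto n f.
Proof. by elim: n f => [|n ih] f [df sf]; split => //; exact: ih. Qed.

Lemma smooth_upto_derive1n n f x : smooth_upto n f ->
  derivable (derive1n n f) x 1.
Proof.
elim: n f => [|n ih] f [df sf]; first exact: df.
by rewrite derive1Sn; exact: ih.
Qed.

Lemma derive1_is_derive f g : (forall x, is_derive x 1 f (g x)) -> f^`()%classic = g.
Proof. by move=> d; apply/funext => x; rewrite derive1E; case: (d x). Qed.

Lemma derivable_is_derive1 f x : derivable f x 1 -> is_derive x 1 f (f^`()%classic x).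
Proof. by move=> d; rewrite derive1E; exact: derivableP. Qed.

Lemma smooth_uptoS n f g : (forall x, is_derive x 1 f (g x)) -> smooth_upto n g ->
  smooth_upto n.+1 f.
Proof. by move=> d sg /=; rewrite (derive1_is_derive d); split => // x; case: (d x). Qed.

Lemma smooth_upto_cst n (c : R) : smooth_upto n (fun=> c).
Proof.
elim: n c => [|n ih] c; first by split => // x; exact: derivable_cst.
by apply: (@smooth_uptoS _ _ (fun=> 0)); exact: ih.
Qed.

Lemma smooth_uptoD n f g : smooth_upto n f -> smooth_upto n g ->
  smooth_upto n (fun x => f x + g x).
Proof.
elim: n f g => [|n ih] f g sf sg.
  by split => // x; apply: derivableD; apply: smooth_upto_derivable; eassumption.
apply: (@smooth_uptoS _ _ (fun x => f^`()%classic x + g^`()%classic x)).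
  move=> x; have df := derivable_is_derive1 (smooth_upto_derivable (x := x) sf).
  have dg := derivable_is_derive1 (smooth_upto_derivable (x := x) sg).
  exact: (@is_deriveD _ _ _ f g x 1 _ _ df dg).
by apply: ih; [case: sf|case: sg].
Qed.

Lemma smooth_uptoM n f g : smooth_upto n f -> smooth_upto n g ->
  smooth_upto n (fun x => f x * g x).
Proof.
elim: n f g => [|n ih] f g sf sg.
  by split => // x; apply: derivableM; apply: smooth_upto_derivable; eassumption.
apply: (@smooth_uptoS _ _ (fun x => f x * g^`()%classic x + g x * f^`()%classic x)).
  move=> x; have df := derivable_is_derive1 (smooth_upto_derivable (x := x) sf).
  have dg := derivable_is_derive1 (smooth_upto_derivable (x := x) sg).
  exact: (@is_deriveM _ _ f g x 1 _ _ df dg).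
by apply: smooth_uptoD; apply: ih; try exact: smooth_uptoW; [case: sg|case: sf].
Qed.

Lemma is_derive_affine f (d : R -> R) (c e x : R) : is_derive (c * x + e) 1 f (d (c * x + e)) ->
  is_derive x 1 (fun x => f (c * x + e)) (c * d (c * x + e)).
Proof.
move=> df; have da : is_derive x 1 (fun x : R => c * x + e) c.
  have dz : is_derive x 1 ( *%R c : R -> R) c.
    have := @is_deriveZ _ _ _ id c x 1 1 (is_derive_id _ _).
    by rewrite /GRing.scale/= mulr1.
  rewrite -[X in is_derive _ _ _ X]addr0.
  exact: (@is_deriveD _ _ _ ( *%R c) (cst e) x 1 c 0 dz (is_derive_cst _ _ _)).
by rewrite [c * d _]mulrC; exact: (@is_derive1_comp _ f (fun x => c * x + e) x _ _ df da).
Qed.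

Lemma smooth_upto_affine n f (c e : R) : smooth_upto n f ->
  smooth_upto n (fun x => f (c * x + e)).
Proof.
elim: n f => [|n ih] f sf.
  split => // x; have := @is_derive_affine f f^`()%classic c e x.
  by case=> //; apply: derivable_is_derive1; exact: smooth_upto_derivable sf.
apply: (@smooth_uptoS _ _ (fun x => c * f^`()%classic (c * x + e))).
  move=> x; apply: is_derive_affine; apply: derivable_is_derive1.
  exact: smooth_upto_derivable sf.
apply: smooth_uptoM; first exact: smooth_upto_cst.
by apply: ih; case: sf.
Qed.

(** The classical smooth function exp (-1/x), times negative powers of x: the span of this family is
    stable under differentiation. *)
Definition flat (j : nat) (x : R) : R :=
  if 0 < x then x ^- j * expR (- x^-1) else 0.

Lemma is_derive_quadratic f (C : R) : f 0 = 0 -> (forall h, `|f h| <= C * h ^+ 2) ->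
  is_derive (0 : R) 1 f 0.
Proof.
move=> f0 fC; have C0 : 0 <= C by have := fC 1; rewrite expr1n mulr1; apply: le_trans.
have : (fun h : R => h^-1 *: ((f \o shift 0) (h *: (1 : R)) - f 0)) @ 0^' --> (0 : R).
  apply/cvgrPdist_le => e e0; rewrite near_withinE; near=> h => h0.
  rewrite /= sub0r normrN f0 subr0 [h *: 1]mulr1 addr0 [_ *: _]mulrC.
  rewrite normrM normfV ler_pdivrMr ?normr_gt0//.
  apply: le_trans (fC h) _; rewrite -real_normK ?num_real// expr2 mulrA ler_wpM2r//.
  apply: (@le_trans _ _ (C * (e / (C + 1)))).
    apply: ler_wpM2l => //; near: h.
    have e' : 0 < e / (C + 1) by rewrite divr_gt0//; lra.
    apply/nbhs_ballP; exists (e / (C + 1)) => //= z.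
    by rewrite /ball/= sub0r normrN => /ltW.
  by rewrite mulrCA ger_pMr// ler_pdivrMr; lra.
move=> /[dup] cv /cvgP dv; split => //.
exact: (cvg_lim _ cv).
Unshelve. all: end_near. Qed.

(** The single term (1/h)^(j+2) / (j+2)! of the exponential series of exp (1/h) is enough. *)
Lemma flat_quadratic j h : `|flat j h| <= (j.+2)`!%:R * h ^+ 2.
Proof.
rewrite /flat; case: ifPn => h0; last by rewrite normr0 mulr_ge0// sqr_ge0.
have h0' := ltW h0.
rewrite ger0_norm ?mulr_ge0 ?invr_ge0 ?exprn_ge0 ?expR_ge0//.
have := @expR_ge1Dxn R h^-1 j.+1; rewrite invr_ge0 => /(_ h0') H.
have {}H : h^-1 ^+ j.+2 <= (j.+2)`!%:R * expR h^-1.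
  by rewrite mulrC -ler_pdivrMr ?ltr0n ?fact_gt0//; lra.
rewrite expRN mulrC ler_pdivrMl ?expR_gt0// mulrA [expR _ * _]mulrC.
apply: (@le_trans _ _ (h^-1 ^+ j.+2 * h ^+ 2)).
  rewrite -addn2 exprD exprVn -mulrA exprVn mulVf ?mulr1// expf_neq0//.
  by rewrite gt_eqF.
by rewrite ler_wpM2r ?sqr_ge0.
Qed.

Lemma is_derive_flat j x :
  is_derive x 1 (flat j) (flat j.+2 x + (- j%:R) * flat j.+1 x).
Proof.
have [x0|x0|->] := ltgtP x 0.
- rewrite /flat !(lt_gtF x0) mulr0 addr0.
  apply: (@near_eq_is_derive _ _ _ (cst 0)).
  near=> y; have y0 : y < 0 by near: y; exact: lt_nbhsl.
  by rewrite (lt_gtF y0).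
- suff dP : is_derive x 1 (fun y => y^-1 ^+ j * expR (- y^-1))
      (flat j.+2 x + (- j%:R) * flat j.+1 x).
    apply: near_eq_is_derive dP.
    near=> y; have y0 : 0 < y by near: y; exact: lt_nbhsr.
    by rewrite /flat y0 exprVn.
  have xn0 : x != 0 by rewrite gt_eqF.
  have dV : is_derive x 1 (fun y : R => y^-1) (- x ^- 2).
    have := @is_deriveV R id x 1 1 xn0 (is_derive_id _ _).
    by rewrite /GRing.scale/= mulr1.
  have dVj : is_derive x 1 (fun y : R => y^-1 ^+ j)
      ((j%:R * x^-1 ^+ j.-1) *: - x ^- 2).
    by have := @is_deriveX _ _ (fun y : R => y^-1) j x 1 _ dV; rewrite fctE.
  have dN : is_derive x 1 (fun y : R => - y^-1) (x ^- 2).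
    by have := @is_deriveN _ _ _ _ x 1 _ dV; rewrite opprK.
  have dE := @is_derive1_comp _ expR (fun y => - y^-1) x _ _ (is_derive_expR _) dN.
  have dM := @is_deriveM _ _ (fun y : R => y^-1 ^+ j) (fun y => expR (- y^-1)) x 1
    _ _ dVj dE.
  apply: (is_derive_eq dM) => {dVj dM}.
  rewrite /flat x0 /GRing.scale/=; case: j => [|j].
    by rewrite !expr0 expr1 mulr0n !mul0r oppr0 mul0r !addr0 mul1r mulr0 addr0 mulrC.
  rewrite /= !exprVn.
  have xj : x ^+ j != 0 by rewrite expf_neq0.
  rewrite !exprS; field.
  by rewrite xn0 xj.
- have -> : flat j.+2 (0 : R) + - j%:R * flat j.+1 0 = 0.
    by rewrite /flat ltxx mulr0 addr0.
  apply: (@is_derive_quadratic _ (j.+2)`!%:R); first by rewrite /flat ltxx.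
  exact: flat_quadratic.
Unshelve. all: end_near. Qed.

Lemma smooth_upto_flat n j : smooth_upto n (flat j).
Proof.
elim: n j => [|n ih] j.
  by split => // x; case: (is_derive_flat j x).
apply: smooth_uptoS (is_derive_flat j) _; apply: smooth_uptoD; first exact: ih.
by apply: smooth_uptoM; [exact: smooth_upto_cst|exact: ih].
Qed.

Definition bump (x : R) : R := flat 0 x * flat 0 (-1 * x + 1).

Lemma flat_ge0 j x : 0 <= flat j x.
Proof.
rewrite /flat; case: ifPn => // x0.
by rewrite mulr_ge0 ?invr_ge0 ?exprn_ge0 ?expR_ge0// ltW.
Qed.

Lemma bump_ge0 x : 0 <= bump x.
Proof. by rewrite mulr_ge0// flat_ge0. Qed.

Lemma bump_gt0 x : 0 < x < 1 -> 0 < bump x.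
Proof.
move=> /andP[x0 x1]; rewrite /bump /flat x0.
have -> : 0 < -1 * x + 1 by lra.
by rewrite !expr0 !invr1 !mul1r mulr_gt0// expR_gt0.
Qed.

Lemma bump_le0 x : x <= 0 -> bump x = 0.
Proof. by move=> x0; rewrite /bump /flat ltNge x0 mul0r. Qed.

Lemma bump_ge1 x : 1 <= x -> bump x = 0.
Proof.
move=> x1; rewrite /bump [X in _ * X]/flat.
have /negbTE -> : ~~ (0 < -1 * x + 1) by rewrite -leNgt; lra.
by rewrite mulr0.
Qed.

Lemma smooth_upto_bump n : smooth_upto n bump.
Proof.
apply: smooth_uptoM; first exact: smooth_upto_flat.
by apply: smooth_upto_affine; exact: smooth_upto_flat.
Qed.

Lemma smooth_upto_continuous n f : smooth_upto n f -> continuous f.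
Proof.
move=> sf x; apply/differentiable_continuous/derivable1_diffP.
exact: smooth_upto_derivable sf.
Qed.

Definition step (x : R) : R := primitive bump x / primitive bump 1.

Lemma primitive_bump_gt0 : 0 < primitive bump 1.
Proof.
have cb := smooth_upto_continuous (smooth_upto_bump 0).
have dP x : is_derive x 1 (primitive bump) (bump x).
  by apply: is_derive_primitive (cb x); exact: continuous_segment_integrable.
have [z] := MVT (@ltr01 R) (fun x _ => dP x)
  (continuous_subspaceT (primitive_continuous cb)).
rewrite in_itv/= => /bump_gt0 bz.
by rewrite primitive0 !subr0 mulr1 => ->.
Qed.

Lemma is_derive_step x : is_derive x 1 step (bump x / primitive bump 1).
Proof.
have cb := smooth_upto_continuous (smooth_upto_bump 0).
have dP : is_derive x 1 (primitive bump) (bump x).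
  by apply: is_derive_primitive (cb x); exact: continuous_segment_integrable.
have dM := @is_deriveM _ _ (primitive bump) (cst (primitive bump 1)^-1) x 1 _ 0
  dP (is_derive_cst _ _ _).
by apply: (is_derive_eq dM); rewrite scaler0 add0r /GRing.scale/= mulrC.
Qed.

Lemma smooth_upto_step n : smooth_upto n step.
Proof.
case: n => [|n]; first by split => // x; case: (is_derive_step x).
apply: smooth_uptoS is_derive_step _; apply: smooth_uptoM.
  exact: smooth_upto_bump.
exact: smooth_upto_cst.
Qed.

Lemma step_le x y : x <= y -> step x <= step y.
Proof.
move=> xy; rewrite ler_wpM2r ?invr_ge0 ?(ltW primitive_bump_gt0)// -subr_ge0.
rewrite -Rintegral_primitive//; first by apply: Rintegral_ge0 => z _; exact: bump_ge0.
apply: continuous_segment_integrable.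
exact: smooth_upto_continuous (smooth_upto_bump 0).
Qed.

Lemma primitive_eq0 f x y : continuous f -> x <= y ->
  (forall z, x <= z <= y -> f z = 0) -> primitive f y = primitive f x.
Proof.
move=> cf xy f0; apply/eqP; rewrite -subr_eq0 -Rintegral_primitive//; last first.
  exact: continuous_segment_integrable.
rewrite (@eq_Rintegral _ _ _ _ _ (cst 0)); first by rewrite Rintegral_cst// mul0r.
by move=> z; rewrite inE/= in_itv/= => /f0.
Qed.

Lemma step_le0 x : x <= 0 -> step x = 0.
Proof.
move=> x0; have cb := smooth_upto_continuous (smooth_upto_bump 0).
rewrite /step -(@primitive_eq0 _ x 0 cb)// ?primitive0 ?mul0r//.
by move=> z /andP[_ /bump_le0].
Qed.

Lemma step_ge1 x : 1 <= x -> step x = 1.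
Proof.
move=> x1; have cb := smooth_upto_continuous (smooth_upto_bump 0).
rewrite /step (@primitive_eq0 _ 1 x cb)// ?divff// ?gt_eqF// ?primitive_bump_gt0//.
by move=> z /andP[/bump_ge1].
Qed.

Lemma step_01 x : 0 <= step x <= 1.
Proof.
have [x0|/ltW x0] := leP x 0; first by rewrite step_le0// lexx ler01.
have [x1|/ltW x1] := leP 1 x; first by rewrite step_ge1// lexx ler01.
by rewrite -{1}(step_le0 (lexx 0)) -[X in _ <= _ <= X](step_ge1 (lexx 1)) !step_le.
Qed.

End smooth.

(** * Weak derivatives and the fundamental theorem of calculus *)

Section weak_derivatives.
Context {R : realType}.
Notation mu := (@lebesgue_measure R).
Implicit Types (f g phi : R -> R) (a b x y z : R) (n : nat).

Lemma integral_support_itv f a b : (forall z, ~~ (a <= z <= b) -> f z = 0) ->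
  (\int[mu]_x (f x)%:E = \int[mu]_(x in `[a, b]) (f x)%:E)%E.
Proof.
move=> f0; rewrite [RHS]integral_mkcond; apply: eq_integral => z _.
rewrite patchE; case: ifPn => // /negP zab; rewrite f0//.
by apply/negP => ab; apply: zab; rewrite inE/= in_itv.
Qed.

Lemma EFin_Rintegral f (D : set R) : measurable D ->
  mu.-integrable D (EFin \o f) ->
  (\int[mu]_(x in D) (f x)%:E = (\int[mu]_(x in D) f x)%R%:E)%E.
Proof. by move=> mD fi; rewrite /Rintegral fineK// integrable_fin_num. Qed.

Lemma is_weak_derivative_itv f g phi a b : continuous f -> segment_integrable g ->
  is_weak_derivative f g -> test_function phi ->
  (forall z, ~~ (a <= z <= b) -> phi z = 0) ->
  (forall z, ~~ (a <= z <= b) -> phi^`()%classic z = 0) ->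
  \int[mu]_(x in `[a, b]) (f x * phi^`()%classic x) =
  - \int[mu]_(x in `[a, b]) (g x * phi x).
Proof.
move=> cf gi fg tphi p0 dp0; have := fg phi tphi.
have cphi : continuous phi.
  by move=> x; apply/differentiable_continuous/derivable1_diffP; exact: (tphi.1 0%N).
have cdphi : continuous phi^`()%classic.
  by move=> x; apply/differentiable_continuous/derivable1_diffP; exact: (tphi.1 1%N).
rewrite (@integral_support_itv _ a b); last by move=> z /dp0 ->; rewrite mulr0.
rewrite (@integral_support_itv (fun x => g x * phi x) a b); last first.
  by move=> z /p0 ->; rewrite mulr0.
rewrite !EFin_Rintegral//; first by move=> -[].
- have := segment_integrableM cphi gi => /(_ a b); apply: eq_integrable => //.
  by move=> z _; rewrite /= mulrC.
- apply: continuous_segment_integrable => x.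
  by apply: cvgM; [exact: cf|exact: cdphi].
Qed.

(** Smoothed indicator of the half line to the right of x. Its transition takes place in [x, x +
    [harmonic n]], where [harmonic n] is 1 / (n + 1), and its derivative [bump_at] is an approximate
    identity. The argument is written in the form c * z + e of [is_derive_affine]. *)
Definition step_at x (n : nat) (z : R) : R := step (n.+1%:R * z + - (n.+1%:R * x)).

Definition bump_at x (n : nat) (z : R) : R :=
  n.+1%:R * (bump (n.+1%:R * z + - (n.+1%:R * x)) / primitive bump 1).

Lemma is_derive_step_at x n z : is_derive z 1 (step_at x n) (bump_at x n z).
Proof.
apply: (@is_derive_affine _ _ (fun z => bump z / primitive bump 1)).
exact: is_derive_step.
Qed.

Lemma continuous_bump_at x n : continuous (bump_at x n).
Proof.
apply: (@smooth_upto_continuous _ 0); apply: smooth_uptoM.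
  exact: smooth_upto_cst.
apply: (@smooth_upto_affine _ 0 (fun z => bump z / primitive bump 1)).
by apply: smooth_uptoM; [exact: smooth_upto_bump|exact: smooth_upto_cst].
Qed.

Lemma bump_at_ge0 x n z : 0 <= bump_at x n z.
Proof. by rewrite mulr_ge0// divr_ge0 ?bump_ge0// ltW// primitive_bump_gt0. Qed.

Lemma bump_at_eq0 x n z : ~~ (x <= z <= x + harmonic n) -> bump_at x n z = 0.
Proof.
rewrite negb_and -!ltNge => /orP[zx|xz]; rewrite /bump_at.
  by rewrite bump_le0 ?mul0r ?mulr0// subr_le0 ler_pM2l// ltW.
rewrite bump_ge1 ?mul0r ?mulr0// -mulrBr -ler_pdivrMl ?ltr0n// mulr1.
by rewrite lerBrDl ltW.
Qed.

Lemma step_at_le x n z : z <= x -> step_at x n z = 0.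
Proof. by move=> zx; rewrite /step_at step_le0// subr_le0 ler_pM2l. Qed.

Lemma step_at_ge x n z : x + harmonic n <= z -> step_at x n z = 1.
Proof.
move=> zx; by rewrite /step_at step_ge1// -mulrBr -ler_pdivrMl ?ltr0n// mulr1 lerBrDl.
Qed.

Lemma harmonic_le1 n : (harmonic n : R) <= 1.
Proof. by rewrite invf_le1// ler1n. Qed.

(** [bump_at x n] is nonnegative, has integral 1 and lives on [x, x + [harmonic n]], so the integral
    is an average of f next to x. *)
Lemma bump_at_cvg f x a b : continuous f -> a <= x -> x + 1 <= b ->
  \int[mu]_(z in `[a, b]) (f z * bump_at x n z) @[n --> \oo] --> f x.
Proof.
move=> cf ax xb; have ab : a <= b by lra.
have fbi n (c : R) : mu.-integrable `[a, b]
    (EFin \o (fun z => (f z - c) * bump_at x n z)).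
  apply: continuous_segment_integrable => z; apply: cvgM.
    by apply: cvgB; [exact: cf|exact: cvg_cst].
  exact: continuous_bump_at.
have cbi n (c : R) : mu.-integrable `[a, b] (EFin \o (fun z => c * bump_at x n z)).
  apply: continuous_segment_integrable => z; apply: cvgM; first exact: cvg_cst.
  exact: continuous_bump_at.
have b1 n : \int[mu]_(z in `[a, b]) bump_at x n z = 1.
  have := harmonic_le1 n => n1.
  have dS := is_derive_step_at x n.
  rewrite (Rintegral_FTC ab (@continuous_bump_at x n) (is_derive_continuous dS)
    (fun z _ => dS z)).
  by rewrite step_at_ge ?step_at_le ?subr0//; lra.
have bi n : mu.-integrable `[a, b] (EFin \o bump_at x n).
  exact/continuous_segment_integrable/continuous_bump_at.
apply/cvgrPdist_le => e e0.
have /cvgrPdist_le /(_ _ e0) /nbhs_ballP [d /= d0 dP] := cf x.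
near=> n.
have nd : harmonic n < d by near: n; exact: (near_infty_natSinv_lt (PosNum d0)).
have -> : f x - \int[mu]_(z in `[a, b]) (f z * bump_at x n z) =
    - \int[mu]_(z in `[a, b]) ((f z - f x) * bump_at x n z).
  under [in RHS]eq_Rintegral do rewrite mulrBl.
  rewrite RintegralB//; last first.
    apply: continuous_segment_integrable => z; apply: cvgM; first exact: cf.
    exact: continuous_bump_at.
  by rewrite RintegralZl// b1 mulr1 opprB.
rewrite normrN; apply: (le_trans (le_normr_Rintegral _ _)) => //.
rewrite -[e]mulr1 -(b1 n) -RintegralZl//.
apply: le_Rintegral => //.
- by apply: integrable_norm; exact: fbi.
- move=> z _; rewrite normrM (ger0_norm (bump_at_ge0 _ _ _)).
  have [zx|zx] := boolP (x <= z <= x + harmonic n); last first.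
    by rewrite bump_at_eq0// !mulr0.
  rewrite ler_wpM2r ?bump_at_ge0// distrC; apply: dP.
  rewrite /ball/= distrC ger0_norm ?subr_ge0; last by case/andP: zx.
  by case/andP: zx => _ zx; lra.
Unshelve. all: end_near. Qed.

Lemma test_function_step x y n : x <= y ->
  test_function (fun z => step_at x n z - step_at y n z).
Proof.
move=> xy; split=> [k z|].
  apply: smooth_upto_derive1n.
  have -> : (fun z => step_at x n z - step_at y n z) =
      (fun z => step_at x n z + (-1) * step_at y n z).
    by apply/funext => w; rewrite mulN1r.
  apply: smooth_uptoD; first by apply: smooth_upto_affine; exact: smooth_upto_step.
  apply: smooth_uptoM; first exact: smooth_upto_cst.
  by apply: smooth_upto_affine; exact: smooth_upto_step.
apply: (subclosed_compact _ (@segment_compact _ x (y + 1))).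
  exact: closed_closure.
have -> : `[x, y + 1]%classic = closure (`[x, y + 1]%classic : set R).
  by apply/closure_id; exact: itv_closed.
apply: closure_subset => z /= zn0; rewrite in_itv/=.
have n1 := harmonic_le1 n.
apply: contraNT zn0; rewrite negb_and -!ltNge => /orP[zx|xz].
  by rewrite !step_at_le ?subr0//; lra.
by rewrite !step_at_ge ?subrr//; lra.
Qed.

(** The test functions are smoothed indicators of ]x, y]. Their derivatives are differences of two
    approximate identities, so one side tends to [f x - f y]; the other side converges by dominated
    convergence. All supports lie in [x, y + 1] because [harmonic n <= 1]. *)
Lemma weak_derivative_FTC f g x y : continuous f -> segment_integrable g ->
  measurable_fun setT g -> is_weak_derivative f g -> x <= y ->
  f y - f x = \int[mu]_(z in `[x, y]) g z.
Proof.
move=> cf gi mg fg xy.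
pose phi n z := step_at x n z - step_at y n z.
have dphi n z : is_derive z 1 (phi n) (bump_at x n z - bump_at y n z).
  have d1 := is_derive_step_at x n z; have d2 := is_derive_step_at y n z.
  exact: is_deriveB.
have dphiE n : (phi n)^`()%classic = fun z => bump_at x n z - bump_at y n z.
  exact: derive1_is_derive.
have cphi n : continuous (phi n) by exact: is_derive_continuous (dphi n).
have out n z : ~~ (x <= z <= y + 1) -> [/\ phi n z = 0 , bump_at x n z = 0 &
    bump_at y n z = 0].
  have n1 := harmonic_le1 n.
  rewrite negb_and -!ltNge /phi => /orP[zx|xz]; split.
  - by rewrite !step_at_le ?subr0//; lra.
  - by apply: bump_at_eq0; rewrite negb_and -!ltNge zx.
  - by apply: bump_at_eq0; rewrite negb_and -!ltNge (lt_le_trans zx).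
  - by rewrite !step_at_ge ?subrr//; lra.
  - apply: bump_at_eq0; rewrite negb_and -!ltNge; apply/orP; right; lra.
  - apply: bump_at_eq0; rewrite negb_and -!ltNge; apply/orP; right; lra.
have E n : \int[mu]_(z in `[x, y + 1]) (f z * bump_at x n z) -
    \int[mu]_(z in `[x, y + 1]) (f z * bump_at y n z) =
    - \int[mu]_(z in `[x, y + 1]) (g z * phi n z).
  have := @is_weak_derivative_itv f g (phi n) x (y + 1) cf gi fg
    (test_function_step n xy).
  rewrite dphiE => <-; last 2 first.
  - by move=> z /(out n)[].
  - by move=> z /(out n)[_ -> ->]; rewrite subrr.
  have fbi w : mu.-integrable `[x, y + 1] (EFin \o (fun z => f z * bump_at w n z)).
    apply: continuous_segment_integrable => z; apply: cvgM; first exact: cf.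
    exact: continuous_bump_at.
  under [RHS]eq_Rintegral do rewrite mulrBr.
  by rewrite RintegralB.
have L1 : \int[mu]_(z in `[x, y + 1]) (f z * bump_at x n z) -
    \int[mu]_(z in `[x, y + 1]) (f z * bump_at y n z) @[n --> \oo] --> f x - f y.
  by apply: cvgB; apply: bump_at_cvg => //; lra.
have gphi n : mu.-integrable `[x, y + 1] (EFin \o (fun z => g z * phi n z)).
  have := @segment_integrableM _ (phi n) g (@cphi n) gi x (y + 1).
  by apply: eq_integrable => // z _; rewrite /= mulrC.
(* Pointwise limit of [phi n]; half-open, since each transition starts at its base point and extends
   to the right. *)
pose one z : R := if x < z <= y then 1 else 0.
have L2 : (\int[mu]_(z in `[x, (y + 1)%R]) (g z * phi n z)%:E)%E @[n --> \oo] -->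
    (\int[mu]_(z in `[x, (y + 1)%R]) (g z * one z)%:E)%E.
  apply: (@dominated_cvg _ _ _ mu `[x, y + 1] (measurable_itv _) _ _
    (fun z => `|(g z)%:E|%E)) => //.
  - by move=> n; case/integrableP: (gphi n).
  - move=> z _; apply: cvg_EFin; first exact: nearW.
    apply: cvgM; first exact: cvg_cst.
    apply: cvg_near_cst; rewrite /one /phi.
    have [zx|xz] /= := leP z x.
      by near=> n; rewrite !step_at_le ?subr0//; lra.
    have [zy|yz] := leP z y.
      have d0 : 0 < z - x by lra.
      near=> n; rewrite step_at_ge ?step_at_le ?subr0//.
      have : harmonic n < z - x by near: n; exact: (near_infty_natSinv_lt (PosNum d0)).
      by lra.
    have d0 : 0 < z - y by lra.
    near=> n; have : harmonic n < z - y.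
      by near: n; exact: (near_infty_natSinv_lt (PosNum d0)).
    by move=> nd; rewrite !step_at_ge ?subrr//; lra.
  - by apply: integrable_abse; exact: gi.
  - move=> n z _; rewrite /= lee_fin normrM ler_piMr//.
    have := step_01 (n.+1%:R * z + - (n.+1%:R * x)).
    have := step_01 (n.+1%:R * z + - (n.+1%:R * y)).
    rewrite -/(step_at x n z) -/(step_at y n z) /phi ler_norml.
    by lra.
have oneE : (\int[mu]_(z in `[x, (y + 1)%R]) (g z * one z)%:E =
    (\int[mu]_(z in `[x, y]) g z)%R%:E)%E.
  rewrite -EFin_Rintegral//.
  rewrite -[RHS]integral_itv_obnd_cbnd; last first.
    apply/measurable_EFinP; apply: measurable_funTS => //.
  rewrite integral_mkcond [RHS]integral_mkcond; apply: eq_integral => z _.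
  rewrite !patchE /one !mem_setE !in_itv/=.
  have [xz|xz] := ltP x z; have [zy|zy] := leP z y => //=; last 3 first.
  - by case: ifP => // _; rewrite mulr0.
  - by case: ifP => // _; rewrite mulr0.
  - by case: ifP => // _; rewrite mulr0.
  by rewrite (ltW xz) (le_trans zy) ?mulr1//; lra.
rewrite oneE in L2; move/fine_cvgP : L2 => [_ L2].
have L3 : (- \int[mu]_(z in `[x, y + 1]) (g z * phi n z)) @[n --> \oo] -->
    - \int[mu]_(z in `[x, y]) g z by apply: cvgN; exact: L2.
move: L1; under eq_fun do rewrite E; move=> L1.
have /(_ _) e := cvg_unique (@norm_hausdorff _ _) L1 L3.
by rewrite -[LHS]opprB e opprK.
Unshelve. all: end_near. Qed.

(** The derivative of f phi has integral zero over an interval at whose ends phi vanishes. *)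
Lemma C1_weak_derivative f g : (forall x, is_derive x 1 f (g x)) -> continuous g ->
  is_weak_derivative f g.
Proof.
move=> df cg phi [sphi cphi].
have dphi x : is_derive x 1 phi (phi^`()%classic x).
  by apply: derivable_is_derive1; exact: (sphi 0%N).
have dphi' x : is_derive x 1 phi^`()%classic (phi^`()^`()%classic x).
  by apply: derivable_is_derive1; exact: (sphi 1%N).
have cf := is_derive_continuous df.
have cph := is_derive_continuous dphi.
have cph' := is_derive_continuous dphi'.
have [M [M0 MP]] : exists M : R, 0 < M /\ forall z, phi z != 0 -> `|z| <= M.
  have [N [Nr NP]] := compact_bounded cphi.
  exists (`|N| + 1); split; first by have := normr_ge0 N; lra.
  move=> z zn0; apply: (NP (`|N| + 1)); first by have := ler_norm N; lra.
  exact: subset_closure.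
have out z : ~~ (- (M + 1) <= z <= M + 1) -> phi z = 0.
  move=> zM; apply/eqP; apply: contraNT zM => /MP; rewrite ler_norml; lra.
have out' z : ~~ (- (M + 1) <= z <= M + 1) -> phi^`()%classic z = 0.
  move=> zM; suff d0 : is_derive z 1 phi 0 by rewrite derive1E; case: d0.
  apply: (@near_eq_is_derive _ _ _ (cst 0)).
  have : `|z| > M by rewrite ltNge ler_norml; apply: contra zM; lra.
  move=> zM'; near=> w; apply/esym/eqP; apply: contraTT isT => /MP.
  rewrite leNgt; apply: contraNN => _; near: w.
  exact: (cvgr_gt _ (@norm_continuous _ _ z)).
rewrite (@integral_support_itv _ (- (M + 1)) (M + 1)); last first.
  by move=> z /out' ->; rewrite mulr0.
rewrite (@integral_support_itv (fun x => g x * phi x) (- (M + 1)) (M + 1)); last first.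
  by move=> z /out ->; rewrite mulr0.
have i1 : mu.-integrable `[- (M + 1), M + 1] (EFin \o (fun x => f x * phi^`()%classic x)).
  apply: continuous_segment_integrable => x.
  by apply: cvgM; [exact: cf|exact: cph'].
have i2 : mu.-integrable `[- (M + 1), M + 1] (EFin \o (fun x => g x * phi x)).
  apply: continuous_segment_integrable => x.
  by apply: cvgM; [exact: cg|exact: cph].
rewrite !EFin_Rintegral// -EFinN; congr EFin.
apply/eqP; rewrite -subr_eq0 opprK -RintegralD//; apply/eqP.
have dfp x : is_derive x 1 (fun x => f x * phi x) (f x * phi^`()%classic x + g x * phi x).
  apply: (is_derive_eq (@is_deriveM _ _ f phi x 1 _ _ (df x) (dphi x))).
  by rewrite /GRing.scale/= [phi x * _]mulrC.
rewrite (Rintegral_FTC _ _ (is_derive_continuous dfp) (fun z _ => dfp z)).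
- have MM z : `|z| = M + 1 -> phi z = 0.
    by move=> zM; apply/eqP; apply: contraPT isT => /MP; rewrite zM; lra.
  rewrite !MM ?mulr0 ?subrr// ?normrN ger0_norm//; lra.
- lra.
- move=> x; apply: cvgD; apply: cvgM;
    [exact: cf|exact: cph'|exact: cg|exact: cph].
Unshelve. all: end_near. Qed.

(** Lebesgue differentiation, applied on each half line to the right of -n; the exceptional null
    sets are countably many. *)
Lemma ae_eq0_of_Rintegral_itv g : segment_integrable g -> measurable_fun setT g ->
  (forall x y, x <= y -> \int[mu]_(z in `[x, y]) g z = 0) ->
  {ae mu, forall x, g x = 0}.
Proof.
move=> gi mg g0.
have lg : locally_integrable setT g.
  split => //; first exact: openT.
  move=> K _ cK; have [M [_ MP]] := compact_bounded cK.
  have /integrableP[_] := gi (- (`|M| + 1)) (`|M| + 1).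
  apply: le_lt_trans; apply: ge0_subset_integral => //.
  - exact: compact_measurable.
  - by apply/measurable_EFinP; apply: measurableT_comp => //; exact: measurable_funTS.
  - move=> z Kz /=; rewrite in_itv/= -ler_norml; apply: (MP (`|M| + 1)) => //.
    by have := ler_norm M; lra.
have H n : {ae mu, forall x, - n%:R < x -> g x = 0}.
  have := @FTC1 _ g (BLeft (- n%:R)) (fun y => gi _ y) lg.
  apply: filterS; first exact: (ae_filter_ringOfSetsType mu).
  move=> x + nx; case; first by rewrite lte_fin.
  move=> _ <-.
  rewrite derive1E; suff d0 : is_derive x 1 (fun x0 : R =>
      \int[mu]_(t in [set` Interval (BLeft (- n%:R)) (BRight x0)]) g t) 0 by case: d0.
  apply: (@near_eq_is_derive _ _ _ (cst 0)).
  near=> w; rewrite g0//; apply/ltW; near: w; exact: lt_nbhsr.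
have := ae_foralln H; apply: filterS.
move=> x Hx.
have [n xn] : exists n : nat, - x < n%:R.
  exists (Num.bound `|x|); apply: le_lt_trans (archi_boundP (normr_ge0 x)).
  by rewrite -normrN ler_norm.
by apply: (Hx n); lra.
Unshelve. all: end_near. Qed.

Lemma Lfun2_segment_integrable g : g \in Lfun mu 2%:E ->
  [/\ segment_integrable g, measurable_fun setT g &
      mu.-integrable setT (EFin \o (fun x => g x ^+ 2))].
Proof.
move=> gL; have g2 := Lfun2_integrable_sqr gL.
have mg : measurable_fun setT g by move: gL => /andP[] /[1!inE].
split => // a b.
have g2i : mu.-integrable `[a, b] (EFin \o (fun x => g x ^+ 2)).
  by apply: integrableS g2.
have i1 : mu.-integrable `[a, b] (EFin \o (fun x : R => 1 : R)).
  by apply: continuous_segment_integrable => x; exact: cvg_cst.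
(* On a bounded interval |g| is dominated by 1 + g^2. *)
apply: (le_integrable _ _ _ (integrableD _ i1 g2i)) => //.
  by apply/measurable_EFinP; exact: measurable_funTS.
move=> z _ /=; rewrite lee_fin [leRHS]ger0_norm; last by have := sqr_ge0 (g z); lra.
have := normr_ge0 (g z).
by have := sqr_ge0 (`|g z| - 1); rewrite sqrrB1 real_normK ?num_real//; lra.
Qed.

End weak_derivatives.

(** * Curves of bounded speed *)

Section curves.
Context {R : realType}.
Notation mu := (@lebesgue_measure R).
Implicit Types (v r f g : R -> R) (a b s x y z : R).

(* [v] is a nonnegative curve in [L^2] moving at speed at most [r] in [L^2]:
   what is needed of the modulus of an [H^1] function. *)
Record speed_bounded v r : Prop := SpeedBounded {
  sb_cont : continuous v;
  sb_ge0 : forall x, 0 <= v x;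
  sb_speed_ge0 : forall x, 0 <= r x;
  sb_speed_int : segment_integrable r;
  sb_speed_meas : measurable_fun setT r;
  sb_speed_sqr : mu.-integrable setT (EFin \o (fun x => r x ^+ 2));
  sb_sqr : mu.-integrable setT (EFin \o (fun x => v x ^+ 2));
  sb_le : forall x y, x <= y -> `|v y - v x| <= \int[mu]_(t in `[x, y]) r t }.

Definition nrm2 a b := Num.sqrt (a ^+ 2 + b ^+ 2).

Lemma nrm2_ge0 a b : 0 <= nrm2 a b. Proof. exact: sqrtr_ge0. Qed.

Lemma sqr_nrm2 a b : nrm2 a b ^+ 2 = a ^+ 2 + b ^+ 2.
Proof. by rewrite sqr_sqrtr// addr_ge0// sqr_ge0. Qed.

Lemma nrm2_cauchy a b x y : a * x + b * y <= nrm2 a b * nrm2 x y.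
Proof.
rewrite -sqrtrM ?addr_ge0 ?sqr_ge0//.
apply: le_trans (ler_norm _) _; rewrite -sqrtr_sqr ler_sqrt ?mulr_ge0 ?addr_ge0 ?sqr_ge0//.
rewrite -subr_ge0; have -> : (a ^+ 2 + b ^+ 2) * (x ^+ 2 + y ^+ 2) - (a * x + b * y) ^+ 2
  = (a * y - b * x) ^+ 2 by ring.
exact: sqr_ge0.
Qed.

Lemma nrm2_dist a b x y : `|nrm2 a b - nrm2 x y| <= nrm2 (a - x) (b - y).
Proof.
have H a' b' x' y' : nrm2 a' b' - nrm2 x' y' <= nrm2 (a' - x') (b' - y').
  have [n0|n0] := eqVneq (nrm2 a' b') 0.
    rewrite n0 sub0r; apply: (@le_trans _ _ 0); last exact: nrm2_ge0.
    by rewrite oppr_le0 nrm2_ge0.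
  have np : 0 < nrm2 a' b' by rewrite lt_neqAle eq_sym n0 nrm2_ge0.
  rewrite -(ler_pM2l np).
  have := nrm2_cauchy a' b' (a' - x') (b' - y').
  have := nrm2_cauchy a' b' x' y'; have := sqr_nrm2 a' b'; rewrite expr2; lra.
rewrite ler_norml; apply/andP; split; last exact: H.
rewrite lerNl opprB; apply: le_trans (H _ _ _ _) _.
by rewrite /nrm2 -[x - a]opprB -[y - b]opprB !sqrrN.
Qed.

(** Pair the integrand with the fixed vector (F, G) formed by the two integrals: Cauchy-Schwarz
    under the integral bounds |(F, G)|^2 by |(F, G)| times the right-hand side. *)
Lemma nrm2_Rintegral f g a b : segment_integrable f -> segment_integrable g ->
  segment_integrable (fun t => nrm2 (f t) (g t)) ->
  nrm2 (\int[mu]_(t in `[a, b]) f t) (\int[mu]_(t in `[a, b]) g t) <=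
  \int[mu]_(t in `[a, b]) nrm2 (f t) (g t).
Proof.
move=> fi gi ni; set F := \int[mu]_(t in _) f t; set G := \int[mu]_(t in _) g t.
have [n0|n0] := eqVneq (nrm2 F G) 0.
  by rewrite n0; apply: Rintegral_ge0 => t _; exact: nrm2_ge0.
have np : 0 < nrm2 F G by rewrite lt_neqAle eq_sym n0 nrm2_ge0.
have zi (c : R) (h : R -> R) : segment_integrable h -> segment_integrable (fun t => c * h t).
  by apply: segment_integrableM => z; exact: cvg_cst.
rewrite -(ler_pM2l np) -expr2 sqr_nrm2 !expr2 -!RintegralZl//.
rewrite -RintegralD//; last 2 first.
- exact: (zi _ _ fi).
- exact: (zi _ _ gi).
apply: le_Rintegral => //.
- exact: (segment_integrableD (zi _ _ fi) (zi _ _ gi)).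
- exact: (zi _ _ ni).
- by move=> t _; exact: nrm2_cauchy.
Qed.

Lemma weak_derivativeP f : H1 f ->
  weak_derivative f \in Lfun mu 2%:E /\ is_weak_derivative f (weak_derivative f).
Proof.
move=> [_ _ [g gL gw]]; rewrite /weak_derivative.
by case: xgetP => [h _ //|/(_ g)]; case.
Qed.

Lemma measurable_nrm2 f g : measurable_fun setT f -> measurable_fun setT g ->
  measurable_fun setT (fun x => nrm2 (f x) (g x)).
Proof.
move=> mf mg; apply: (@measurableT_comp _ _ _ _ _ _ (@Num.sqrt R)).
  by apply: continuous_measurable_fun; exact: sqrt_continuous.
by apply: measurable_funD; apply: measurable_funX.
Qed.

Lemma normcE2 (z : R[i]) : Normc.normc z = nrm2 (complex.Re z) (complex.Im z).
Proof. by case: z. Qed.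

Lemma integrable_nrm2_sqr f g :
  mu.-integrable setT (EFin \o (fun x => f x ^+ 2)) ->
  mu.-integrable setT (EFin \o (fun x => g x ^+ 2)) ->
  mu.-integrable setT (EFin \o (fun x => nrm2 (f x) (g x) ^+ 2)).
Proof.
move=> fi gi; apply: eq_integrable (integrableD _ fi gi) => //.
by move=> x _; rewrite /= sqr_nrm2.
Qed.

(** Integrated form of the inequality | |u|' | <= |u'|: the modulus of an increment bounds the
    increment of the modulus, and the increment is the integral of the vector u'. *)
Lemma H1C_speed_bounded (u : R -> R[i]) : H1C u ->
  speed_bounded (fun x => Normc.normc (u x))
    (fun x => Normc.normc (weak_derivativeC u x)).
Proof.
move=> [Hf Hg]; set f := fun x => complex.Re (u x) in Hf *.
set g := fun x => complex.Im (u x) in Hg *.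
have [dfL dfw] := weak_derivativeP Hf; have [dgL dgw] := weak_derivativeP Hg.
have [dfi dfm dfs] := Lfun2_segment_integrable dfL.
have [dgi dgm dgs] := Lfun2_segment_integrable dgL.
have [cf /Lfun2_segment_integrable [_ _ fs] _] := Hf.
have [cg /Lfun2_segment_integrable [_ _ gs] _] := Hg.
have -> : (fun x => Normc.normc (u x)) = (fun x => nrm2 (f x) (g x)).
  by apply/funext => x; rewrite normcE2.
have -> : (fun x => Normc.normc (weak_derivativeC u x)) =
    (fun x => nrm2 (weak_derivative f x) (weak_derivative g x)).
  by apply/funext => x; rewrite normcE2.
have mn := measurable_nrm2 dfm dgm.
have si : segment_integrable (fun x => nrm2 (weak_derivative f x) (weak_derivative g x)).
  move=> a b; have si := @integrableD _ _ _ mu `[a, b] (measurable_itv _) _ _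
    (integrable_norm (dfi a b)) (integrable_norm (dgi a b)).
  apply: (le_integrable _ _ _ si) => //.
    by apply/measurable_EFinP; apply: measurable_funS mn.
  move=> x _ /=; rewrite lee_fin ger0_norm ?nrm2_ge0// ger0_norm ?addr_ge0//.
  rewrite -(@ler_pXn2r _ 2)// ?nnegrE ?nrm2_ge0 ?addr_ge0// sqr_nrm2.
  rewrite sqrrD !real_normK ?num_real// lerD2r lerDl.
  by rewrite mulrn_wge0// mulr_ge0.
split => //.
- move=> x; apply: continuous_comp; last exact: sqrt_continuous.
  by apply: cvgD; apply: cvgM; (exact: cf || exact: cg).
- by move=> x; exact: nrm2_ge0.
- by move=> x; exact: nrm2_ge0.
- exact: integrable_nrm2_sqr.
- exact: integrable_nrm2_sqr.
- move=> x y xy; apply: le_trans (nrm2_dist _ _ _ _) _.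
  rewrite (weak_derivative_FTC cf dfi dfm dfw xy) (weak_derivative_FTC cg dgi dgm dgw xy).
  exact: nrm2_Rintegral.
Qed.

Lemma Rintegral_itv_le (k : R -> R) a b : (forall x, 0 <= k x) ->
  mu.-integrable setT (EFin \o k) ->
  \int[mu]_(t in `[a, b]) k t <= \int[mu]_t k t.
Proof.
move=> k0 ki; rewrite /Rintegral fine_le//.
- by apply: integrable_fin_num => //; exact: integrableS ki.
- exact: integrable_fin_num.
- apply: ge0_subset_integral => //; first by case/integrableP: ki.
  by move=> x _; rewrite lee_fin.
Qed.

(** The integrals over [-B, B] come within d of their supremum, which leaves less than d for any
    segment outside. *)
Lemma integral_tail (k : R -> R) (d : R) : (forall x, 0 <= k x) ->
  mu.-integrable setT (EFin \o k) -> 0 < d ->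
  exists2 B, 0 < B & forall a b, a <= b -> (B <= a) || (b <= - B) ->
    \int[mu]_(t in `[a, b]) k t < d.
Proof.
move=> k0 ki d0.
have ks : segment_integrable k by move=> a b; exact: integrableS ki.
pose S := [set x | exists2 B, 0 < B & x = \int[mu]_(t in `[- B, B]) k t].
have supS : has_sup S.
  split; first by exists (\int[mu]_(t in `[-1, 1]) k t), 1.
  by exists (\int[mu]_t k t) => _ [B _ ->]; exact: Rintegral_itv_le.
have [_ [B B0 ->] SB] := sup_adherent d0 supS.
have iS C : 0 < C -> \int[mu]_(t in `[- C, C]) k t <= sup S.
  by move=> C0; apply: ub_le_sup; [case: supS|exists C].
exists B => // a b ab aB.
pose C := Num.max B (Num.max `|a| `|b|).
have BC : B <= C by rewrite /C le_max lexx.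
have aC : `|a| <= C by rewrite /C !le_max lexx orbT.
have bC : `|b| <= C by rewrite /C !le_max lexx !orbT.
have := iS C (lt_le_trans B0 BC).
have nn x y : 0 <= \int[mu]_(t in `[x, y]) k t by apply: Rintegral_ge0.
move: aC bC; rewrite !ler_norml => /andP[a1 a2] /andP[b1 b2].
have C1 : - C <= - B by lra.
have C2 : - B <= C by lra.
have C3 : - B <= B by lra.
rewrite (Rintegral_itv_cat ks C1 C2) (Rintegral_itv_cat ks C3 BC).
(* J hides the integrals, so that [lra] sees them as atoms. *)
have [J JE] : exists J, forall p q, \int[mu]_(t in `[p, q]) k t = J p q by eexists.
have nJ p q : 0 <= J p q by rewrite -JE.
case/orP: aB => aB.
  rewrite (Rintegral_itv_cat ks aB a2) (Rintegral_itv_cat ks ab b2) !JE in SB *.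
  by have := nJ (- C) (- B); have := nJ B a; have := nJ b C; lra.
have aC : a <= - B by lra.
rewrite (Rintegral_itv_cat ks a1 aC) (Rintegral_itv_cat ks ab aB) !JE in SB *.
by have := nJ (- C) a; have := nJ B C; have := nJ b (- B); lra.
Qed.

(** Over an interval, v^2 varies by at most the integral of 2 v r, hence of v^2 + r^2. On a far unit
    interval this is below e^2 / 2, and somewhere on it v^2 itself is below e^2 / 2, being so on
    average. *)
Lemma speed_bounded_decay v r (e : R) : speed_bounded v r -> 0 < e ->
  exists2 B, 0 < B & forall x, B <= `|x| -> v x < e.
Proof.
move=> sb e0; pose k x := v x ^+ 2 + r x ^+ 2.
have k0 x : 0 <= k x by rewrite addr_ge0 ?sqr_ge0.
have ki : mu.-integrable setT (EFin \o k).
  by apply: eq_integrable (integrableD _ (sb_sqr sb) (sb_speed_sqr sb)) => //.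
have ks a b : mu.-integrable `[a, b] (EFin \o k) by exact: integrableS ki.
have d0 : 0 < e ^+ 2 / 2 by rewrite divr_gt0// exprn_gt0.
have [B B0 BP] := integral_tail k0 ki d0.
exists B => // x Bx.
(* The unit interval [a, a + 1] starts at x and leads away from the origin. *)
pose a := if 0 <= x then x else x - 1.
have axb : a <= x <= a + 1 by rewrite /a; case: ifP => _; lra.
have aB : (B <= a) || (a + 1 <= - B).
  move: Bx; rewrite /a; case: ifP => x0.
    by rewrite ger0_norm// => ->.
  have x1 : x < 0 by rewrite ltNge x0.
  by rewrite subrK (ltr0_norm x1) lerNr => ->; rewrite orbT.
have aa : a <= a + 1 by lra.
have Ik := BP _ _ aa aB.
have [w wa vw] : exists2 w, a <= w <= a + 1 & v w ^+ 2 < e ^+ 2 / 2.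
  apply: contrapT => nw.
  have : \int[mu]_(t in `[a, a + 1]) (e ^+ 2 / 2) <= \int[mu]_(t in `[a, a + 1]) k t.
    apply: le_Rintegral => //.
      by apply: continuous_segment_integrable => z; exact: cvg_cst.
    move=> w; rewrite /= in_itv/= => wa.
    apply: (@le_trans _ _ (v w ^+ 2)); last by rewrite lerDl sqr_ge0.
    by rewrite leNgt; apply/negP => vw; apply: nw; exists w.
  rewrite Rintegral_cst//.
  have -> : fine (mu `[a, a + 1]) = 1.
    have := congr1 fine (@lebesgue_measure_itv R `[a, a + 1]%R).
    by rewrite /= lte_fin ltrDl ltr01/= addrAC subrr add0r.
  by rewrite mulr1 leNgt Ik.
have key p q : p <= q -> a <= p -> q <= a + 1 ->
    `|v q ^+ 2 - v p ^+ 2| < e ^+ 2 / 2.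
  move=> pq ap qa.
  have c2 : continuous ((fun s : R => 2 * s) \o v).
    by move=> z; apply: cvgM; [exact: cvg_cst|exact: (sb_cont sb)].
  have dsq z : is_derive z 1 (fun s : R => s ^+ 2) (2 * z).
    by apply: (is_derive_eq (@is_deriveX _ _ id 2 z 1 1 _)); rewrite /GRing.scale/= mulr1.
  have := integral_chain_le pq (sb_cont sb) (sb_speed_int sb) (sb_speed_ge0 sb)
    (sb_le sb) (fun z => dsq (v z)) c2.
  move/le_lt_trans; apply; apply: le_lt_trans Ik.
  apply: (@le_trans _ _ (\int[mu]_(t in `[p, q]) k t)).
    apply: le_Rintegral => //.
      apply: (@segment_integrableM _ (fun t => `|2 * v t|)); last exact: (sb_speed_int sb).
      by move=> z; apply: cvg_norm; exact: c2.
    move=> t _; rewrite ger0_norm ?mulr_ge0// ?(sb_ge0 sb)// /k.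
    by have := sqr_ge0 (v t - r t); rewrite sqrrB; lra.
  rewrite /Rintegral fine_le//.
  - by apply: integrable_fin_num.
  - by apply: integrable_fin_num.
  apply: ge0_subset_integral => //.
  - by case/integrableP: (ks a (a + 1)).
  - by move=> t _; rewrite lee_fin.
  - by move=> t /=; rewrite !in_itv/= => /andP[pt tq]; apply/andP; split; lra.
have : v x ^+ 2 < e ^+ 2.
  have /andP[ax xb] := axb; have /andP[aw wb] := wa.
  have [xw|/ltW xw] := leP x w.
    by have := key _ _ xw ax wb; rewrite ltr_norml; lra.
  by have := key _ _ xw aw xb; rewrite ltr_norml; lra.
by rewrite ltr_pXn2r// nnegrE ?(sb_ge0 sb)// ltW.
Qed.

Lemma speed_bounded_max v r x0 : speed_bounded v r -> 0 < v x0 ->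
  exists x1, forall x, v x <= v x1.
Proof.
move=> sb v0; have [B B0 BP] := speed_bounded_decay sb v0.
have BB : - B <= B by lra.
have [x1 x1B x1P] := EVT_max BB (continuous_subspaceT (sb_cont sb)).
exists x1 => x; have [Bx|xB] := leP B `|x|.
  apply: (@le_trans _ _ (v x0)); first exact/ltW/BP.
  apply: x1P; rewrite in_itv/= -ler_norml leNgt; apply/negP => /ltW /BP.
  by rewrite ltxx.
by apply: x1P; rewrite in_itv/= -ler_norml ltW.
Qed.

(** The curve climbs from height nearly 0 to [v x] and comes back; each way costs at least
    [F (v x) - F 0], whence the factor 2. *)
Lemma speed_bounded_level v r (F f : R -> R) x : speed_bounded v r ->
  (forall s, is_derive s 1 F (f s)) -> continuous f -> (forall s, 0 <= f s) ->
  mu.-integrable setT (EFin \o (fun t => f (v t) * r t)) ->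
  2 * (F (v x) - F 0) <= \int[mu]_t (f (v t) * r t).
Proof.
move=> sb dF cf f0 ki; apply/ler_addgt0Pr => e e0.
have kk t : 0 <= f (v t) * r t by rewrite mulr_ge0// (sb_speed_ge0 sb).
have e20 : 0 < e / 2 by lra.
have cF : continuous F := is_derive_continuous dF.
have /cvgrPdist_lt /(_ _ e20) /nbhs_ballP [d /= d0 dP] := cF 0.
have [B B0 BP] := speed_bounded_decay sb d0.
have far y : B <= `|y| -> F (v y) - F 0 < e / 2.
  move=> /BP vy; have := dP (v y); rewrite /ball/= sub0r normrN ger0_norm ?(sb_ge0 sb)//.
  by move=> /(_ vy); rewrite distrC ltr_norml; lra.
pose a := Num.min x (- B); pose b := Num.max x B.
have ax : a <= x by rewrite /a ge_min lexx.
have xb : x <= b by rewrite /b le_max lexx.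
have aB : B <= `|a|.
  have : a <= - B by rewrite /a ge_min lexx orbT.
  by move=> ?; rewrite ler0_norm; lra.
have bB : B <= `|b|.
  have : B <= b by rewrite /b le_max lexx orbT.
  by move=> ?; rewrite ger0_norm; lra.
have cfv : continuous (f \o v).
  by move=> z; apply: continuous_comp; [exact: (sb_cont sb)|exact: cf].
have chain p q (pq : p <= q) := integral_chain_le pq (sb_cont sb) (sb_speed_int sb)
  (sb_speed_ge0 sb) (sb_le sb) (fun z => dF (v z)) cfv.
have ab : a <= b by lra.
have := Rintegral_itv_le a b kk ki.
rewrite (@Rintegral_itv_cat _ _ a x b)//; last first.
  by move=> p q; exact: integrableS ki.
have := chain _ _ ax; have := chain _ _ xb.
have nE p q : \int[mu]_(t in `[p, q]) (`|f (v t)| * r t) =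
    \int[mu]_(t in `[p, q]) (f (v t) * r t).
  by apply: eq_Rintegral => t _; rewrite ger0_norm.
rewrite !nE !ler_norml; have := far _ aB; have := far _ bB; lra.
Qed.

(* Completing the square in the action density: the defect of the calibration
   inequality is the squared [L^2] norm of [r - f v]. *)
Lemma speed_bounded_action v r (F f : R -> R) x : speed_bounded v r ->
  (forall s, is_derive s 1 F (f s)) -> continuous f -> (forall s, 0 <= f s) ->
  mu.-integrable setT (EFin \o (fun t => f (v t) ^+ 2)) ->
  mu.-integrable setT (EFin \o (fun t => (r t - f (v t)) ^+ 2)) /\
  4 * (F (v x) - F 0) + \int[mu]_t ((r t - f (v t)) ^+ 2) <=
  \int[mu]_t (r t ^+ 2) + \int[mu]_t (f (v t) ^+ 2).
Proof.
move=> sb dF cf f0 f2i; have r2i := sb_speed_sqr sb.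
have cfv : continuous (f \o v).
  by move=> z; apply: continuous_comp; [exact: (sb_cont sb)|exact: cf].
have mfv := continuous_measurable_fun cfv.
have mr := sb_speed_meas sb.
have si := @integrableD _ _ _ mu setT measurableT _ _ r2i f2i.
have ki : mu.-integrable setT (EFin \o (fun t => f (v t) * r t)).
  apply: (le_integrable _ _ _ si) => //.
    by apply/measurable_EFinP; exact: measurable_funM.
  move=> t _; rewrite /= lee_fin ger0_norm ?mulr_ge0 ?(sb_speed_ge0 sb)//.
  rewrite ger0_norm ?addr_ge0 ?sqr_ge0//.
  by have := sqr_ge0 (r t - f (v t)); rewrite sqrrB;
    have := sqr_ge0 (r t + f (v t)); rewrite sqrrD; lra.
have k2i : mu.-integrable setT (EFin \o (fun t => 2 * (f (v t) * r t))).
  by apply: eq_integrable (integrableZl _ 2 ki).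
have di : mu.-integrable setT (EFin \o (fun t => (r t - f (v t)) ^+ 2)).
  apply: eq_integrable (integrableB _ si k2i) => // t _ /=.
  by congr EFin; ring.
split => //.
have -> : \int[mu]_t ((r t - f (v t)) ^+ 2) =
    \int[mu]_t (r t ^+ 2) + \int[mu]_t (f (v t) ^+ 2) -
    2 * \int[mu]_t (f (v t) * r t).
  rewrite -RintegralZl// -RintegralD// -RintegralB//.
  by apply: eq_Rintegral => t _; ring.
have := speed_bounded_level x sb dF cf f0 ki; lra.
Qed.

End curves.

(** * Profiles as functions of their height *)

Section powers.
Context {R : realType}.
Implicit Types (k l s t x : R).

Lemma is_derive_powR_norm k s : 0 < s ->
  is_derive s 1 (fun x : R => `|x| `^ k) (k * s `^ (k - 1)).
Proof.
move=> s0; have d := is_derive1_powR k s0; apply: near_eq_is_derive d.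
near=> x; rewrite ger0_norm//; apply/ltW; near: x; exact: lt_nbhsr.
Unshelve. all: end_near. Qed.

Lemma continuous_powR_norm k : 0 < k -> continuous (fun s : R => `|s| `^ k).
Proof.
move=> k0 s; have [->|s0] := eqVneq s 0.
  apply/cvgrPdist_lt => e e0; rewrite normr0 powR0 ?gt_eqF//.
  apply/nbhs_ballP; exists (e `^ k^-1); first exact: powR_gt0.
  move=> x; rewrite /ball/= !sub0r !normrN => xe.
  rewrite ger0_norm ?powR_ge0//.
  have -> : e = (e `^ k^-1) `^ k by rewrite -powRrM mulVf ?gt_eqF// powRr1// ltW.
  by rewrite gt0_ltr_powR// nnegrE// ltW// powR_gt0.
have ns0 : 0 < `|s| by rewrite normr_gt0.
have [dpow _] := is_derive1_powR k ns0.
have c : {for `|s|, continuous (fun x : R => x `^ k)}.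
  by apply: differentiable_continuous; exact/derivable1_diffP.
exact: (cvg_comp _ _ (@norm_continuous _ _ s) c).
Qed.

(** Difference quotient of the k-th power between t and 1; the value k at t = 1 is its limit, which
    makes it continuous. *)
Definition quot k t := if t == 1 then k else (1 - `|t| `^ k) / (1 - t).

Lemma quotE k t : (1 - t) * quot k t = 1 - `|t| `^ k.
Proof.
rewrite /quot; case: eqVneq => [->|t1].
  by rewrite normr1 powR1 !subrr mul0r.
by rewrite mulrC divfK// subr_eq0 eq_sym.
Qed.

Lemma continuous_quot k : 0 < k -> continuous (quot k).
Proof.
move=> k0 t; have [->|t1] := eqVneq t 1.
  have /is_derive1_caratheodory [h [hE hC h1]] := is_derive_powR_norm k (@ltr01 R).
  have -> : quot k = h.
    apply/funext => z; rewrite /quot; case: eqVneq => [->|z1].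
      by rewrite h1 powR1 mulr1.
    have z1' : z - 1 != 0 by rewrite subr_eq0.
    have := hE z; rewrite normr1 powR1 => e.
    by rewrite -[1 - _]opprB e -[1 - z]opprB invrN mulrNN mulfK.
  exact: hC.
have t1' : 1 - t != 0 by rewrite subr_eq0 eq_sym.
have c : (fun z => (1 - `|z| `^ k) / (1 - z)) @ t --> (1 - `|t| `^ k) / (1 - t).
  apply: cvgM.
    by apply: cvgB; [exact: cvg_cst|exact: continuous_powR_norm].
  by apply: cvgV => //; apply: cvgB; [exact: cvg_cst|exact: cvg_id].
rewrite /continuous_at {2}/quot (negbTE t1).
apply: cvg_trans c; apply: near_eq_cvg.
near=> z; rewrite /quot ifF//; apply/negbTE.
near: z; apply/nbhs_ballP; exists `|1 - t|; first by rewrite /= normr_gt0.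
by move=> z; rewrite /ball/= => zt; apply: contraTneq zt => ->; rewrite distrC ltxx.
Unshelve. all: end_near. Qed.

Lemma quot_gt0 k t : 0 < k -> 0 <= t <= 1 -> 0 < quot k t.
Proof.
move=> k0 /andP[t0 t1]; rewrite /quot; case: eqVneq => // tn1.
have {tn1}t1 : t < 1 by rewrite lt_neqAle tn1.
rewrite divr_gt0 ?subr_gt0// ger0_norm// -[X in _ < X](congr1 (@^~ k) (@powR1 R)).
by rewrite gt0_ltr_powR// nnegrE.
Qed.

(* Young's inequality with second factor [1] is Bernoulli's inequality. *)
Lemma quot_le k l t : 0 < k -> k < l -> 0 <= t <= 1 ->
  k * quot l t <= l * quot k t.
Proof.
move=> k0 kl /andP[t0 t1]; have l0 : 0 < l by exact: lt_trans kl.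
have [->|tn1] := eqVneq t 1; first by rewrite /quot eqxx mulrC.
have {tn1}t1' : 0 < 1 - t by rewrite subr_gt0 lt_neqAle tn1.
rewrite -(ler_pM2l t1') mulrCA [leRHS]mulrCA !quotE ger0_norm//.
have kn0 : k != 0 by rewrite gt_eqF.
have ln0 : l != 0 by rewrite gt_eqF.
have lkn0 : l - k != 0 by rewrite subr_eq0 gt_eqF.
have := @conjugate_powR R (t `^ k) 1 (l / k) (l / (l - k)).
rewrite powR_ge0 ler01 !divr_gt0 ?subr_gt0// mulr1 powR1.
have -> : (l / k)^-1 + (l / (l - k))^-1 = 1 by field; rewrite kn0 ln0 lkn0.
move=> /(_ isT isT isT isT erefl).
rewrite -powRrM.
have -> : k * (l / k) = l by field.
move=> young.
have : l * t `^ k <= l * (t `^ l / (l / k) + 1 / (l / (l - k))) by rewrite ler_pM2l.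
have -> : l * (t `^ l / (l / k) + 1 / (l / (l - k))) = k * t `^ l + (l - k).
  by field; rewrite kn0 ln0 lkn0.
lra.
Qed.

(** First-order bound at t = 1, from t^k >= 1 + k ln t and - ln t <= (1 - t) / t; on [1/2, 1] one
    has 1/t <= 1 + 2 (1 - t). *)
Lemma quot_upper k t : 0 < k -> 2^-1 <= t <= 1 ->
  quot k t <= k + 2 * k * (1 - t).
Proof.
move=> k0 /andP[t0 t1]; have [->|tn1] := eqVneq t 1.
  by rewrite /quot eqxx subrr mulr0 addr0.
have t1' : 0 < 1 - t by rewrite subr_gt0 lt_neqAle tn1.
have tp : 0 < t by lra.
rewrite -(ler_pM2l t1') quotE gtr0_norm//.
have h1 : 1 + k * ln t <= t `^ k.
  by rewrite /powR gt_eqF//; exact: expR_ge1Dx.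
have h2 : - ln t <= t^-1 - 1.
  have := @le_ln1Dx R (t^-1 - 1).
  have -> : 1 + (t^-1 - 1) = t^-1 by ring.
  rewrite lnV// ltrBrDl subrr invr_gt0; exact.
have h3 : k * (- ln t) <= k * (t^-1 - 1) by rewrite ler_pM2l.
have h4 : t^-1 - 1 <= 2 * (1 - t).
  rewrite -(ler_pM2l tp) mulrBr mulfV ?gt_eqF//; nra.
have h5 : t^-1 - 1 = (1 - t) * t^-1 by field; rewrite gt_eqF.
have h6 : t^-1 <= 1 + 2 * (1 - t).
  by lra.
have h7 : (1 - t) * t^-1 <= (1 - t) * (1 + 2 * (1 - t)) by rewrite ler_pM2l.
have : k * (t^-1 - 1) <= k * ((1 - t) * (1 + 2 * (1 - t))).
  by rewrite ler_pM2l// h5.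
lra.
Qed.

(** With y = l (1 - t), the exponential bound gives t^l (1 + y) <= 1, and then 1 - t^l >= y -
    y^2. *)
Lemma quot_lower l t : 0 < l -> 2^-1 <= t <= 1 ->
  l - l ^+ 2 * (1 - t) <= quot l t.
Proof.
move=> l0 /andP[t0 t1]; have [->|tn1] := eqVneq t 1.
  by rewrite /quot eqxx subrr mulr0 subr0.
have t1' : 0 < 1 - t by rewrite subr_gt0 lt_neqAle tn1.
have tp : 0 < t by lra.
rewrite -(ler_pM2l t1') quotE gtr0_norm//.
have h1 : ln t <= t - 1.
  have := @le_ln1Dx R (t - 1).
  by rewrite [1 + _]addrC subrK; apply; lra.
have h2 : 1 + l * (1 - t) <= (t `^ l)^-1.
  rewrite -powRN /powR gt_eqF//; apply: le_trans (expR_ge1Dx _).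
  by rewrite lerD2l mulNr -mulrN ler_pM2l; lra.
have h3 : 0 < t `^ l by rewrite powR_gt0.
have h4 : t `^ l * (1 + l * (1 - t)) <= 1.
  by rewrite -ler_pdivlMl// mulr1.
have y0 : 0 < l * (1 - t) by rewrite mulr_gt0.
set y := l * (1 - t) in h4 y0; set w := t `^ l in h3 h4 *.
have -> : (1 - t) * (l - l ^+ 2 * (1 - t)) = y - y ^+ 2 by rewrite /y; ring.
clearbody y w; nra.
Qed.

End powers.

(** * Mass of a profile of given height *)

Section profile.
Context {R : realType}.
Notation mu := (@lebesgue_measure R).
Variables (A B k l : R).
Hypotheses (A0 : 0 < A) (B0 : 0 < B) (k0 : 0 < k) (k4 : k < 4) (kl : k < l).
Implicit Types (m n s t tau x z : R).

Let l0 : 0 < l. Proof. exact: lt_trans kl. Qed.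

(* The potential is [G s = - s ^ 2 * pot s / 2]; [pot1 s] is [s] times the
   derivative of [pot]. *)
Definition pot s := A * `|s| `^ k - B * `|s| `^ l.
Definition pot1 s := A * k * `|s| `^ k - B * l * `|s| `^ l.
(** The factor left in [pot1 m] after m^k is taken out. It is strictly decreasing and carries the
    sign of the derivative of [pot]; its value tells how far the height m is from [hmax]. *)
Definition slope m := A * k - B * l * m `^ (l - k).

(* the largest height of a bound state: the point where [pot] is maximal *)
Definition hmax := (A * k / (B * l)) `^ (l - k)^-1.

Lemma continuous_pot : continuous pot.
Proof.
move=> s; apply: cvgB; apply: cvgM;
  (exact: cvg_cst || exact: continuous_powR_norm).
Qed.

Lemma continuous_pot1 : continuous pot1.
Proof.
move=> s; apply: cvgB; apply: cvgM;
  (exact: cvg_cst || exact: continuous_powR_norm).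
Qed.

Lemma is_derive_pot s : 0 < s -> is_derive s 1 pot (pot1 s / s).
Proof.
move=> s0; have dk := is_derive_powR_norm k s0; have dl := is_derive_powR_norm l s0.
have dA := @is_deriveM _ _ (cst A) _ s 1 0 _ (is_derive_cst _ _ _) dk.
have dB := @is_deriveM _ _ (cst B) _ s 1 0 _ (is_derive_cst _ _ _) dl.
apply: (is_derive_eq (is_deriveB _ _)) => /=.
rewrite !scaler0 !addr0 /GRing.scale/= /pot1 gtr0_norm// mulrBl.
have sn0 : s != 0 by rewrite gt_eqF.
by rewrite !powRB ?sn0 ?implybT// !powRr1 ?ltW//; ring.
Qed.

Lemma hmax_gt0 : 0 < hmax.
Proof. by apply: powR_gt0; rewrite divr_gt0// mulr_gt0. Qed.

Lemma pot1E s : 0 < s -> pot1 s = s `^ k * slope s.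
Proof.
move=> s0; rewrite /pot1 /slope gtr0_norm//.
have -> : s `^ l = s `^ k * s `^ (l - k).
  by rewrite -powRD ?(gt_eqF s0) ?implybT// addrC subrK.
ring.
Qed.

Lemma slope_hmax : slope hmax = 0.
Proof.
rewrite /slope /hmax -powRrM mulVf ?subr_eq0 ?gt_eqF// powRr1; last first.
  by rewrite divr_ge0// mulr_ge0// ltW.
by field; rewrite !gt_eqF.
Qed.

Lemma slope_lt s t : 0 <= s -> s < t -> slope t < slope s.
Proof.
move=> s0 st; rewrite /slope ltrD2l ltrN2 ltr_pM2l ?mulr_gt0//.
by rewrite gt0_ltr_powR ?subr_gt0// nnegrE// ltW// (le_lt_trans s0).
Qed.

Lemma slope_gt0 s : 0 <= s < hmax -> 0 < slope s.
Proof. by move=> /andP[s0 sh]; rewrite -slope_hmax slope_lt. Qed.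

Lemma pot1_gt0 s : 0 < s < hmax -> 0 < pot1 s.
Proof.
move=> /andP[s0 sh]; rewrite pot1E// mulr_gt0 ?powR_gt0//.
by rewrite slope_gt0// (ltW s0).
Qed.

Lemma pot_lt s t : 0 <= s -> s < t -> t <= hmax -> pot s < pot t.
Proof.
move=> s0 st th; rewrite -subr_gt0.
have dp x : x \in `]s, t[%R -> is_derive x 1 pot (pot1 x / x).
  by rewrite in_itv/= => /andP[sx _]; apply: is_derive_pot; exact: le_lt_trans sx.
have [c] := MVT st dp (continuous_subspaceT continuous_pot).
rewrite in_itv/= => /andP[sc ct] ->.
have c0 : 0 < c by exact: le_lt_trans sc.
rewrite mulr_gt0 ?subr_gt0// divr_gt0// pot1_gt0// c0.
exact: lt_le_trans th.
Qed.

Lemma pot_le s t : 0 <= s -> s <= t -> t <= hmax -> pot s <= pot t.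
Proof.
move=> s0; rewrite le_eqVlt => /predU1P[->//|st] th.
exact/ltW/pot_lt.
Qed.

Lemma pot_le_hmax s : 0 <= s -> pot s <= pot hmax.
Proof.
move=> s0; have [sh|hs] := leP s hmax; first exact: pot_le.
have dp x : x \in `]hmax, s[%R -> is_derive x 1 pot (pot1 x / x).
  rewrite in_itv/= => /andP[sx _]; apply: is_derive_pot.
  exact: lt_trans hmax_gt0 sx.
have [c] := MVT hs dp (continuous_subspaceT continuous_pot).
rewrite in_itv/= => /andP[hc _] e.
have c0 : 0 < c by exact: lt_trans hmax_gt0 hc.
rewrite -subr_le0 e mulr_le0_ge0//; last by rewrite subr_ge0 ltW.
rewrite mulr_le0_ge0// ?invr_ge0 ?(ltW c0)// pot1E//.
rewrite mulr_ge0_le0 ?powR_ge0// -slope_hmax ltW// slope_lt//.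
exact/ltW/hmax_gt0.
Qed.

(* [tau] parametrizes the profile of height [m] as [m * clip tau]; the clipping
   only makes the formulas continuous on the whole line. *)
Definition clip tau := Num.max 0 (1 - tau ^+ 2).

Lemma clipE tau : -1 <= tau <= 1 -> clip tau = 1 - tau ^+ 2.
Proof.
move=> t1; apply/max_r; rewrite subr_ge0 -(expr1n _ 2).
by rewrite -real_normK ?num_real// ler_pXn2r ?nnegrE// ler_norml.
Qed.

Lemma clip_01 tau : 0 <= clip tau <= 1.
Proof. by rewrite /clip le_max lexx ge_max ler01/= gerBl sqr_ge0. Qed.

Lemma continuous_clip : continuous clip.
Proof.
move=> tau; have c : {for tau, continuous (fun x : R => 1 - x ^+ 2)}.
  by apply: cvgB; [exact: cvg_cst|exact: exprn_continuous].
by apply: (@continuous_max _ _ (cst 0) _ tau _ c); exact: cst_continuous.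
Qed.

(** [pot m - pot (m * clip tau)] divided by tau^2, written so that it makes sense at tau = 0, where
    it equals [pot1 m] for m > 0. Below [hmax] it is continuous and positive, which removes the
    singularity at the top of the profile. *)
Definition disc m tau :=
  A * m `^ k * quot k (clip tau) - B * m `^ l * quot l (clip tau).

Lemma continuous_disc m : continuous (disc m).
Proof.
have c q : 0 < q -> continuous (fun tau => quot q (clip tau)).
  move=> q0 tau; apply: continuous_comp; first exact: continuous_clip.
  exact: continuous_quot.
by move=> tau; apply: cvgB; apply: cvgM; (exact: cvg_cst || exact: c).
Qed.

Lemma discE m tau : 0 < m -> -1 <= tau <= 1 ->
  tau ^+ 2 * disc m tau = pot m - pot (m * clip tau).
Proof.
move=> m0 t1; rewrite /disc /pot normrM (gtr0_norm m0).
rewrite !(powRM _ (ltW m0) (normr_ge0 _)).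
have e q : tau ^+ 2 * quot q (clip tau) = 1 - `|clip tau| `^ q.
  by rewrite -quotE {2}clipE// opprB addrCA subrr addr0.
have -> : tau ^+ 2 * (A * m `^ k * quot k (clip tau) - B * m `^ l * quot l (clip tau))
  = A * m `^ k * (tau ^+ 2 * quot k (clip tau))
    - B * m `^ l * (tau ^+ 2 * quot l (clip tau)) by ring.
by rewrite !e; ring.
Qed.

(** [quot_le] trades the quotient of exponent l for the one of exponent k; the coefficients then
    combine into [slope m], so positivity below [hmax] follows. *)
Lemma disc_ge m tau : 0 < m -> m `^ k * quot k (clip tau) * slope m / k <= disc m tau.
Proof.
move=> m0; rewrite /disc /slope.
have -> : m `^ l = m `^ k * m `^ (l - k).
  by rewrite -powRD ?(gt_eqF m0) ?implybT// addrC subrK.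
have q := quot_le k0 kl (clip_01 tau).
rewrite ler_pdivrMr// -subr_ge0.
have -> : (A * m `^ k * quot k (clip tau) - B * (m `^ k * m `^ (l - k)) *
     quot l (clip tau)) * k - m `^ k * quot k (clip tau) * (A * k - B * l * m `^ (l - k))
  = B * m `^ k * m `^ (l - k) * (l * quot k (clip tau) - k * quot l (clip tau)) by ring.
by rewrite !mulr_ge0 ?powR_ge0 ?subr_ge0// ltW.
Qed.

Lemma disc_gt0 m tau : 0 < m < hmax -> 0 < disc m tau.
Proof.
move=> /andP[m0 mh]; apply: lt_le_trans (disc_ge _ m0).
by rewrite !mulr_gt0 ?powR_gt0 ?quot_gt0 ?clip_01 ?invr_gt0// slope_gt0// (ltW m0).
Qed.

(** The attractive term scales exactly like m^k; the repulsive one grows faster, like m^l, and is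
    subtracted. *)
Lemma disc_scale m n tau : 0 < m <= n -> disc n tau <= (n / m) `^ k * disc m tau.
Proof.
move=> /andP[m0 mn]; have n0 : 0 < n by exact: lt_le_trans mn.
rewrite powRM ?invr_ge0 ?(ltW m0) ?(ltW n0)//.
have mk0 : 0 < m `^ k by exact: powR_gt0.
have nk0 : 0 < n `^ k by exact: powR_gt0.
have -> : m^-1 `^ k = (m `^ k)^-1.
  by rewrite -powR_inv1 ?(ltW m0)// powRAC powR_inv1// powR_ge0.
have e x : 0 < x -> x `^ l = x `^ k * x `^ (l - k).
  by move=> x0; rewrite -powRD ?(gt_eqF x0) ?implybT// addrC subrK.
rewrite /disc (e m m0) (e n n0).
have -> : n `^ k / m `^ k * (A * m `^ k * quot k (clip tau) -
    B * (m `^ k * m `^ (l - k)) * quot l (clip tau)) =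
  A * n `^ k * quot k (clip tau) - B * (n `^ k * m `^ (l - k)) * quot l (clip tau).
  by field; rewrite gt_eqF.
rewrite lerD2l lerN2 ler_wpM2r ?(ltW (quot_gt0 _ (clip_01 _)))//.
rewrite ler_pM2l// ler_pM2l//.
by apply: ge0_ler_powR; rewrite ?nnegrE ?(ltW m0) ?(ltW n0)// subr_ge0 ltW.
Qed.

Definition mass_integrand m tau := clip tau / Num.sqrt (disc m tau).

Lemma continuous_sqrt_disc m : continuous (fun tau => Num.sqrt (disc m tau)).
Proof.
move=> tau; apply: continuous_comp; first exact: continuous_disc.
exact: sqrt_continuous.
Qed.

Lemma continuous_mass_integrand m : 0 < m < hmax -> continuous (mass_integrand m).
Proof.
move=> m0 tau; apply: cvgM; first exact: continuous_clip.
apply: cvgV; last exact: continuous_sqrt_disc.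
by rewrite gt_eqF// sqrtr_gt0 disc_gt0.
Qed.

Lemma mass_integrand_ge0 m tau : 0 <= mass_integrand m tau.
Proof. by rewrite divr_ge0 ?sqrtr_ge0//; case/andP: (clip_01 tau). Qed.

(** Twice the integral of s / sqrt (pot m - pot s) over [0, m], after the substitution s = m (1 -
    tau^2). This is the integral of Q^2 for a profile with |Q'| = Q sqrt (pot m - pot Q), each half
    contributing ds / |Q'|. *)
Definition profile_mass m := 4 * m ^+ 2 * \int[mu]_(t in `[0, 1]) mass_integrand m t.

Lemma profile_mass_gt0 m : 0 < m < hmax -> 0 < profile_mass m.
Proof.
move=> mh; have /andP[m0 _] := mh.
have ci := continuous_mass_integrand mh.
rewrite !mulr_gt0 ?exprn_gt0//.
rewrite Rintegral_primitive//; last exact: continuous_segment_integrable.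
have dP x : is_derive x 1 (primitive (mass_integrand m)) (mass_integrand m x).
  by apply: is_derive_primitive (ci x); exact: continuous_segment_integrable.
have [c] := MVT (@ltr01 R) (fun x _ => dP x)
  (continuous_subspaceT (primitive_continuous ci)).
rewrite in_itv/= => /andP[c0 c1] ->; rewrite subr0 mulr1.
rewrite divr_gt0 ?sqrtr_gt0 ?disc_gt0// clipE; last by rewrite (ltW c1); lra.
by rewrite subr_gt0 expr_lt1// ltW.
Qed.

(** The prefactor contributes (n/m)^2 and the root of [disc_scale] takes back at most (n/m)^(k/2).
    The exponent 2 - k/2 is positive exactly when k < 4. *)
Lemma profile_mass_scale m n : 0 < m -> m <= n -> n < hmax ->
  (n / m) `^ (2 - k / 2) * profile_mass m <= profile_mass n.
Proof.
move=> m0 mn nh; have n0 : 0 < n by exact: lt_le_trans mn.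
have mh : 0 < m < hmax by rewrite m0 (le_lt_trans mn).
have nh' : 0 < n < hmax by rewrite n0.
have im := continuous_mass_integrand mh; have in' := continuous_mass_integrand nh'.
pose c := (n / m) `^ (k / 2).
have nm0 : 0 < n / m by rewrite divr_gt0.
have c0 : 0 < c by exact: powR_gt0.
have H tau : mass_integrand m tau <= c * mass_integrand n tau.
  rewrite /mass_integrand mulrCA ler_wpM2l//; first by case/andP: (clip_01 tau).
  rewrite ler_pdivlMr ?sqrtr_gt0 ?disc_gt0// mulrC ler_pdivrMr ?sqrtr_gt0 ?disc_gt0//.
  apply: (@le_trans _ _ (Num.sqrt ((n / m) `^ k * disc m tau))).
    by rewrite ler_sqrt ?mulr_ge0 ?powR_ge0 ?(ltW (disc_gt0 _ _))// disc_scale// m0.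
  by rewrite sqrtrM ?powR_ge0// -powR12_sqrt ?powR_ge0// -powRrM.
have -> : (n / m) `^ (2 - k / 2) = n ^+ 2 / m ^+ 2 / c.
  rewrite powRB ?(gt_eqF nm0) ?implybT// -expr_div_n; congr (_ / _).
  by rewrite powR_mulrn// ltW.
rewrite /profile_mass.
set I := \int[mu]_(t in _) _; set J := \int[mu]_(t in _) _.
have IJ : I <= c * J.
  rewrite /J -RintegralZl//; last exact: continuous_segment_integrable.
  apply: le_Rintegral => //; first exact: continuous_segment_integrable.
  apply: continuous_segment_integrable => z.
  by apply: cvgM; [exact: cvg_cst|exact: in'].
have -> : n ^+ 2 / m ^+ 2 / c * (4 * m ^+ 2 * I) = 4 * n ^+ 2 * (I / c).
  by field; rewrite gt_eqF// gt_eqF.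
by rewrite ler_pM2l ?mulr_gt0 ?exprn_gt0// ler_pdivrMr// mulrC.
Qed.

Lemma profile_mass_lt m n : 0 < m -> m < n -> n < hmax ->
  profile_mass m < profile_mass n.
Proof.
move=> m0 mn nh; apply: lt_le_trans (profile_mass_scale m0 (ltW mn) nh).
rewrite -[X in X < _]mul1r ltr_pM2r ?profile_mass_gt0 ?m0 ?(lt_trans mn)//.
have e0 : 0 < 2 - k / 2 by have := k4; lra.
have n1 : 1 < n / m by rewrite ltr_pdivlMr// mul1r.
have := @gt0_ltr_powR _ _ e0 1 (n / m); rewrite powR1; apply=> //; rewrite nnegrE ?ler01//.
exact: le_trans ler01 (ltW n1).
Qed.

Lemma profile_mass_small (c : R) : 0 < c -> exists m, 0 < m < hmax /\ profile_mass m < c.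
Proof.
move=> c0; have h0 := hmax_gt0; pose n := hmax / 2.
have n0 : 0 < n by rewrite /n; lra.
have nh : n < hmax by rewrite /n; lra.
have N0 : 0 < profile_mass n by rewrite profile_mass_gt0// n0.
pose e := 2 - k / 2; have e0 : 0 < e by rewrite /e; have := k4; lra.
(* Chosen so that x^(2 - k/2) exceeds [profile_mass n / c]: shrinking the height n by the factor x
   brings the mass below c. *)
pose x := 1 + (profile_mass n / c) `^ e^-1.
have y0 : 0 < profile_mass n / c by rewrite divr_gt0.
have z0 : 0 < (profile_mass n / c) `^ e^-1 by rewrite powR_gt0.
have x1 : 1 <= x by rewrite /x; lra.
have x0 : 0 < x by lra.
exists (n / x); have nx0 : 0 < n / x by rewrite divr_gt0.
have nxn : n / x <= n by rewrite ler_pdivrMr// ler_pMr.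
split; first by rewrite nx0 (le_lt_trans nxn).
have := profile_mass_scale nx0 nxn nh.
have -> : n / (n / x) = x by field; rewrite !gt_eqF.
rewrite -/e => H.
have xe : profile_mass n / c < x `^ e.
  have ze : (profile_mass n / c) = ((profile_mass n / c) `^ e^-1) `^ e.
    by rewrite -powRrM mulVf ?(gt_eqF e0)// powRr1// (ltW y0).
  rewrite ze; apply: gt0_ltr_powR => //; rewrite ?nnegrE ?(ltW z0) ?(ltW x0)//.
  by rewrite /x ltrDr.
have xe0 : 0 < x `^ e by rewrite powR_gt0.
rewrite -(ltr_pM2l xe0); apply: (le_lt_trans H).
by rewrite -ltr_pdivrMr.
Qed.

End profile.

(** * Divergence of the mass at the maximal height *)

Section profile_mass_large.
Context {R : realType}.
Variables (A B k l : R).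
Hypotheses (A0 : 0 < A) (B0 : 0 < B) (k0 : 0 < k) (k4 : k < 4) (kl : k < l).
Implicit Types (m n s t tau x z : R).

Let l0 : 0 < l. Proof. exact: lt_trans kl. Qed.
Let hm0 : 0 < hmax A B k l. Proof. exact: hmax_gt0. Qed.

(** Inverse of [slope], with value [hmax] at d = 0: heights near the top are parametrized by their
    small slope. *)
Definition height_of_slope (d : R) := ((A * k - d) / (B * l)) `^ (l - k)^-1.

Lemma slope_height (d : R) : 0 <= d <= A * k -> slope A B k l (height_of_slope d) = d.
Proof.
move=> /andP[d0 dk]; rewrite /slope /height_of_slope -powRrM.
have lk : l - k != 0 by rewrite subr_eq0 gt_eqF.
rewrite mulVf// powRr1; last by rewrite divr_ge0 ?subr_ge0// mulr_ge0// ltW.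
by field; rewrite !gt_eqF.
Qed.

Lemma height_of_slope_le (d e : R) : 0 <= d -> d <= e -> e <= A * k ->
  height_of_slope e <= height_of_slope d.
Proof.
move=> d0 de ek; apply: ge0_ler_powR.
- by rewrite invr_ge0 subr_ge0 ltW.
- by rewrite nnegrE divr_ge0 ?subr_ge0// mulr_ge0// ltW.
- by rewrite nnegrE divr_ge0 ?subr_ge0 ?(le_trans de)// mulr_ge0// ltW.
- by rewrite ler_pM2r ?invr_gt0 ?mulr_gt0// lerD2l lerN2.
Qed.

(** First-order expansion of both quotients at 1 - clip tau = tau^2. The constants 2 A k and A k l
    come from [quot_upper] and [quot_lower], the latter with B l m^(l-k) <= A k, so they do not
    depend on m. *)
Lemma disc_le_near_top m tau : 0 < m <= hmax A B k l -> 0 <= tau <= 2^-1 ->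
  disc A B k l m tau <=
  m `^ k * (slope A B k l m + (2 * A * k + A * k * l) * tau ^+ 2).
Proof.
move=> /andP[m0 mh] /andP[t0 t1].
have t11 : -1 <= tau <= 1 by apply/andP; split; lra.
have tt : tau ^+ 2 <= 2^-1 by nra.
have t20 := sqr_ge0 tau.
have cE := clipE t11.
have c1 : 2^-1 <= clip tau <= 1 by rewrite cE; apply/andP; split; lra.
have qk := quot_upper k0 c1; have ql := quot_lower l0 c1.
have e1 : 1 - clip tau = tau ^+ 2 by rewrite cE; ring.
rewrite e1 in qk ql.
rewrite /disc.
have -> : m `^ l = m `^ k * m `^ (l - k).
  by rewrite -powRD ?(gt_eqF m0) ?implybT// addrC subrK.
set w := m `^ (l - k).
have w0 : 0 <= w by exact: powR_ge0.
have wl : B * l * w <= A * k.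
  rewrite -subr_ge0 -/(slope A B k l m).
  move: mh; rewrite le_eqVlt => /predU1P[->|mh]; first by rewrite slope_hmax.
  by apply: ltW; apply: slope_gt0 => //; rewrite (ltW m0).
have -> : A * m `^ k * quot k (clip tau) - B * (m `^ k * w) * quot l (clip tau) =
  m `^ k * (A * quot k (clip tau) - B * w * quot l (clip tau)) by ring.
rewrite ler_wpM2l ?powR_ge0// /slope -/w.
have h1 : A * quot k (clip tau) <= A * (k + 2 * k * tau ^+ 2) by rewrite ler_wpM2l// ltW.
have h2 : B * w * (l - l ^+ 2 * tau ^+ 2) <= B * w * quot l (clip tau).
  by rewrite ler_wpM2l// mulr_ge0// ltW.
have h3 : B * l * w * (l * tau ^+ 2) <= A * k * (l * tau ^+ 2).
  by rewrite ler_wpM2r// mulr_ge0// ltW.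
set X := A * quot k _ in h1 *; set Y := B * w * quot l _ in h2 *.
have e2 : B * w * (l - l ^+ 2 * tau ^+ 2) = B * l * w - B * l * w * (l * tau ^+ 2) by ring.
rewrite e2 in h2.
have -> : A * k - B * l * w + (2 * A * k + A * k * l) * tau ^+ 2 =
  A * (k + 2 * k * tau ^+ 2) - B * l * w + A * k * (l * tau ^+ 2) by ring.
clearbody X Y; lra.
Qed.

Lemma sqrt_powR m x : Num.sqrt (m `^ x) = m `^ (x / 2).
Proof. by rewrite -powR12_sqrt ?powR_ge0// -powRrM. Qed.

(** At slope d^2 the bound on [disc] is at most m^k (q tau + d)^2, so the mass integrand is at least
    K / (q tau + d) on [0, 1/2]. The integral of this is (K/q) ln ((q/2 + d) / d), which is
    unbounded as d tends to 0. *)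
Lemma profile_mass_large (c : R) : exists m, 0 < m < hmax A B k l /\
  c < profile_mass A B k l m.
Proof.
have Ak : 0 < A * k by rewrite mulr_gt0.
pose ms := height_of_slope (A * k / 2).
have ms0 : 0 < ms.
  apply: powR_gt0; rewrite divr_gt0 ?mulr_gt0//; lra.
pose C := 2 * A * k + A * k * l.
have C0 : 0 < C by rewrite addr_gt0 ?mulr_gt0.
have [q q0 qC] : exists2 q : R, 0 < q & C = q ^+ 2.
  by exists (Num.sqrt C); rewrite ?sqrtr_gt0// sqr_sqrtr// ltW.
pose e := 2 - k / 2; have e0 : 0 < e by rewrite /e; have := k4; lra.
have mse0 : 0 < ms `^ e by exact: powR_gt0.
(* The size of the logarithm that brings the mass to at least |c| + 1 for every height m >= ms. *)
pose L := q * (`|c| + 1) / (3 * ms `^ e).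
(* The first bound keeps the height above ms, the second makes the logarithm at least L. *)
pose d := Num.min (Num.sqrt (A * k / 2)) (q / 2 * expR (- L)).
have d0 : 0 < d.
  rewrite lt_min sqrtr_gt0 divr_gt0//= mulr_gt0 ?expR_gt0// divr_gt0//.
have dd : d ^+ 2 <= A * k / 2.
  have ds : d <= Num.sqrt (A * k / 2) by rewrite /d ge_min lexx.
  have Ak2 : 0 <= A * k / 2 by rewrite divr_ge0// ltW.
  by rewrite -(sqr_sqrtr Ak2) ler_pXn2r ?nnegrE ?sqrtr_ge0 ?(ltW d0).
have dL : d <= q / 2 * expR (- L) by rewrite /d ge_min lexx orbT.
have LE : L = q * (`|c| + 1) / (3 * ms `^ e) by [].
clearbody d L; have d20 : 0 < d ^+ 2 by rewrite exprn_gt0.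
pose m := height_of_slope (d ^+ 2).
have sm : slope A B k l m = d ^+ 2.
  by apply: slope_height; rewrite (ltW d20)/=; lra.
have msm : ms <= m by apply: height_of_slope_le; rewrite ?(ltW d20)//; lra.
clearbody m ms; have m0 : 0 < m by exact: lt_le_trans msm.
have mh : m < hmax A B k l.
  rewrite ltNge; apply/negP => hm.
  have : slope A B k l m <= slope A B k l (hmax A B k l).
    move: hm; rewrite le_eqVlt => /predU1P[->//|hm]; apply: ltW.
    by apply: slope_lt => //; exact: ltW.
  by rewrite sm slope_hmax// leNgt d20.
have mm : 0 < m < hmax A B k l by rewrite m0.
exists m; split => //.
have ci := continuous_mass_integrand A0 B0 k0 kl mm.
have si := continuous_segment_integrable ci.
pose P := primitive (mass_integrand A B k l m).
(* 3/4 is the least value of [clip] on [0, 1/2]. *)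
pose K := 3 / 4 / m `^ (k / 2).
have mk0 : 0 < m `^ (k / 2) by exact: powR_gt0.
have K0 : 0 < K by rewrite divr_gt0// divr_gt0.
have dP x : is_derive x 1 P (mass_integrand A B k l m x).
  by apply: is_derive_primitive (ci x).
have dln x : 0 <= x -> is_derive x 1 (fun x => K / q * ln (q * x + d)) (K / (q * x + d)).
  move=> x0; have y0 : 0 < q * x + d by rewrite ltr_wpDl// mulr_ge0// ltW.
  have := @is_derive_affine _ (@ln R) (fun x => x^-1) q d x (is_derive1_ln y0).
  move=> dl; have dM := @is_deriveM _ _ (cst (K / q)) _ x 1 0 _ (is_derive_cst _ _ _) dl.
  apply: (is_derive_eq dM); rewrite scaler0 addr0 /GRing.scale/=.
  by field; rewrite !gt_eqF.
have low x : 0 <= x <= 2^-1 -> K / (q * x + d) <= mass_integrand A B k l m x.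
  move=> /andP[x0 x1]; have x01 : 0 <= x <= 2^-1 by rewrite x0.
  have y0 : 0 < q * x + d by rewrite ltr_wpDl// mulr_ge0// ltW.
  have Dx := @disc_gt0 _ A B k l A0 B0 k0 kl m x mm.
  have sD : Num.sqrt (disc A B k l m x) <= m `^ (k / 2) * (q * x + d).
    have -> : m `^ (k / 2) * (q * x + d) = Num.sqrt (m `^ k * (q * x + d) ^+ 2).
      by rewrite sqrtrM ?powR_ge0// sqrtr_sqr gtr0_norm// sqrt_powR.
    rewrite ler_sqrt ?mulr_ge0 ?powR_ge0 ?(ltW y0)//.
    have mh' : 0 < m <= hmax A B k l by rewrite m0 ltW.
    apply: (le_trans (disc_le_near_top mh' x01)); rewrite sm -/C.
    rewrite ler_wpM2l ?powR_ge0//.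
    rewrite qC; have : 0 <= 2 * (q * x * d) by rewrite !mulr_ge0// ltW.
    rewrite -subr_ge0; congr (0 <= _); ring.
  have x11 : -1 <= x <= 1 by apply/andP; split; lra.
  have cx : 3 / 4 <= clip x by rewrite (clipE x11); nra.
  rewrite /mass_integrand /K ler_pdivlMr ?sqrtr_gt0//.
  apply: le_trans cx.
  apply: (@le_trans _ _ (3 / 4 / m `^ (k / 2) / (q * x + d) * (m `^ (k / 2) * (q * x + d)))).
    by rewrite ler_wpM2l// !divr_ge0// ltW.
  by rewrite le_eqVlt; apply/orP; left; apply/eqP; field; rewrite !gt_eqF.
have P12 : K / q * (ln (q / 2 + d) - ln d) <= P 2^-1 - P 0.
  pose h x := P x - K / q * ln (q * x + d).
  have dh x : 0 <= x -> is_derive x 1 h (mass_integrand A B k l m x - K / (q * x + d)).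
    by move=> x0; exact: (@is_deriveB _ _ _ _ _ _ _ _ _ (dP x) (dln x x0)).
  have h01 : (0 : R) < 2^-1 by rewrite invr_gt0.
  have dI x : x \in `]0, 2^-1[%R ->
      is_derive x 1 h (mass_integrand A B k l m x - K / (q * x + d)).
    by rewrite in_itv/= => /andP[/ltW x0 _]; exact: dh.
  have cI : {within `[0, 2^-1], continuous h}.
    apply: derivable_within_continuous => x.
    by rewrite in_itv/= => /andP[x0 _]; case: (dh x x0).
  have [x] := MVT h01 dI cI.
  rewrite in_itv/= => /andP[x0 x1]; rewrite /h mulr0 add0r => hx.
  have := low x; rewrite (ltW x0) (ltW x1) => /(_ isT) lx.
  suff : 0 <= P 2^-1 - K / q * ln (q * 2^-1 + d) - (P 0 - K / q * ln d).
    by move=> ?; lra.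
  by rewrite hx mulr_ge0 ?subr_ge0// ltW.
have P1 : P 2^-1 <= P 1.
  rewrite -subr_ge0 -Rintegral_primitive//; last by lra.
  by apply: Rintegral_ge0 => x _; exact: mass_integrand_ge0.
have lnL : L <= ln (q / 2 + d) - ln d.
  have dq : d * expR L <= q / 2.
    by rewrite -ler_pdivlMr ?expR_gt0// -expRN.
  rewrite lerBrDl -[X in _ + X]expRK -lnM ?posrE ?expR_gt0//.
  rewrite ler_ln ?posrE ?mulr_gt0 ?expR_gt0 ?addr_gt0 ?divr_gt0//.
  by apply: (le_trans dq); rewrite lerDl ltW.
rewrite /profile_mass Rintegral_primitive// -/P.
have KL : K / q * L <= P 1 - P 0.
  apply: (@le_trans _ _ (K / q * (ln (q / 2 + d) - ln d))); last by lra.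
  by rewrite ler_wpM2l// divr_ge0// ltW.
have m2 : 4 * m ^+ 2 * (K / q * L) = (m `^ e / ms `^ e) * (`|c| + 1).
  have -> : m `^ e = m ^+ 2 / m `^ (k / 2).
    by rewrite /e powRB ?(gt_eqF m0) ?implybT// powR_mulrn// ltW.
  by rewrite /K LE; field; rewrite !gt_eqF.
have m20 : 0 < 4 * m ^+ 2 by rewrite mulr_gt0// exprn_gt0.
rewrite -(ler_pM2l m20) m2 in KL.
apply: lt_le_trans KL.
apply: (@lt_le_trans _ _ (`|c| + 1)); first by have := ler_norm c; lra.
rewrite ler_peMl ?addr_ge0// ler_pdivlMr// mul1r.
by apply: ge0_ler_powR; rewrite ?nnegrE ?(ltW e0) ?(ltW ms0) ?(ltW m0).
Qed.

End profile_mass_large.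

(** * Action of a profile and the reduced energy *)

Section profile_action.
Context {R : realType}.
Notation mu := (@lebesgue_measure R).
Variables (A B k l : R).
Hypotheses (A0 : 0 < A) (B0 : 0 < B) (k0 : 0 < k) (k4 : k < 4) (kl : k < l).
Implicit Types (m n s t tau x z : R).

Let l0 : 0 < l. Proof. exact: lt_trans kl. Qed.
Local Notation pot := (pot A B k l).
Local Notation pot1 := (pot1 A B k l).
Local Notation hmax := (hmax A B k l).
Local Notation disc := (disc A B k l).
Local Notation profile_mass := (profile_mass A B k l).

Definition action_integrand m tau := clip tau * tau ^+ 2 * Num.sqrt (disc m tau).

(** The integral of |Q'|^2 over the profile: twice the integral of s sqrt (pot m - pot s) over
    [0, m], after the same substitution as for [profile_mass]. *)
Definition profile_action m := 4 * m ^+ 2 * \int[mu]_(t in `[0, 1]) action_integrand m t.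

Lemma continuous_action_integrand m : continuous (action_integrand m).
Proof.
move=> tau; apply: cvgM; last exact: continuous_sqrt_disc.
by apply: cvgM; [exact: continuous_clip|exact: exprn_continuous].
Qed.

(** m times the derivative of [disc] in m; it is to [pot1] what [disc] is to [pot]. *)
Definition disc1 m tau :=
  A * k * m `^ k * quot k (clip tau) - B * l * m `^ l * quot l (clip tau).

Lemma disc1E m tau : 0 < m -> -1 <= tau <= 1 ->
  tau ^+ 2 * disc1 m tau = pot1 m - pot1 (m * clip tau).
Proof.
move=> m0 t1; rewrite /disc1 /pot1 normrM (gtr0_norm m0).
rewrite !(powRM _ (ltW m0) (normr_ge0 _)).
have e q : tau ^+ 2 * quot q (clip tau) = 1 - `|clip tau| `^ q.
  by rewrite -quotE {2}clipE// opprB addrCA subrr addr0.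
have -> : tau ^+ 2 * (A * k * m `^ k * quot k (clip tau) -
     B * l * m `^ l * quot l (clip tau))
  = A * k * m `^ k * (tau ^+ 2 * quot k (clip tau))
    - B * l * m `^ l * (tau ^+ 2 * quot l (clip tau)) by ring.
by rewrite !e; ring.
Qed.

Lemma is_deriveMcst (f : R -> R) (c df x : R) : is_derive x 1 f df ->
  is_derive x 1 (fun z => c * f z) (c * df).
Proof.
move=> d; apply: (is_derive_eq (@is_deriveM _ _ (cst c) f x 1 0 _ (is_derive_cst _ _ _) d)).
by rewrite scaler0 addr0.
Qed.

Lemma is_derive_mul (f g : R -> R) (df dg x : R) : is_derive x 1 f df ->
  is_derive x 1 g dg -> is_derive x 1 (fun z => f z * g z) (f x * dg + df * g x).
Proof.
move=> d e; apply: (is_derive_eq (@is_deriveM _ _ f g x 1 _ _ d e)).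
by rewrite /GRing.scale/= [g x * _]mulrC.
Qed.

Lemma is_derive_cstB (f : R -> R) (c df x : R) : is_derive x 1 f df ->
  is_derive x 1 (fun z => c - f z) (- df).
Proof.
move=> d; rewrite -[- df]sub0r.
exact: (@is_deriveB _ _ _ (cst c) f x 1 0 df (is_derive_cst _ _ _) d).
Qed.

Lemma is_derive_disc m tau : 0 < m -> is_derive m 1 (disc ^~ tau) (disc1 m tau / m).
Proof.
move=> m0; have dk := is_derive1_powR k m0; have dl := is_derive1_powR l m0.
have dA := is_deriveMcst (A * quot k (clip tau)) dk.
have dB := is_deriveMcst (B * quot l (clip tau)) dl.
have -> : disc ^~ tau = (fun z => A * quot k (clip tau) * z `^ k -
   B * quot l (clip tau) * z `^ l) by apply/funext => z; rewrite /disc; ring.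
apply: (is_derive_eq (is_deriveB _ _)).
have mn0 : m != 0 by rewrite gt_eqF.
rewrite /disc1 !powRB ?mn0 ?implybT// !powRr1 ?(ltW m0)//; ring.
Qed.

Definition daction m tau :=
  8 * m * (clip tau * tau ^+ 2 * Num.sqrt (disc m tau)) +
  2 * m * (clip tau * tau ^+ 2 * disc1 m tau / Num.sqrt (disc m tau)).

Lemma is_derive_action_integrand m tau : 0 < m < hmax ->
  is_derive m 1 (fun n => 4 * n ^+ 2 * action_integrand n tau) (daction m tau).
Proof.
move=> mh; have /andP[m0 _] := mh.
have D0 := disc_gt0 A0 B0 k0 kl tau mh.
have dD := is_derive_disc tau m0.
have dS := @is_derive1_comp _ Num.sqrt (disc ^~ tau) m _ _ (is_derive1_sqrt D0) dD.
have dm2 : is_derive m 1 (fun n : R => n ^+ 2) (2 * m).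
  by apply: (is_derive_eq (@is_deriveX _ _ id 2 m 1 1 _)); rewrite /GRing.scale/= mulr1.
have d4 := is_deriveMcst 4 dm2.
have dc := is_deriveMcst (clip tau * tau ^+ 2) dS.
apply: (is_derive_eq (is_derive_mul d4 dc)).
have s0 : Num.sqrt (disc m tau) != 0 by rewrite gt_eqF// sqrtr_gt0.
by rewrite /daction /=; field; rewrite s0 gt_eqF.
Qed.

(** Domination for differentiating under the integral. The numerators are largest at the upper
    height v, and [disc_scale] bounds 1 / sqrt (disc m) by its value at v up to the factor
    (v/u)^(k/2). *)
Lemma daction_bound (u v : R) : 0 < u -> u < v -> v < hmax ->
  exists G : R -> R, [/\ continuous G, forall tau, 0 <= G tau &
    forall m tau, u < m < v -> 0 <= tau <= 1 -> `|daction m tau| <= G tau].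
Proof.
move=> u0 uv vh; have v0 : 0 < v by exact: lt_trans uv.
have vm : 0 < v < hmax by rewrite v0.
pose K tau := A * v `^ k * quot k (clip tau).
pose L tau := A * k * v `^ k * quot k (clip tau) + B * l * v `^ l * quot l (clip tau).
pose N tau := (v / u) `^ (k / 2) / Num.sqrt (disc v tau).
have q0 q tau : 0 < q -> 0 < quot q (clip tau).
  by move=> q0; rewrite quot_gt0// clip_01.
have cq q : 0 < q -> continuous (fun tau => quot q (clip tau)).
  move=> q1 tau; apply: continuous_comp; first exact: continuous_clip.
  exact: continuous_quot.
have K0 tau : 0 <= K tau by rewrite !mulr_ge0 ?powR_ge0// ltW// q0.
have L0 tau : 0 <= L tau.
  by rewrite addr_ge0// !mulr_ge0 ?powR_ge0//; apply: ltW => //; exact: q0.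
have N0 tau : 0 <= N tau by rewrite divr_ge0 ?powR_ge0 ?sqrtr_ge0.
exists (fun tau => 8 * v * Num.sqrt (K tau) + 2 * v * (L tau * N tau)); split.
- move=> tau; apply: cvgD; apply: cvgM; try exact: cvg_cst.
    apply: (@continuous_comp _ _ _ K Num.sqrt); last exact: sqrt_continuous.
    by apply: cvgM; [exact: cvg_cst|exact: cq].
  apply: cvgM.
    by apply: cvgD; apply: cvgM; (exact: cvg_cst || exact: cq).
  apply: cvgM; first exact: cvg_cst.
  apply: cvgV; last exact: continuous_sqrt_disc.
  by rewrite gt_eqF// sqrtr_gt0 disc_gt0.
- by move=> tau; rewrite addr_ge0 ?(mulr_ge0 (mulr_ge0 _ (ltW v0))) ?sqrtr_ge0 ?(mulr_ge0 (L0 _) (N0 _)).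
- move=> m tau /andP[um mv] /andP[t0 t1].
  have m0 : 0 < m by exact: lt_trans um.
  have mh : 0 < m < hmax by rewrite m0 (lt_trans mv).
  have D0 := disc_gt0 A0 B0 k0 kl tau mh.
  have Dv0 := disc_gt0 A0 B0 k0 kl tau vm.
  have /andP[c0 c1] := clip_01 tau.
  have ct0 : 0 <= clip tau * tau ^+ 2 by rewrite mulr_ge0 ?sqr_ge0.
  have ct1 : clip tau * tau ^+ 2 <= 1.
    by rewrite mulr_ile1 ?sqr_ge0 ?expr_le1.
  have pk q : 0 < q -> m `^ q <= v `^ q.
    move=> qq; apply: ge0_ler_powR; rewrite ?nnegrE ?(ltW qq) ?(ltW m0) ?(ltW v0)//.
    exact: ltW.
  have DK : disc m tau <= K tau.
    rewrite /disc /K; apply: (@le_trans _ _ (A * m `^ k * quot k (clip tau))).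
      by rewrite gerBl !mulr_ge0 ?powR_ge0//; apply: ltW => //; exact: q0.
    by rewrite ler_pM2r ?q0// ler_pM2l// pk.
  have D1L : `|disc1 m tau| <= L tau.
    rewrite /disc1 /L; apply: (le_trans (ler_normB _ _)).
    rewrite !normrM !(gtr0_norm (q0 _ _ _))// (gtr0_norm A0) (gtr0_norm B0).
    rewrite (gtr0_norm k0) (gtr0_norm l0) !(ger0_norm (powR_ge0 _ _)).
    apply: lerD; rewrite ler_pM2r ?q0//.
      by rewrite ler_pM2l ?pk// mulr_gt0.
    by rewrite ler_pM2l ?pk// mulr_gt0.
  have DN : (Num.sqrt (disc m tau))^-1 <= N tau.
    rewrite /N ler_pdivlMr ?sqrtr_gt0// mulrC ler_pdivrMr ?sqrtr_gt0//.
    rewrite -sqrt_powR -sqrtrM ?powR_ge0//.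
    rewrite ler_sqrt; last by rewrite mulr_ge0 ?powR_ge0// ltW.
    have mv' : 0 < m <= v by rewrite m0 ltW.
    apply: (le_trans (disc_scale A B0 k0 kl tau mv')).
    rewrite ler_pM2r//; apply: ge0_ler_powR.
    + exact: ltW.
    + by rewrite nnegrE divr_ge0// ltW.
    + by rewrite nnegrE divr_ge0// ltW.
    + by rewrite ler_pM2l// lef_pV2 ?posrE// ltW.
  have sD := sqrtr_ge0 (disc m tau).
  have sK := sqrtr_ge0 (K tau).
  have sDK : Num.sqrt (disc m tau) <= Num.sqrt (K tau) by rewrite ler_sqrt.
  rewrite /daction; apply: (le_trans (ler_normD _ _)); apply: lerD.
    rewrite ger0_norm; last by rewrite !mulr_ge0 ?sqr_ge0// ltW.
    apply: ler_pM.
    + by rewrite mulr_ge0// ltW.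
    + by rewrite mulr_ge0.
    + by rewrite ler_pM2l// ltW.
    + by rewrite -[leRHS]mul1r ler_pM.
  have m20 : 0 <= 2 * m by rewrite mulr_ge0// ltW.
  rewrite normrM (ger0_norm m20); apply: ler_pM => //.
    by rewrite ler_pM2l// ltW.
  rewrite normrM normfV (ger0_norm sD) normrM (ger0_norm ct0).
  apply: ler_pM => //; rewrite ?invr_ge0//.
    by rewrite mulr_ge0.
  by rewrite -[leRHS]mul1r ler_pM.
Qed.

(* The primitive whose boundary values vanish: integrating its derivative turns
   the derivative of the action into the mass. *)
Definition virial m tau := 2 * m * (clip tau ^+ 2 * tau * Num.sqrt (disc m tau)).

Definition dvirial m tau :=
  - (8 * m * (clip tau * tau ^+ 2 * Num.sqrt (disc m tau))) +
  2 * m * (clip tau * pot1 (m * clip tau) / Num.sqrt (disc m tau)).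

Lemma is_derive_virial m tau : 0 < m < hmax -> 0 < tau < 1 ->
  is_derive tau 1 (virial m) (dvirial m tau).
Proof.
move=> mh /andP[t0 t1]; have /andP[m0 _] := mh.
have t11 : -1 <= tau <= 1 by apply/andP; split; lra.
have c0 : 0 < 1 - tau ^+ 2 by nra.
have mc0 : 0 < m * (1 - tau ^+ 2) by rewrite mulr_gt0.
have cE := clipE t11.
have D0 := disc_gt0 A0 B0 k0 kl tau mh.
(* tau sqrt (disc m tau) is the root of N, so only [pot] has to be differentiated, and not [quot] in
   its second argument. *)
pose N x := pot m - pot (m * (1 - x ^+ 2)).
have NE : tau ^+ 2 * disc m tau = N tau by rewrite (discE _ _ _ _ m0 t11) cE.
have N0 : 0 < N tau by rewrite -NE mulr_gt0// exprn_gt0.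
have sN : Num.sqrt (N tau) = tau * Num.sqrt (disc m tau).
  by rewrite -NE sqrtrM ?sqr_ge0// sqrtr_sqr gtr0_norm.
have d2 : is_derive tau 1 (fun x : R => x ^+ 2) (2 * tau).
  by apply: (is_derive_eq (@is_deriveX _ _ id 2 tau 1 1 _)); rewrite /GRing.scale/= mulr1.
have dc := is_derive_cstB 1 d2.
have dmc := is_deriveMcst m dc.
have dp := @is_derive1_comp _ pot (fun x => m * (1 - x ^+ 2)) tau _ _
  (is_derive_pot A B k l mc0) dmc.
have dN : is_derive tau 1 N _ := is_derive_cstB (pot m) dp.
have dS := @is_derive1_comp _ Num.sqrt N tau _ _ (is_derive1_sqrt N0) dN.
have dY := is_deriveMcst (2 * m) (is_derive_mul (is_derive_mul dc dc) dS).
have dY' : is_derive tau 1 (fun x : R => 2 * m *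
    ((1 - x ^+ 2) * (1 - x ^+ 2) * (Num.sqrt \o N) x)) (dvirial m tau).
  apply: (is_derive_eq dY) => /=; rewrite /dvirial sN cE.
  have s0 : Num.sqrt (disc m tau) != 0 by rewrite gt_eqF// sqrtr_gt0.
  by field; rewrite s0 !gt_eqF.
apply: near_eq_is_derive dY'; near=> x.
have x0 : 0 < x by near: x; exact: lt_nbhsr.
have x1 : x < 1 by near: x; exact: lt_nbhsl.
have x11 : -1 <= x <= 1 by apply/andP; split; lra.
rewrite /virial /= (clipE x11); congr (_ * _); rewrite -expr2 -mulrA; congr (_ * _).
have -> : N x = x ^+ 2 * disc m x by rewrite (discE _ _ _ _ m0 x11) (clipE x11).
by rewrite sqrtrM ?sqr_ge0// sqrtr_sqr gtr0_norm.
Unshelve. all: end_near. Qed.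

(** Formally, differentiating sqrt (pot m - pot s) under the integral in s gives pot'(m) times half
    the mass, the boundary term being zero, but the result is singular at s = m. In the variable tau
    the differentiation is legitimate and produces extra terms, which add up to minus the derivative
    of [virial]. *)
Lemma is_derive_profile_action m : 0 < m < hmax ->
  is_derive m 1 profile_action (pot1 m / m * profile_mass m / 2).
Proof.
move=> mh; have /andP[m0 mh'] := mh.
pose u := m / 2; pose v := (m + hmax) / 2.
have u0 : 0 < u by rewrite divr_gt0.
have um : u < m by rewrite /u; lra.
have mv : m < v by rewrite /v; lra.
have vh : v < hmax by rewrite /v; lra.
have [G [cG G0 GP]] := daction_bound u0 (lt_trans um mv) vh.
pose f n tau := 4 * n ^+ 2 * action_integrand n tau.
have cf n : continuous (f n).
  by move=> tau; apply: cvgM; [exact: cvg_cst|exact: continuous_action_integrand].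
have Im : `]u, v[%classic m by rewrite /= in_itv/= um.
have intf x : `]u, v[%classic x -> mu.-integrable `[0, 1] (EFin \o f x).
  by move=> _; exact: continuous_segment_integrable.
have dI x (y : R) : `]u, v[%classic x -> is_derive x 1 (f ^~ y) (daction x y).
  rewrite /= in_itv/= => /andP[ux xv]; apply: is_derive_action_integrand.
  by rewrite (lt_trans u0 ux) (lt_trans xv vh).
have df x (y : R) : `]u, v[%classic x -> `[0, 1]%classic y -> derivable (f ^~ y) x 1.
  by move=> /(dI x y) [].
have d1E x (y : R) : `]u, v[%classic x -> partial1of2 f x y = daction x y.
  by move=> /(dI x y) [_ e]; rewrite partial1of2E.
have iG : mu.-integrable `[0, 1] (EFin \o G) by exact: continuous_segment_integrable.
have Gub x (y : R) : `]u, v[%classic x -> `[0, 1]%classic y -> `|partial1of2 f x y| <= G y.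
  move=> xI yI; rewrite d1E//; apply: GP; first by move: xI; rewrite /= in_itv.
  by move: yI; rewrite /= in_itv.
have dF := @derivable_under_integral _ _ _ mu f `[0, 1] (measurable_itv _) _ _ _ Im intf df
  G G0 iG Gub.
have eF := @differentiation_under_integral _ _ _ mu f `[0, 1] (measurable_itv _) _ _ _ Im intf df
  G G0 iG Gub.
have SE : profile_action = (fun n => \int[mu]_(y in `[0, 1]) f n y).
  apply/funext => n; rewrite /profile_action RintegralZl//.
  exact/continuous_segment_integrable/continuous_action_integrand.
have cs : continuous (fun tau => Num.sqrt (disc m tau)).
  exact: continuous_sqrt_disc.
have cis : continuous (fun tau => (Num.sqrt (disc m tau))^-1).
  move=> tau; apply: cvgV; last exact: cs.
  by rewrite gt_eqF// sqrtr_gt0 disc_gt0.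
have cp1 : continuous (fun tau => pot1 (m * clip tau)).
  move=> tau; apply: (@continuous_comp _ _ _ (fun x => m * clip x) pot1);
    last exact: continuous_pot1.
  by apply: cvgM; [exact: cvg_cst|exact: continuous_clip].
have cvi : continuous (virial m).
  move=> tau; apply: cvgM; first exact: cvg_cst.
  apply: cvgM; last exact: cs.
  apply: cvgM; last exact: cvg_id.
  by apply: cvgM; exact: continuous_clip.
have cdv : continuous (dvirial m).
  move=> tau; apply: cvgD.
    apply: cvgN; apply: cvgM; first exact: cvg_cst.
    exact: continuous_action_integrand.
  apply: cvgM; first exact: cvg_cst.
  apply: cvgM; last exact: cis.
  by apply: cvgM; [exact: continuous_clip|exact: cp1].
have vir : \int[mu]_(t in `[0, 1]) dvirial m t = 0.
  have c1 : clip (1 : R) = 0 by rewrite clipE ?expr1n ?subrr//; lra.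
  rewrite (Rintegral_FTC ler01 cdv cvi (fun x x01 => is_derive_virial mh x01)).
  by rewrite /virial c1 expr0n/= !(mul0r, mulr0) subrr.
have ci := continuous_mass_integrand A0 B0 k0 kl mh.
rewrite SE; split; first exact: dF.
rewrite -derive1E eF.
under eq_Rintegral do rewrite (d1E _ _ Im).
(* The terms in sqrt (disc) cancel against those of [dvirial]; [disc1E] merges the remaining ones
   into the constant [pot1 m]. *)
have -> : \int[mu]_(x in `[0, 1]) daction m x = \int[mu]_(x in `[0, 1])
    (2 * m * pot1 m * mass_integrand A B k l m x - dvirial m x).
  apply: eq_Rintegral => x; rewrite inE/= in_itv/= => /andP[x0 x1].
  have x11 : -1 <= x <= 1 by apply/andP; split; lra.
  have -> : pot1 m = x ^+ 2 * disc1 m x + pot1 (m * clip x).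
    by rewrite (disc1E m0 x11) subrK.
  rewrite /daction /dvirial /mass_integrand; ring.
have cmi : continuous (fun x => 2 * m * pot1 m * mass_integrand A B k l m x).
  by move=> x; apply: cvgM; [exact: cvg_cst|exact: ci].
rewrite RintegralB//; last 2 first.
- exact: (continuous_segment_integrable cmi).
- exact: (continuous_segment_integrable cdv).
rewrite vir subr0 RintegralZl//; last exact: (continuous_segment_integrable ci).
rewrite /profile_mass; field.
by rewrite gt_eqF.
Qed.

(** Psi of the overview. The action bounds the kinetic part and the calibration term from below; the
    last term is what a fixed mass leaves of the shift by [pot m] in [curve_energyE]. *)
Definition reduced_energy (lam : R) m := profile_action m - pot m * lam / 2.

Lemma is_derive_reduced_energy (lam : R) m : 0 < m < hmax ->
  is_derive m 1 (reduced_energy lam) (pot1 m / m / 2 * (profile_mass m - lam)).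
Proof.
move=> mh; have /andP[m0 _] := mh.
have dS := is_derive_profile_action mh.
have dp := is_deriveMcst (lam / 2) (is_derive_pot A B k l m0).
have -> : reduced_energy lam = (fun m => profile_action m - lam / 2 * pot m).
  by apply/funext => n; rewrite /reduced_energy; ring.
by apply: (is_derive_eq (is_deriveB _ _)); field; rewrite gt_eqF.
Qed.

Lemma reduced_energy_decr (lam : R) m n : 0 < m -> m < n -> n < hmax ->
  (forall z, m < z < n -> profile_mass z < lam) ->
  reduced_energy lam n < reduced_energy lam m.
Proof.
move=> m0 mn nh Mz.
have d x : x \in `[m, n]%R -> is_derive x 1 (reduced_energy lam)
    (pot1 x / x / 2 * (profile_mass x - lam)).
  rewrite in_itv/= => /andP[mx xn]; apply: is_derive_reduced_energy.
  by rewrite (lt_le_trans m0 mx) (le_lt_trans xn nh).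
have d' x : x \in `]m, n[%R -> is_derive x 1 (reduced_energy lam)
    (pot1 x / x / 2 * (profile_mass x - lam)).
  by move=> xI; apply: d; exact: subset_itv_oo_cc xI.
have c : {within `[m, n], continuous (reduced_energy lam)}.
  by apply: derivable_within_continuous => x /d [].
have [x] := MVT mn d' c; rewrite in_itv/= => /andP[mx xn] e.
have x0 : 0 < x by exact: lt_trans mx.
rewrite -subr_lt0 e nmulr_rlt0 ?subr_gt0// pmulr_rlt0.
  by rewrite subr_lt0 Mz// mx.
by rewrite !divr_gt0// pot1_gt0// x0 (lt_trans xn).
Qed.

Lemma reduced_energy_incr (lam : R) m n : 0 < m -> m < n -> n < hmax ->
  (forall z, m < z < n -> lam < profile_mass z) ->
  reduced_energy lam m < reduced_energy lam n.
Proof.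
move=> m0 mn nh Mz.
have d x : x \in `[m, n]%R -> is_derive x 1 (reduced_energy lam)
    (pot1 x / x / 2 * (profile_mass x - lam)).
  rewrite in_itv/= => /andP[mx xn]; apply: is_derive_reduced_energy.
  by rewrite (lt_le_trans m0 mx) (le_lt_trans xn nh).
have d' x : x \in `]m, n[%R -> is_derive x 1 (reduced_energy lam)
    (pot1 x / x / 2 * (profile_mass x - lam)).
  by move=> xI; apply: d; exact: subset_itv_oo_cc xI.
have c : {within `[m, n], continuous (reduced_energy lam)}.
  by apply: derivable_within_continuous => x /d [].
have [x] := MVT mn d' c; rewrite in_itv/= => /andP[mx xn] e.
have x0 : 0 < x by exact: lt_trans mx.
rewrite -subr_gt0 e pmulr_rgt0 ?subr_gt0//; last first.
by rewrite mulr_gt0 ?subr_gt0 ?Mz ?mx// !divr_gt0// pot1_gt0// x0 (lt_trans xn).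
Qed.

Lemma reduced_energy_min (lam h m : R) : 0 < h < hmax -> profile_mass h = lam ->
  0 < m < hmax -> m != h -> reduced_energy lam h < reduced_energy lam m.
Proof.
move=> /andP[h0 hh] hl /andP[m0 mh]; rewrite neq_lt => /orP[mlh|hlm].
  apply: reduced_energy_decr => // z /andP[mz zh]; rewrite -hl.
  by apply: profile_mass_lt => //; exact: lt_trans mz.
apply: reduced_energy_incr => // z /andP[hz zm]; rewrite -hl.
by apply: profile_mass_lt => //; exact: lt_trans mh.
Qed.

(* The height at which the increasing function [profile_mass] crosses [lam] is
   an interior minimum of [reduced_energy], whose derivative vanishes there. *)
Lemma exists_height (lam : R) : 0 < lam ->
  exists h, 0 < h < hmax /\ profile_mass h = lam.
Proof.
move=> lam0; have [m1 [/andP[m10 m1h] M1]] := profile_mass_small A0 B0 k0 k4 kl lam0.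
have [m2 [/andP[m20 m2h] M2]] := profile_mass_large A0 B0 k0 k4 kl lam.
have mono := profile_mass_lt A0 B0 k0 k4 kl.
pose S := [set m | 0 < m < hmax /\ profile_mass m < lam].
have Sm1 : S m1 by split; rewrite ?m10.
have ubS : ubound S m2.
  move=> m [/andP[m0 mh] Mm]; rewrite leNgt; apply/negP => m2m.
  by have := mono _ _ m20 m2m mh; rewrite ltNge (ltW (lt_trans Mm M2)).
have supS : has_sup S by split; [exists m1|exists m2].
pose h := sup S.
have hm2 : h <= m2 by apply: ge_sup => //; exists m1.
have m1h' : m1 <= h by apply: ub_le_sup => //; exists m2.
have adh (d : R) : 0 < d -> exists2 y, S y & h - d < y.
  by move=> d0; exact: sup_adherent.
have Sh y : S y -> y <= h by move=> Sy; apply: ub_le_sup => //; exists m2.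
clearbody h; have h0 : 0 < h by exact: lt_le_trans m1h'.
have hh : h < hmax by exact: le_lt_trans m2h.
have lo z : 0 < z -> z < h -> profile_mass z < lam.
  move=> z0 zh; have d0 : 0 < h - z by rewrite subr_gt0.
  have [y [/andP[y0 yh] My]] := adh _ d0.
  rewrite subKr => zy; exact: lt_trans (mono _ _ z0 zy yh) My.
have hi z : h < z -> z < hmax -> lam < profile_mass z.
  move=> hz zh.
  have [y hy yz] : exists2 y, h < y & y < z.
    by exists ((h + z) / 2); rewrite (midf_lt hz).
  have y0 : 0 < y by exact: lt_trans hy.
  apply: le_lt_trans (mono _ _ y0 yz zh); rewrite leNgt; apply/negP => My.
  have : y <= h by apply: Sh; split; rewrite ?y0 ?(lt_trans yz).
  by rewrite leNgt hy.
exists h; split; first by rewrite h0.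
have hI : h \in `]0, hmax[%R by rewrite in_itv/= h0.
have dd m : m \in `]0, hmax[%R -> derivable (reduced_energy lam) m 1.
  by rewrite in_itv/= => mI; case: (is_derive_reduced_energy lam mI).
have mn m : m \in `]0, hmax[%R -> reduced_energy lam h <= reduced_energy lam m.
  rewrite in_itv/= => /andP[m0 mh].
  have [mlh|hlm|->//] := ltgtP m h.
    apply: ltW; apply: (reduced_energy_decr m0 mlh hh) => z /andP[mz zh].
    exact: (lo z (lt_trans m0 mz) zh).
  apply: ltW; apply: (reduced_energy_incr h0 hlm mh) => z /andP[hz zm].
  exact: (hi z hz (lt_trans zm mh)).
have h0h : 0 <= hmax by exact/ltW/hmax_gt0.
have [_ e0] := derive1_at_min h0h dd hI mn.
have hI' : 0 < h < hmax by rewrite h0.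
have [_ e1] := is_derive_reduced_energy lam hI'.
have := e1; rewrite e0 => /esym/eqP.
rewrite mulf_eq0 gt_eqF /=; first by rewrite subr_eq0 => /eqP.
by rewrite !divr_gt0// pot1_gt0.
Qed.

End profile_action.

(** * The ground state profile *)

Section profile_function.
Context {R : realType}.
Notation mu := (@lebesgue_measure R).
Variables (A B k l : R).
Hypotheses (A0 : 0 < A) (B0 : 0 < B) (k0 : 0 < k) (k4 : k < 4) (kl : k < l).
Implicit Types (m n s t tau x z : R).

Let l0 : 0 < l. Proof. exact: lt_trans kl. Qed.
Local Notation pot := (pot A B k l).
Local Notation hmax := (hmax A B k l).
Local Notation disc := (disc A B k l).
Local Notation profile_mass := (profile_mass A B k l).
Local Notation profile_action := (profile_action A B k l).

(** The speed |Q'| of the profile of height m as a function of s = Q. The root is 0 where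
    [pot s > pot m]. *)
Definition calib m s := `|s| * Num.sqrt (pot m - pot s).

Lemma continuous_calib m : continuous (calib m).
Proof.
move=> s; apply: cvgM; first exact: norm_continuous.
apply: (@continuous_comp _ _ _ (fun x => pot m - pot x) Num.sqrt);
  last exact: sqrt_continuous.
by apply: cvgB; [exact: cvg_cst|exact: continuous_pot].
Qed.

Lemma calib_ge0 m s : 0 <= calib m s.
Proof. by rewrite mulr_ge0 ?sqrtr_ge0. Qed.

Lemma is_derive_calib m s : is_derive s 1 (primitive (calib m)) (calib m s).
Proof.
apply: is_derive_primitive; last exact: continuous_calib.
by apply: continuous_segment_integrable; exact: continuous_calib.
Qed.

Lemma sqrt_disc_pos tau m : 0 < m -> 0 <= tau <= 1 ->
  Num.sqrt (pot m - pot (m * clip tau)) = tau * Num.sqrt (disc m tau).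
Proof.
move=> m0 /andP[t0 t1]; rewrite -(discE A B k l m0); last by apply/andP; split; lra.
by rewrite sqrtrM ?sqr_ge0// sqrtr_sqr ger0_norm.
Qed.

(** Substitution s = m (1 - x^2), carried out by differentiating minus the primitive along it; the
    factor 1/2 appears because the action counts both the climb and the descent. *)
Lemma primitive_calib m : 0 < m < hmax ->
  primitive (calib m) m = profile_action m / 2.
Proof.
move=> /andP[m0 mh].
pose F x := - primitive (calib m) (m * (1 - x ^+ 2)).
have cai := @continuous_action_integrand R A B k l k0 kl m.
have cf : continuous (fun x => 2 * m ^+ 2 * action_integrand A B k l m x).
  by move=> x; apply: cvgM; [exact: cvg_cst|exact: cai].
have dF x : is_derive x 1 F (2 * m * x * calib m (m * (1 - x ^+ 2))).
  have d2 : is_derive x 1 (fun x : R => x ^+ 2) (2 * x).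
    by apply: (is_derive_eq (@is_deriveX _ _ id 2 x 1 1 _)); rewrite /GRing.scale/= mulr1.
  have dm := is_deriveMcst m (is_derive_cstB 1 d2).
  have dp := @is_derive1_comp _ _ (fun x => m * (1 - x ^+ 2)) x _ _
    (is_derive_calib m _) dm.
  have dN := is_derive_cstB 0 dp.
  have -> : F = (fun z => 0 - (primitive (calib m) \o (fun x => m * (1 - x ^+ 2))) z).
    by apply/funext => z; rewrite sub0r.
  by apply: (is_derive_eq dN); ring.
have dF' x : 0 < x < 1 -> is_derive x 1 F (2 * m ^+ 2 * action_integrand A B k l m x).
  move=> /andP[x0 x1]; apply: (is_derive_eq (dF x)).
  have x11 : -1 <= x <= 1 by apply/andP; split; lra.
  rewrite -(clipE x11) /calib sqrt_disc_pos//; last by rewrite !ltW.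
  have /andP[c0 _] := clip_01 x.
  by rewrite normrM (gtr0_norm m0) (ger0_norm c0) /action_integrand; ring.
have := Rintegral_FTC ler01 cf (is_derive_continuous dF) dF'.
rewrite RintegralZl//; last exact: (continuous_segment_integrable cai).
rewrite /F expr1n subrr mulr0 primitive0 oppr0 sub0r opprK expr0n/= subr0 mulr1 => <-.
by rewrite /profile_action; field.
Qed.

Lemma ler_primitive (f g : R -> R) x : continuous f -> continuous g -> 0 <= x ->
  (forall t, 0 <= t <= x -> f t <= g t) -> primitive f x <= primitive g x.
Proof.
move=> cf cg x0 fg.
have fi := continuous_segment_integrable cf.
have gi := continuous_segment_integrable cg.
have := Rintegral_primitive fi x0; rewrite primitive0 subr0 => <-.
have := Rintegral_primitive gi x0; rewrite primitive0 subr0 => <-.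
by apply: le_Rintegral.
Qed.

Variable h : R.
Hypothesis hh : 0 < h < hmax.

Let h0 : 0 < h. Proof. by case/andP: hh. Qed.

(** This is tanh (x / 2), the odd solution of y' = (1 - y^2) / 2. *)
Definition logistic (x : R) := 1 - 2 / (expR x + 1).

Lemma logistic_den x : 0 < expR x + 1.
Proof. by rewrite addr_gt0// expR_gt0. Qed.

Lemma is_derive_logistic x : is_derive x 1 logistic ((1 - logistic x ^+ 2) / 2).
Proof.
have e0 := logistic_den x; have en0 : expR x + 1 != 0 by rewrite gt_eqF.
have de : is_derive x 1 (fun x : R => expR x + 1) (expR x).
  rewrite -[X in is_derive _ _ _ X]addr0.
  exact: (@is_deriveD _ _ _ expR (cst 1) x 1 _ 0 (is_derive_expR x) (is_derive_cst _ _ _)).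
have dV := @is_deriveV R (fun x => expR x + 1) x _ 1 en0 de.
apply: (is_derive_eq (is_derive_cstB 1 (is_deriveMcst 2 dV))).
by rewrite /logistic /GRing.scale/=; field.
Qed.

Lemma logistic_lt x : -1 < logistic x < 1.
Proof.
have e0 := logistic_den x; have e1 := expR_gt0 x.
rewrite /logistic ltrBrDl -ltrBrDr opprK ltrBlDr ltrDl divr_gt0// andbT.
by rewrite ltr_pdivrMr//; lra.
Qed.

Lemma logisticN x : logistic (- x) = - logistic x.
Proof.
rewrite /logistic expRN; have e := expR_gt0 x; field.
by rewrite !gt_eqF// ?addr_gt0// expR_gt0.
Qed.

(** For Q = h (1 - tau^2) the profile equation becomes tau' = (1 - tau^2) sqrt (disc h tau) / 2,
    which is regular at the top tau = 0. It is the equation of [logistic] up to the positive factor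
    sqrt (disc), so a change of time [xi] solves it; its inverse is the primitive of w. *)
Lemma exists_profile_parameter : exists tau : R -> R,
  [/\ forall x, is_derive x 1 tau (clip (tau x) * Num.sqrt (disc h (tau x)) / 2),
      forall x, -1 < tau x < 1, forall x, tau (- x) = - tau x,
      forall x, 0 < x -> 0 < tau x & tau x @[x --> +oo] --> (1 : R)].
Proof.
pose w x := (Num.sqrt (disc h (logistic x)))^-1.
have s0 tau : 0 < Num.sqrt (disc h tau) by rewrite sqrtr_gt0 disc_gt0.
have cs := @continuous_sqrt_disc R A B k l k0 kl h.
have clog : continuous logistic := is_derive_continuous is_derive_logistic.
have cw : continuous w.
  move=> x; apply: cvgV; first by rewrite gt_eqF.
  apply: (@continuous_comp _ _ _ logistic (fun t => Num.sqrt (disc h t))).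
    exact: clog.
  exact: cs.
have wN x : w (- x) = w x.
  rewrite /w logisticN; congr (_^-1); congr Num.sqrt.
  by rewrite /disc /clip sqrrN.
have N11 : (-1 : R) <= 1 by lra.
(* The maximum of sqrt (disc) bounds w below, which makes the change of time global. *)
have [c _ cP] := EVT_max N11 (continuous_subspaceT cs).
have wlow x : (Num.sqrt (disc h c))^-1 <= w x.
  rewrite lef_pV2 ?posrE ?s0//; apply: cP; rewrite in_itv/=.
  by have /andP[a b] := logistic_lt x; rewrite !ltW.
have dX x : is_derive x 1 (primitive w) (w x).
  by apply: is_derive_primitive (cw x); exact: continuous_segment_integrable.
have V0 : 0 < (Num.sqrt (disc h c))^-1 by rewrite invr_gt0.
have [xi [Xxi xiX dxi]] := inverse_of_pos_derivative V0 wlow dX.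
have XN x : primitive w (- x) = - primitive w x.
  pose g x := primitive w (-1 * x + 0) + primitive w x.
  have dg z : is_derive z 1 g 0.
    have d1 := @is_derive_affine _ (primitive w) w (-1) 0 z (dX _).
    apply: (is_derive_eq (is_deriveD d1 (dX z))).
    by rewrite addr0 mulN1r mulN1r wN addNr.
  have := is_derive_0_is_cst x 0 dg.
  rewrite /g mulr0 !addr0 primitive0 addr0 mulN1r => /eqP.
  by rewrite addr_eq0 => /eqP.
have xiN x : xi (- x) = - xi x.
  by apply: (can_inj Xxi); rewrite XN !xiX.
pose tau x := logistic (xi x).
have dtau x : is_derive x 1 tau (clip (tau x) * Num.sqrt (disc h (tau x)) / 2).
  have /andP[t1 t2] := logistic_lt (xi x).
  have -> : clip (tau x) = 1 - tau x ^+ 2 by apply: clipE; rewrite !ltW.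
  apply: (is_derive_eq (is_derive1_comp (is_derive_logistic (xi x)) (dxi x))).
  by rewrite /w invrK -/(tau x); ring.
have taulow x z : x <= z -> tau x <= tau z.
  move=> xz; have [y _ e] := MVT_segment xz (fun z _ => dtau z)
    (continuous_subspaceT (is_derive_continuous dtau)).
  rewrite -subr_ge0 e mulr_ge0 ?subr_ge0// divr_ge0// mulr_ge0 ?sqrtr_ge0//.
  by case/andP: (clip_01 (tau y)).
exists tau; split => //.
- by move=> x; exact: logistic_lt.
- by move=> x; rewrite /tau xiN logisticN.
- move=> x x0.
  have xi0 : 0 < xi x.
    rewrite ltNge; apply/negP => xi0.
    have [y _ e] := MVT_segment xi0 (fun z _ => dX z)
      (continuous_subspaceT (is_derive_continuous dX)).
    move: e; rewrite primitive0 xiX sub0r => e.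
    have : 0 <= w y * (0 - xi x).
      by rewrite mulr_ge0 ?subr_ge0// (le_trans (ltW V0)).
    by rewrite -e oppr_ge0 leNgt x0.
  have e1 : 1 < expR (xi x) by rewrite expR_gt1.
  have e2 := logistic_den (xi x).
  by rewrite /tau /logistic subr_gt0 ltr_pdivrMr//; lra.
- apply/cvgrPdist_le => e e0; near=> x.
  (* At time 2 / e, [logistic] is within 2 / (exp (2/e) + 1) <= e of its limit 1. *)
  have e20 : 0 < 2 / e by rewrite divr_gt0.
  have xN : primitive w (2 / e) <= x.
    by near: x; apply: nbhs_pinfty_ge; exact: num_real.
  have tl := taulow _ _ xN; rewrite {1}/tau Xxi in tl.
  have /andP[_ t1] := logistic_lt (xi x).
  rewrite ger0_norm; last by rewrite subr_ge0 ltW.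
  have ee := expR_ge1Dx (2 / e).
  have le : 2 / (expR (2 / e) + 1) <= e.
    rewrite ler_pdivrMr ?logistic_den//.
    have : e * (1 + 2 / e) <= e * expR (2 / e) by rewrite ler_pM2l.
    have -> : e * (1 + 2 / e) = e + 2 by field; rewrite gt_eqF.
    lra.
  by rewrite lerBlDr -lerBlDl; apply: le_trans tl; rewrite /logistic lerD2l lerN2.
Unshelve. all: end_near. Qed.

End profile_function.

(** * Existence of the profile and comparison of curves with it *)

Section profile_properties.
Context {R : realType}.
Notation mu := (@lebesgue_measure R).
Variables (A B k l : R).
Hypotheses (A0 : 0 < A) (B0 : 0 < B) (k0 : 0 < k) (k4 : k < 4) (kl : k < l).
Implicit Types (m n s t tau x y z : R).

Local Notation pot := (pot A B k l).
Local Notation hmax := (hmax A B k l).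
Local Notation disc := (disc A B k l).
Local Notation profile_mass := (profile_mass A B k l).
Local Notation profile_action := (profile_action A B k l).
Local Notation calib := (calib A B k l).

Record is_profile (h : R) (Q dQ : R -> R) : Prop := IsProfile {
  profile_derive : forall x, is_derive x 1 Q (dQ x);
  profile_dcont : continuous dQ;
  profile_bounds : forall x, 0 < Q x <= h;
  profile_top : Q 0 = h;
  profile_even : forall x, Q (- x) = Q x;
  profile_lt : forall x, 0 < x -> Q x < h;
  profile_ode : forall x, 0 < x -> dQ x = - calib h (Q x);
  profile_dsqr : forall x, dQ x ^+ 2 = calib h (Q x) ^+ 2;
  profile_sqr_int : (\int[mu]_x (Q x ^+ 2)%:E = (profile_mass h)%:E)%E;
  profile_dsqr_int : (\int[mu]_x (dQ x ^+ 2)%:E = (profile_action h)%:E)%E }.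

(** Taking the derivative through tau, which is odd, gives dQ its change of sign at the top; the
    equation for Q alone only prescribes |Q'|. *)
Lemma exists_profile h : 0 < h < hmax -> exists Q dQ, is_profile h Q dQ.
Proof.
move=> hh; have /andP[h0 hh'] := hh.
have [tau [dtau t11 tN tpos t1]] := exists_profile_parameter A0 B0 k0 kl hh.
have t11' x : -1 <= tau x <= 1 by have /andP[a b] := t11 x; rewrite !ltW.
have cE x : clip (tau x) = 1 - tau x ^+ 2 := clipE (t11' x).
have cpos x : 0 < clip (tau x).
  have /andP[a b] := t11 x; rewrite cE subr_gt0 -(expr1n _ 2).
  by rewrite -real_normK ?num_real// ltr_pXn2r ?nnegrE// ltr_norml a.
have D0 t : 0 < disc h t by exact: disc_gt0.
have s0 t : 0 < Num.sqrt (disc h t) by rewrite sqrtr_gt0.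
pose Q x := h * clip (tau x).
pose dQ x := - (h * tau x * clip (tau x) * Num.sqrt (disc h (tau x))).
have tau0 : tau 0 = 0 by have := tN 0; rewrite oppr0 => e; lra.
have ctau : continuous tau := is_derive_continuous dtau.
have cs := @continuous_sqrt_disc R A B k l k0 kl h.
have cst_ : continuous (fun x => Num.sqrt (disc h (tau x))).
  by move=> x; apply: (@continuous_comp _ _ _ tau (fun t => Num.sqrt (disc h t)));
    [exact: ctau|exact: cs].
have ccl : continuous (fun x => clip (tau x)).
  by move=> x; apply: (@continuous_comp _ _ _ tau clip);
    [exact: ctau|exact: continuous_clip].
have calE x : calib h (Q x) = h * clip (tau x) * (`|tau x| * Num.sqrt (disc h (tau x))).
  rewrite /calib /Q -(discE A B k l h0 (t11' x)).
  by rewrite gtr0_norm ?mulr_gt0// sqrtrM ?sqr_ge0// sqrtr_sqr.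
have dQE x : is_derive x 1 Q (dQ x).
  have d2 := is_derive_mul (dtau x) (dtau x).
  have := is_deriveMcst h (is_derive_cstB 1 d2).
  have -> : (fun z => h * (1 - tau z * tau z)) = Q.
    by apply/funext => z; rewrite /Q cE expr2.
  by move=> d; apply: (is_derive_eq d); rewrite /dQ; field.
have cdQ : continuous dQ.
  move=> x; apply: cvgN; apply: cvgM; last exact: cst_.
  by apply: cvgM; [apply: cvgM; [exact: cvg_cst|exact: ctau]|exact: ccl].
have QN x : Q (- x) = Q x by rewrite /Q tN /clip sqrrN.
have dsq x : dQ x ^+ 2 = calib h (Q x) ^+ 2.
  rewrite calE sqrrN !exprMn real_normK ?num_real//; ring.
exists Q, dQ; split => //.
- move=> x; rewrite mulr_gt0//= ger_pMr//; by case/andP: (clip_01 (tau x)).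
- by rewrite /Q cE tau0 expr0n/= subr0 mulr1.
- move=> x x0; rewrite /Q gtr_pMr// cE gtrBl exprn_gt0//; exact: tpos.
- move=> x x0; rewrite calE gtr0_norm ?tpos// /dQ; congr (- _); ring.
- have ci := continuous_mass_integrand A0 B0 k0 kl hh.
  pose P := primitive (mass_integrand A B k l h).
  have dP x : is_derive x 1 P (mass_integrand A B k l h x).
    by apply: is_derive_primitive (ci x); exact: continuous_segment_integrable.
  (* A primitive of Q^2: the factor sqrt (disc) in tau' cancels the denominator of the mass
     integrand, and the limit tau = 1 at infinity gives the integral over [0, 1]. *)
  pose F x := 2 * h ^+ 2 * P (tau x).
  have dF x : is_derive x 1 F (Q x ^+ 2).
    apply: (is_derive_eq (is_deriveMcst (2 * h ^+ 2)
      (@is_derive1_comp _ P tau x _ _ (dP _) (dtau x)))).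
    rewrite /mass_integrand /Q; field.
    by rewrite gt_eqF.
  have cQ2 : continuous (fun x => Q x ^+ 2).
    move=> x; rewrite /Q; apply: cvgM; apply: cvgM; try exact: cvg_cst; exact: ccl.
  have FL : F x @[x --> +oo] --> 2 * h ^+ 2 * P 1.
    apply: cvgM; first exact: cvg_cst.
    have cP : continuous P := is_derive_continuous dP.
    exact: (cvg_comp _ _ t1 (cP 1)).
  rewrite (ge0_even_integral _ cQ2 _ dF FL); last 2 first.
  + by move=> x; exact: sqr_ge0.
  + by move=> x; rewrite QN.
  have e : \int[mu]_(t in `[0, 1]) mass_integrand A B k l h t = P 1 - P 0.
    by rewrite Rintegral_primitive//; exact: continuous_segment_integrable.
  by congr EFin; rewrite /profile_mass e /F tau0; ring.
- have ci := @continuous_action_integrand R A B k l k0 kl h.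
  pose P := primitive (action_integrand A B k l h).
  have dP x : is_derive x 1 P (action_integrand A B k l h x).
    by apply: is_derive_primitive (ci x); exact: continuous_segment_integrable.
  pose F x := 2 * h ^+ 2 * P (tau x).
  have dF x : is_derive x 1 F (dQ x ^+ 2).
    apply: (is_derive_eq (is_deriveMcst (2 * h ^+ 2)
      (@is_derive1_comp _ P tau x _ _ (dP _) (dtau x)))).
    by rewrite /action_integrand /dQ; field.
  have cQ2 : continuous (fun x => dQ x ^+ 2).
    by move=> x; apply: cvgM; exact: cdQ.
  have FL : F x @[x --> +oo] --> 2 * h ^+ 2 * P 1.
    apply: cvgM; first exact: cvg_cst.
    have cP : continuous P := is_derive_continuous dP.
    exact: (cvg_comp _ _ t1 (cP 1)).
  rewrite (ge0_even_integral _ cQ2 _ dF FL); last 2 first.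
  + by move=> x; exact: sqr_ge0.
  + by move=> x; rewrite !dsq QN.
  have e : \int[mu]_(t in `[0, 1]) action_integrand A B k l h t = P 1 - P 0.
    by rewrite Rintegral_primitive//; exact: continuous_segment_integrable.
  by congr EFin; rewrite /profile_action e /F tau0; ring.
Qed.

Definition slowness h (e : R) s := (Num.max (calib h s) e)^-1.

Lemma slowness_gt0 h (e : R) s : 0 < e -> 0 < slowness h e s.
Proof. by move=> e0; rewrite invr_gt0 lt_max e0 orbT. Qed.

Lemma continuous_slowness h (e : R) : 0 < e -> continuous (slowness h e).
Proof.
move=> e0 s; apply: cvgV; first by rewrite gt_eqF// lt_max e0 orbT.
have cc := @continuous_calib R A B k l k0 kl h.
apply: (@continuous_max _ _ (calib h) (cst e) s); first exact: cc.
exact: cst_continuous.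
Qed.

(* A curve that satisfies the same first order equation as the profile falls
   from its maximum no faster than the profile does. The travel time
   [primitive (slowness h e)] is truncated at [e], since the true slowness
   [1 / calib h] blows up at height [h]. *)
Lemma profile_comparison h Q dQ (v r : R -> R) x1 x : 0 < h < hmax ->
  is_profile h Q dQ -> speed_bounded v r -> v x1 = h ->
  {ae mu, forall t, r t = calib h (v t)} ->
  Q (x - x1) <= v x.
Proof.
move=> /andP[h0 hh] pQ sb vx1 rE.
pose d := `|x - x1|.
have QdE : Q (x - x1) = Q d.
  rewrite /d; have [z0|z0] := leP 0 (x - x1); first by rewrite ger0_norm.
  by rewrite ltr0_norm// (profile_even pQ).
have [xx|xx] := eqVneq x x1.
  by rewrite xx subrr (profile_top pQ) vx1.
have d0 : 0 < d by rewrite normr_gt0 subr_eq0.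
rewrite QdE leNgt; apply/negP => vQ.
have cT (e : R) : 0 < e -> continuous (slowness h e) by exact: continuous_slowness.
have dT (e : R) s : 0 < e -> is_derive s 1 (primitive (slowness h e)) (slowness h e s).
  move=> e0; apply: is_derive_primitive (cT _ e0 s).
  exact: continuous_segment_integrable (cT _ e0).
have Tle (e : R) s t : 0 < e -> s <= t ->
    primitive (slowness h e) s <= primitive (slowness h e) t.
  move=> e0 st; rewrite -subr_ge0 -Rintegral_primitive//; last first.
    exact: continuous_segment_integrable (cT _ e0).
  by apply: Rintegral_ge0 => z _; exact/ltW/slowness_gt0.
(* Since r = [calib h v] almost everywhere, truncated slowness times speed is at most 1, so the
   travel time from h down to [v x] is at most the elapsed distance d. *)
have upper (e : R) : 0 < e ->
    primitive (slowness h e) h - primitive (slowness h e) (v x) <= d.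
  move=> e0.
  have csv : continuous (slowness h e \o v).
    by move=> z; apply: continuous_comp; [exact: (sb_cont sb)|exact: cT].
  have ccv : continuous (fun z => calib h (v z)).
    move=> z; apply: (@continuous_comp _ _ _ v (calib h)); first exact: (sb_cont sb).
    exact: continuous_calib.
  have bound a b : a <= b -> `|primitive (slowness h e) (v b) -
      primitive (slowness h e) (v a)| <= b - a.
    move=> ab; apply: (le_trans (integral_chain_le ab (sb_cont sb) (sb_speed_int sb)
      (sb_speed_ge0 sb) (sb_le sb) (fun z => dT e (v z) e0) csv)).
    have -> : \int[mu]_(t in `[a, b]) (`|slowness h e (v t)| * r t) =
        \int[mu]_(t in `[a, b]) (`|slowness h e (v t)| * calib h (v t)).
      congr fine; apply: ae_eq_integral => //.
      - apply/measurable_EFinP; apply: measurable_funTS; apply: measurable_funM.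
          apply: measurableT_comp => //; exact: continuous_measurable_fun.
        exact: (sb_speed_meas sb).
      - apply/measurable_EFinP; apply: measurable_funTS; apply: measurable_funM.
          apply: measurableT_comp => //; exact: continuous_measurable_fun.
        exact: continuous_measurable_fun.
      - have := rE; apply: filterS; first exact: (ae_filter_ringOfSetsType mu).
        by move=> t /= -> _.
    have cn : continuous (fun t => `|slowness h e (v t)| * calib h (v t)).
      by move=> z; apply: cvgM; [apply: cvg_norm; exact: csv|exact: ccv].
    have -> : b - a = \int[mu]_(t in `[a, b]) (1 : R).
      have := @Rintegral_FTC _ id (cst 1) a b ab (@cst_continuous _ _ _)
        (fun z => @cvg_id _ _) (fun z _ => is_derive_id z 1).
      by move=> <-.
    apply: le_Rintegral => //.
    - exact: (continuous_segment_integrable cn).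
    - by apply: continuous_segment_integrable => z; exact: cvg_cst.
    - move=> t _; rewrite gtr0_norm ?slowness_gt0// /slowness mulrC.
      by rewrite ler_pdivrMr ?lt_max ?e0 ?orbT// mul1r le_max lexx.
  rewrite /d; have [x1x|xx1] := leP x1 x.
    rewrite ger0_norm ?subr_ge0//; have := bound _ _ x1x.
    by rewrite vx1 ler_norml => /andP[+ _]; rewrite lerNl opprB.
  rewrite ltr0_norm ?subr_lt0// [- (x - x1)]opprB; have := bound _ _ (ltW xx1).
  by rewrite vx1 ler_norml => /andP[_].
(* Slowness increases as e decreases, so the extra travel time from [Q d] to [v x] is at least its
   value at e = 1, independently of e. *)
have sgap (e : R) : 0 < e -> e <= 1 ->
    primitive (slowness h 1) (Q d) - primitive (slowness h 1) (v x) <=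
    primitive (slowness h e) (Q d) - primitive (slowness h e) (v x).
  move=> e0 e1.
  have i1 := continuous_segment_integrable (cT 1 ltr01).
  have ie := continuous_segment_integrable (cT e e0).
  rewrite -(Rintegral_primitive i1 (ltW vQ)) -(Rintegral_primitive ie (ltW vQ)).
  apply: le_Rintegral => //.
  move=> t _; rewrite /slowness lef_pV2 ?posrE ?lt_max ?e0 ?ltr01 ?orbT//.
  by rewrite ge_max !le_max lexx e1 orbT.
pose c := primitive (slowness h 1) (Q d) - primitive (slowness h 1) (v x).
have c0 : 0 < c.
  have [y _ ey] := MVT vQ (fun s _ => dT 1 s ltr01)
    (continuous_subspaceT (is_derive_continuous (fun s => dT 1 s ltr01))).
  by rewrite /c ey mulr_gt0 ?slowness_gt0 ?subr_gt0.
(* The fall of the profile is timed from y0 > 0, away from the top; the time y0 <= c / 2 lost in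
   this way is less than the extra time c. *)
pose y0 := Num.min d (c / 2).
have y00 : 0 < y0 by rewrite lt_min d0 divr_gt0.
have y0d : y0 <= d by rewrite ge_min lexx.
have y0c : y0 <= c / 2 by rewrite ge_min lexx orbT.
have cQ : continuous Q := is_derive_continuous (profile_derive pQ).
have ccQ : continuous (fun z => calib h (Q z)).
  move=> z; apply: (@continuous_comp _ _ _ Q (calib h)); first exact: cQ.
  exact: continuous_calib.
have [w wI wP] := EVT_min y0d (continuous_subspaceT ccQ).
have w0 : 0 < w.
  by move: wI; rewrite in_itv/= => /andP[+ _]; exact: lt_le_trans.
have cw : 0 < calib h (Q w).
  have /andP[Q0 _] := profile_bounds pQ w.
  rewrite /calib mulr_gt0 ?normr_gt0 ?gt_eqF// sqrtr_gt0 subr_gt0.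
  by apply: pot_lt => //; rewrite ?(ltW Q0) ?(ltW hh)// (profile_lt pQ).
(* Below the speed of the profile on all of [y0, d]: the truncation is inactive there and travel
   time along Q decreases at unit rate. *)
pose e := Num.min 1 (calib h (Q w)).
have e0 : 0 < e by rewrite lt_min ltr01.
have e1 : e <= 1 by rewrite ge_min lexx.
have ew : e <= calib h (Q w) by rewrite ge_min lexx orbT.
have fall : primitive (slowness h e) (Q d) - primitive (slowness h e) (Q y0) =
    - (d - y0).
  have dI z : z \in `]y0, d[%R ->
      is_derive z 1 (primitive (slowness h e) \o Q) (- 1).
    rewrite in_itv/= => /andP[yz zd].
    have z0 : 0 < z by exact: lt_trans yz.
    apply: (is_derive_eq (is_derive1_comp (dT e (Q z) e0) (profile_derive pQ z))).
    rewrite (profile_ode pQ)// /slowness.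
    have ez : e <= calib h (Q z).
      by apply: (le_trans ew); apply: wP; rewrite in_itv/= !ltW.
    by rewrite (max_l ez) mulrN mulVf// gt_eqF// (lt_le_trans e0).
  have cI : continuous (primitive (slowness h e) \o Q).
    move=> z; apply: continuous_comp; first exact: cQ.
    exact: is_derive_continuous (fun s => dT e s e0) _.
  have [z _ ez] := MVT_segment y0d dI (continuous_subspaceT cI).
  by move: ez; rewrite mulN1r; exact.
(* The curve would need time at least (d - y0) + c > d to fall from h to [v x], against the bound
   d. *)
have := upper e e0; have := sgap e e0 e1; rewrite -/c.
have := Tle e (Q y0) h e0.
have /andP[_ ->] := profile_bounds pQ y0 => /(_ isT).
move: fall y0c; clear -c0 y00.
set T1 := primitive _ _; set T2 := primitive _ _; set T3 := primitive _ _.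
set T4 := primitive _ _.
clearbody T1 T2 T3 T4 y0 c; lra.
Qed.

(** Every segment integral is squeezed between 0 and the total, so the primitive of f is
    constant. *)
Lemma continuous_ge0_integral0 (f : R -> R) : continuous f -> (forall x, 0 <= f x) ->
  mu.-integrable setT (EFin \o f) -> \int[mu]_x f x = 0 -> forall x, f x = 0.
Proof.
move=> cf f0 fi i0 x.
have si := continuous_segment_integrable cf.
have Pc y z : y <= z -> primitive f z = primitive f y.
  move=> yz; apply/eqP; rewrite -subr_eq0 -(Rintegral_primitive si yz) eq_le.
  rewrite -{1}i0 Rintegral_itv_le//=.
  by apply: Rintegral_ge0.
have d1 := is_derive_primitive si (cf x).
have d2 : is_derive x 1 (primitive f) 0.
  have -> : primitive f = cst (primitive f x); last exact: is_derive_cst.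
  by apply/funext => y; case/orP: (le_total x y) => /Pc.
by case: d1 => _ <-; case: d2.
Qed.

End profile_properties.

(** * Energy bound and uniqueness *)

Section energy_bound.
Context {R : realType}.
Notation mu := (@lebesgue_measure R).
Variables (A B k l : R).
Hypotheses (A0 : 0 < A) (B0 : 0 < B) (k0 : 0 < k) (k4 : k < 4) (kl : k < l).
Variable G : R -> R.
Hypothesis GE : forall s, 0 <= s -> G s = - (s ^+ 2 * pot A B k l s) / 2.
Implicit Types (m n s t x y z : R) (v r : R -> R).

Local Notation pot := (pot A B k l).
Local Notation hmax := (hmax A B k l).
Local Notation profile_mass := (profile_mass A B k l).
Local Notation profile_action := (profile_action A B k l).
Local Notation calib := (calib A B k l).
Local Notation reduced_energy := (reduced_energy A B k l).

Definition curve_energy v r : \bar R :=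
  ((2^-1)%:E * \int[mu]_x (r x ^+ 2)%:E + \int[mu]_x (G (v x))%:E)%E.

Lemma sqr_calib n s : pot s <= pot n -> calib n s ^+ 2 = s ^+ 2 * (pot n - pot s).
Proof.
by move=> sn; rewrite exprMn real_normK ?num_real// sqr_sqrtr// subr_ge0.
Qed.

(** The values of v lie in [0, v x1], where [pot] has a minimum, so the square is at most a constant
    times v^2. *)
Lemma calib_sqr_integrable v r n x1 : speed_bounded v r ->
  (forall x, v x <= v x1) -> (forall x, pot (v x) <= pot n) ->
  mu.-integrable setT (EFin \o (fun x => calib n (v x) ^+ 2)).
Proof.
move=> sb vx1 vn.
have cpot := @continuous_pot R A B k l k0 kl.
have [c _ cP] := EVT_min (sb_ge0 sb x1) (continuous_subspaceT cpot).
have cc : continuous (fun x => calib n (v x)).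
  move=> z; apply: (@continuous_comp _ _ _ v (calib n)); first exact: (sb_cont sb).
  exact: continuous_calib.
have Ci : mu.-integrable setT (EFin \o (fun x => (pot n - pot c) * v x ^+ 2)).
  by apply: eq_integrable (integrableZl _ (pot n - pot c) (sb_sqr sb)) => //.
apply: (le_integrable _ _ _ Ci) => //.
  apply/measurable_EFinP; apply: measurable_funX.
  exact: continuous_measurable_fun.
move=> x _; rewrite /= lee_fin sqr_calib//.
have h1 : 0 <= pot n - pot (v x) by rewrite subr_ge0.
have h2 : pot n - pot (v x) <= pot n - pot c.
  by rewrite lerD2l lerN2; apply: cP; rewrite in_itv/= (sb_ge0 sb) vx1.
have h3 := sqr_ge0 (v x).
rewrite (ger0_norm (mulr_ge0 h3 h1)) (ger0_norm (mulr_ge0 (le_trans h1 h2) h3)).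
by rewrite mulrC ler_wpM2r.
Qed.

(** Add and subtract pot n v^2 / 2: the integral of this term is a constant because the mass is
    fixed, and the rest is the density completed to a square in [speed_bounded_action]. *)
Lemma curve_energyE v r n x1 (lam : R) : speed_bounded v r ->
  (forall x, v x <= v x1) -> (forall x, pot (v x) <= pot n) ->
  (\int[mu]_x (v x ^+ 2)%:E = lam%:E)%E ->
  curve_energy v r = ((\int[mu]_x (r x ^+ 2) + \int[mu]_x (calib n (v x) ^+ 2)) / 2
    - pot n * lam / 2)%:E.
Proof.
move=> sb vx1 vn vlam; rewrite /curve_energy.
have ci := calib_sqr_integrable sb vx1 vn.
have vi := sb_sqr sb.
have ci' : mu.-integrable setT (EFin \o (fun x => 2^-1 * calib n (v x) ^+ 2)).
  by apply: eq_integrable (integrableZl _ 2^-1 ci).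
have vi' : mu.-integrable setT (EFin \o (fun x => pot n / 2 * v x ^+ 2)).
  by apply: eq_integrable (integrableZl _ (pot n / 2) vi).
have GvE x : G (v x) = 2^-1 * calib n (v x) ^+ 2 - pot n / 2 * v x ^+ 2.
  rewrite GE ?(sb_ge0 sb)// sqr_calib//; ring.
have Gi : mu.-integrable setT (EFin \o (fun x => G (v x))).
  apply: eq_integrable (integrableB _ ci' vi') => //.
  by move=> x _; rewrite /= GvE.
rewrite (EFin_Rintegral measurableT (sb_speed_sqr sb)).
rewrite (EFin_Rintegral measurableT Gi) -EFinM -EFinD; congr EFin.
under [X in _ + X]eq_Rintegral do rewrite GvE.
rewrite RintegralB// RintegralZl// RintegralZl//.
have -> : \int[mu]_x (v x ^+ 2) = lam by rewrite /Rintegral vlam.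
ring.
Qed.

Lemma integral_sqr_gt0_point v r (lam : R) : speed_bounded v r ->
  (\int[mu]_x (v x ^+ 2)%:E = lam%:E)%E -> 0 < lam -> exists x, 0 < v x.
Proof.
move=> sb vl lam0; apply: contrapT => nv.
have v0 x : v x = 0.
  apply/eqP; rewrite eq_le (sb_ge0 sb) andbT leNgt; apply/negP => vx.
  by apply: nv; exists x.
move: vl; rewrite integral0_eq; last by move=> x _; rewrite v0 expr0n.
by move=> [e]; move: lam0; rewrite -e ltxx.
Qed.

(** For a maximum below [hmax], the energy is at least the reduced energy of that maximum plus half
    the squared defect of [r - calib v]. Equality therefore forces the maximum to be the minimum
    point h and the defect to vanish almost everywhere. For a maximum at or above [hmax] the
    inequality is strict. *)
Lemma curve_energy_ge v r (lam h : R) : speed_bounded v r ->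
  (\int[mu]_x (v x ^+ 2)%:E = lam%:E)%E -> 0 < lam ->
  0 < h < hmax -> profile_mass h = lam ->
  ((reduced_energy lam h)%:E <= curve_energy v r)%E /\
  (curve_energy v r = (reduced_energy lam h)%:E ->
   exists x1, v x1 = h /\ {ae mu, forall t, r t = calib h (v t)}).
Proof.
move=> sb vl lam0 hh hl; have /andP[h0 hh'] := hh.
have [x0 vx0] := integral_sqr_gt0_point sb vl lam0.
have [x1 vx1] := speed_bounded_max sb vx0.
have m0 : 0 < v x1 by exact: lt_le_trans (vx1 x0).
have cpot := @continuous_pot R A B k l k0 kl.
have dcal n s : is_derive s 1 (primitive (calib n)) (calib n s) by exact: is_derive_calib.
have ccal n := @continuous_calib R A B k l k0 kl n.
have action n (vn : forall x, pot (v x) <= pot n) :=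
  speed_bounded_action x1 sb (dcal n) (ccal n) (calib_ge0 A B k l n)
    (calib_sqr_integrable sb vx1 vn).
have sq0 n : 0 <= \int[mu]_t ((r t - calib n (v t)) ^+ 2).
  by apply: Rintegral_ge0 => t _; exact: sqr_ge0.
have [mh|hm] := ltP (v x1) hmax.
  have vn x : pot (v x) <= pot (v x1).
    by apply: pot_le => //; [exact: sb_ge0 sb x|exact: ltW].
  have mI : 0 < v x1 < hmax by rewrite m0.
  have [di de] := action _ vn.
  rewrite primitive0 subr0 (primitive_calib k0 kl mI) in de.
  have EE := curve_energyE sb vx1 vn vl.
  set I := \int[mu]_t ((r t - calib (v x1) (v t)) ^+ 2) in de sq0.
  have low : reduced_energy lam (v x1) + I / 2 <= (\int[mu]_x (r x ^+ 2) +
      \int[mu]_x (calib (v x1) (v x) ^+ 2)) / 2 - pot (v x1) * lam / 2.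
    rewrite /reduced_energy; move: de.
    by set X := \int[mu]_t (r t ^+ 2); set Y := \int[mu]_t _;
      set Z := profile_action _; clearbody X Y Z I; lra.
  rewrite EE lee_fin.
  have [e|mnh] := eqVneq (v x1) h.
    split.
      apply: le_trans low; rewrite e lerDl divr_ge0//; exact: (sq0 (v x1)).
    move=> [EX]; exists x1; split => //.
    have I0 : I = 0.
      apply/eqP; rewrite eq_le (sq0 (v x1)) andbT.
      by move: low; rewrite EX e gerDl pmulr_lle0// invr_gt0.
    have i0 : (\int[mu]_x `|((r x - calib h (v x)) ^+ 2)%:E| = 0)%E.
      under eq_integral do rewrite gee0_abs ?lee_fin ?sqr_ge0//.
      rewrite -e EFin_Rintegral//; congr EFin; exact: I0.
    have mi : measurable_fun setT (fun x => ((r x - calib h (v x)) ^+ 2)%:E).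
      by rewrite -e; case/integrableP: di.
    have := (ae_eq_integral_abs mu measurableT mi).1 i0.
    apply: filterS => t /(_ Logic.I)[] /eqP; rewrite sqrf_eq0 subr_eq0.
    by move/eqP.
  have lt := reduced_energy_min A0 B0 k0 k4 kl hh hl mI mnh.
  have lt' : reduced_energy lam h < (\int[mu]_x (r x ^+ 2) +
      \int[mu]_x (calib (v x1) (v x) ^+ 2)) / 2 - pot (v x1) * lam / 2.
    apply: (lt_le_trans lt); apply: le_trans low; rewrite lerDl divr_ge0//.
    exact: (sq0 (v x1)).
  split; first exact: ltW.
  by move=> [EX]; move: lt'; rewrite EX ltxx.
(* Above [hmax] the calibration of height [hmax] is compared with the one of a
   height slightly below [hmax]. *)
have vn x : pot (v x) <= pot hmax.
  by apply: pot_le_hmax => //; exact: sb_ge0 sb x.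
have [_ de] := action _ vn.
have EE := curve_energyE sb vx1 vn vl.
(* A fixed height between h and [hmax], to have a gap in reduced energy that does not depend on the
   n chosen afterwards. *)
pose ms := (h + hmax) / 2.
have [hms msh] : h < ms /\ ms < hmax by rewrite /ms !(midf_lt hh').
clearbody ms.
have ms0 : 0 < ms by exact: lt_trans hms.
have gap : reduced_energy lam h < reduced_energy lam ms.
  by apply: (reduced_energy_min A0 B0 k0 k4 kl hh hl); rewrite ?ms0// gt_eqF.
(* With this tolerance, replacing [pot hmax] by [pot n] changes the term with lam by less than the
   gap. *)
pose e := (reduced_energy lam ms - reduced_energy lam h) / lam.
have e0 : 0 < e by rewrite divr_gt0// subr_gt0.
have hm0 := hmax_gt0 A0 B0 k0 kl.
have [n [msn nh pn]] : exists n, [/\ ms < n, n < hmax & pot hmax - pot n < e].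
  have /cvgrPdist_lt /(_ _ e0) /nbhs_ballP [d /= d0 dP] := cpot hmax.
  exists (Num.max ((ms + hmax) / 2) (hmax - d / 2)).
  have [a1 a2] := midf_lt msh.
  split.
  - by rewrite lt_max a1.
  - by rewrite gt_max a2 gtrBl divr_gt0.
  - apply: le_lt_trans (ler_norm _) (dP _ _); rewrite /ball/=.
    rewrite ger0_norm; last by rewrite subr_ge0 ge_max (ltW a2) gerBl divr_ge0// ltW.
    rewrite ltrBlDr -ltrBlDl lt_max; apply/orP; right.
    by rewrite ltrD2l ltrN2 ltr_pdivrMr// ltr_pMr// ltr1n.
have n0 : 0 < n by exact: lt_trans msn.
have nI : 0 < n < hmax by rewrite n0.
have Sn : profile_action n / 2 <= primitive (calib hmax) (v x1).
  rewrite -(primitive_calib k0 kl nI).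
  have c1 := ccal n; have c2 := ccal hmax.
  apply: (@le_trans _ _ (primitive (calib hmax) n)).
    apply: (ler_primitive c1 c2 (ltW n0)) => t /andP[t0 tn].
    rewrite /calib ler_wpM2l// ler_wsqrtr// lerD2r.
    by apply: pot_le => //; exact: ltW.
  have nv : n <= v x1 by rewrite (le_trans (ltW nh)).
  rewrite -subr_ge0 -(Rintegral_primitive (continuous_segment_integrable c2) nv).
  by apply: Rintegral_ge0 => t _; exact: calib_ge0.
have Pn : reduced_energy lam ms < reduced_energy lam n.
  apply: (reduced_energy_incr A0 B0 k0 kl ms0 msn nh) => z /andP[mz zn].
  rewrite -hl; apply: (profile_mass_lt A0 B0 k0 k4 kl h0).
    exact: lt_trans mz.
  exact: lt_trans nh.
rewrite primitive0 subr0 in de.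
have lt' : reduced_energy lam h < (\int[mu]_x (r x ^+ 2) +
      \int[mu]_x (calib hmax (v x) ^+ 2)) / 2 - pot hmax * lam / 2.
  have pl : (pot hmax - pot n) * lam < reduced_energy lam ms - reduced_energy lam h.
    by rewrite -ltr_pdivlMr.
  have pp : 0 <= (pot hmax - pot n) * lam.
    rewrite mulr_ge0 ?(ltW lam0)// subr_ge0; exact: pot_le_hmax (ltW n0).
  move: Pn pl pp de (sq0 hmax) Sn; rewrite {2}/reduced_energy.
  set X := \int[mu]_t (r t ^+ 2); set Y := \int[mu]_t (calib _ _ ^+ 2).
  set Z := \int[mu]_t _; set S := profile_action n; set P := primitive _ _.
  set e1 := reduced_energy lam ms; set e2 := reduced_energy lam h.
  set p1 := pot hmax; set p2 := pot n.
  have -> : (p1 - p2) * lam = p1 * lam - p2 * lam by ring.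
  set q1 := p1 * lam; set q2 := p2 * lam.
  by clearbody X Y Z S P e1 e2 q1 q2; clear -R A B k l A0 B0 k0 k4 kl G GE; lra.
split; first by rewrite EE lee_fin ltW.
by rewrite EE => -[EX]; move: lt'; rewrite EX ltxx.
Qed.

End energy_bound.

(** * The profile as the unique positive even ground state *)

Section ground_state.
Context {R : realType}.
Notation mu := (@lebesgue_measure R).
Local Open Scope complex_scope.
Implicit Types (c x y z : R) (f g v r Q dQ : R -> R).

Lemma Lfun2_of_integrable_sqr g : measurable_fun setT g ->
  mu.-integrable setT (EFin \o (fun x => g x ^+ 2)) -> g \in Lfun mu 2%:E.
Proof.
move=> mg gi; rewrite inE; apply/andP; split; rewrite inE//=.
rewrite /finite_norm unlock poweR_lty//.
under eq_integral => x _ do rewrite /= powR_mulrn// real_normK ?num_real//.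
exact: integrable_lty gi.
Qed.

(** Both derivatives integrate to the same increments of f on every segment. *)
Lemma weak_derivative_unique f g : H1 f -> g \in Lfun mu 2%:E ->
  is_weak_derivative f g -> {ae mu, forall x, weak_derivative f x = g x}.
Proof.
move=> Hf gL wg; have [cf _ _] := Hf.
have [dL wd] := weak_derivativeP Hf.
have [gi mg _] := Lfun2_segment_integrable gL.
have [di md _] := Lfun2_segment_integrable dL.
have : {ae mu, forall x, weak_derivative f x - g x = 0}.
  apply: ae_eq0_of_Rintegral_itv.
  - by move=> a b; apply: eq_integrable (integrableB _ (di a b) (gi a b)).
  - exact: measurable_funB.
  - move=> x y xy; rewrite RintegralB//.
    rewrite -(weak_derivative_FTC cf gi mg wg xy).
    by rewrite -(weak_derivative_FTC cf di md wd xy) subrr.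
apply: filterS; first exact: (ae_filter_ringOfSetsType mu).
by move=> x /eqP; rewrite subr_eq0 => /eqP.
Qed.

Lemma H1_cst0 : H1 (cst 0 : R -> R).
Proof.
have L0 : (cst 0 : R -> R) \in Lfun mu 2%:E .
  apply: Lfun2_of_integrable_sqr => //.
  apply: (@eq_integrable _ _ _ mu setT measurableT (cst 0%E)).
    by move=> x _; rewrite /= expr0n.
  exact: integrable0.
split => //; first exact: cst_continuous.
exists (cst 0) => //; apply: C1_weak_derivative; exact: cst_continuous.
Qed.

Lemma ge0_integral_translation f c : continuous f -> (forall x, 0 <= f x) ->
  (\int[mu]_x (f (x - c)%R)%:E = \int[mu]_x (f x)%:E)%E.
Proof.
move=> cf f0; pose F x := x - c.
have dF x : is_derive x 1 F 1.
  rewrite -[X in is_derive _ _ _ X]subr0.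
  exact: (@is_deriveB _ _ _ id (cst c) x 1 1 0 (is_derive_id _ _) (is_derive_cst _ _ _)).
have F1 : F^`()%classic = cst 1 :> (R -> R).
  by apply/funext => x; rewrite derive1E; case: (dF x).
rewrite (@increasing_ge0_integration_by_substitutionT _ F f)//.
- by apply: eq_integral => x _; rewrite F1 /= !fctE mulr1.
- by move=> x y xy; rewrite ltrD2r.
- by rewrite F1; exact: cst_continuous.
- by rewrite F1; exact: is_cvg_cst.
- by rewrite F1; exact: is_cvg_cst.
- by apply: cvg_addrr_Ny.
- by apply: cvg_addrr.
Qed.

Lemma normc_real x : Normc.normc x%:C = `|x|.
Proof. by rewrite /= expr0n/= addr0 sqrtr_sqr. Qed.

Lemma double_powerE (a b p q s : R) : 2 < p -> p < q -> 0 <= s ->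
  double_power a b p q s = - (s ^+ 2 * pot (2 * a) (2 * b) (p - 2) (q - 2) s) / 2.
Proof.
move=> p2 pq; rewrite le_eqVlt => /predU1P[<-|s0].
  have [p0 q0] : p != 0 /\ q != 0 by split; apply/negP => /eqP; lra.
  by rewrite /double_power normr0 !powR0// expr0n/= mul0r oppr0 !mulr0 addr0 mul0r.
rewrite /double_power /pot gtr0_norm//.
have E (e : R) : s `^ e = s ^+ 2 * s `^ (e - 2).
  rewrite -powR_mulrn ?(ltW s0)// -powRD; first by rewrite addrC subrK.
  by rewrite (gt_eqF s0) implybT.
by rewrite (E p) (E q); field.
Qed.

Lemma lambda_star_ge0 (G : R -> R) : (0 <= lambda_star G)%E.
Proof. by rewrite /lambda_star le_max lexx. Qed.

Lemma speed_bounded_energy G u : energy G u = curve_energy G (fun x => Normc.normc (u x))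
  (fun x => Normc.normc (weak_derivativeC u x)).
Proof. by []. Qed.

Section ground_state_of_profile.
Variables (A B k l lam h : R) (G : R -> R) (Q dQ : R -> R).
Hypotheses (A0 : 0 < A) (B0 : 0 < B) (k0 : 0 < k) (k4 : k < 4) (kl : k < l).
Hypotheses (lam0 : 0 < lam) (hh : 0 < h < hmax A B k l).
Hypothesis hl : profile_mass A B k l h = lam.
Hypothesis GE : forall s, 0 <= s -> G s = - (s ^+ 2 * pot A B k l s) / 2.
Hypothesis pQ : is_profile A B k l h Q dQ.

Let u0 x := (Q x)%:C.

Lemma profile_gt0 x : 0 < Q x.
Proof. by case/andP: (profile_bounds pQ x). Qed.

Lemma profile_H1 : H1 Q /\ dQ \in Lfun mu 2%:E.
Proof.
have cQ : continuous Q := is_derive_continuous (profile_derive pQ).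
have sqi (f : R -> R) (c : R) : continuous f -> (\int[mu]_x (f x ^+ 2)%:E = c%:E)%E ->
    f \in Lfun mu 2%:E.
  move=> cf fc; have mf := continuous_measurable_fun cf.
  apply: Lfun2_of_integrable_sqr => //; apply/integrableP; split.
    by apply/measurable_EFinP; exact: measurable_funX.
  under eq_integral do rewrite /= ger0_norm ?sqr_ge0//.
  by rewrite fc ltry.
have dL := sqi _ _ (profile_dcont pQ) (profile_dsqr_int pQ).
split => //; split => //; first exact: sqi (profile_sqr_int pQ).
by exists dQ => //; exact: C1_weak_derivative (profile_derive pQ) (profile_dcont pQ).
Qed.

Lemma profile_H1r : H1r u0.
Proof.
have [HQ _] := profile_H1.
split => //; first by split => //; exact: H1_cst0.
by move=> x; rewrite /u0 (profile_even pQ).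
Qed.

(** The profile moves exactly at speed [calib h], so both integrals in [curve_energyE] equal
    [profile_action h]. *)
Lemma profile_energy : energy G u0 = (reduced_energy A B k l lam h)%:E.
Proof.
have [HQ dL] := profile_H1; have [HC _ _] := profile_H1r.
have sb := H1C_speed_bounded HC.
have nQ x : Normc.normc (u0 x) = Q x by rewrite normc_real gtr0_norm// profile_gt0.
have Ql x : Normc.normc (u0 x) <= Normc.normc (u0 0).
  by rewrite !nQ (profile_top pQ); case/andP: (profile_bounds pQ x).
have /andP[h0 hm] := hh.
have potl x : pot A B k l (Normc.normc (u0 x)) <= pot A B k l h.
  have /andP[q0 qh] := profile_bounds pQ x.
  by rewrite nQ; apply: pot_le; rewrite // ltW.
have ml : (\int[mu]_x ((Normc.normc (u0 x)) ^+ 2)%:E = lam%:E)%E.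
  by under eq_integral do rewrite nQ; rewrite (profile_sqr_int pQ) hl.
rewrite speed_bounded_energy (curve_energyE k0 kl GE sb Ql potl ml).
have -> : \int[mu]_x (calib A B k l h (Normc.normc (u0 x)) ^+ 2) = profile_action A B k l h.
  rewrite /Rintegral; under eq_integral do rewrite nQ -(profile_dsqr pQ).
  by rewrite (profile_dsqr_int pQ).
have -> : \int[mu]_x (Normc.normc (weak_derivativeC u0 x) ^+ 2) = profile_action A B k l h.
  (* [weak_derivative] picks an arbitrary representative, so it agrees with dQ, and with 0 for the
     imaginary part, only almost everywhere. *)
  have wdQ := weak_derivative_unique HQ dL
    (C1_weak_derivative (profile_derive pQ) (profile_dcont pQ)).
  have L0 : (cst 0 : R -> R) \in Lfun mu 2%:E by case: H1_cst0.
  have wd0 := weak_derivative_unique H1_cst0 L0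
    (C1_weak_derivative (fun x : R => is_derive_cst _ _ _) (@cst_continuous _ _ _)).
  rewrite /Rintegral -[RHS]/(fine (profile_action A B k l h)%:E) -(profile_dsqr_int pQ).
  congr fine; apply: ae_eq_integral => //.
  - by apply/measurable_EFinP; apply: measurable_funX; exact: (sb_speed_meas sb).
  - apply/measurable_EFinP; apply: measurable_funX.
    by apply: continuous_measurable_fun; exact: (profile_dcont pQ).
  - move: wdQ wd0; apply: filterS2; first exact: (ae_filter_ringOfSetsType mu).
    move=> x e1 e2 _.
    by rewrite /weak_derivativeC /= e1 e2 expr0n/= addr0 sqr_sqrtr// sqr_ge0.
by congr EFin; rewrite /reduced_energy; field.
Qed.

Lemma profile_mass_sphere : mass_sphere lam u0.
Proof.
have [HC _ _] := profile_H1r; split => //; rewrite /mass -hl -(profile_sqr_int pQ).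
by apply: eq_integral => x _; rewrite normc_real gtr0_norm// profile_gt0.
Qed.

Lemma ground_energyE : ground_energy G lam = (reduced_energy A B k l lam h)%:E.
Proof.
apply/eqP; rewrite eq_le; apply/andP; split.
  apply: ereal_inf_lbound; exists u0; first exact: profile_mass_sphere.
  exact: profile_energy.
apply: le_ereal_inf_tmp => _ [u [HC Mu] <-].
have [le_E _] := curve_energy_ge A0 B0 k0 k4 kl GE (H1C_speed_bounded HC) Mu lam0 hh hl.
exact: le_E.
Qed.

Lemma profile_ground_state : ground_states G lam u0.
Proof.
split; first exact: profile_mass_sphere.
by rewrite ground_energyE profile_energy.
Qed.

Lemma profile_ground_state_unique u : ground_states G lam u -> H1r u ->
  (forall x, 0 < u x) -> u0 = u.
Proof.
move=> [[HC Mu] Eu] [_ u_real u_even] upos.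
have sb := H1C_speed_bounded HC.
pose v x := Normc.normc (u x).
(* Being real and positive, u coincides with its modulus. *)
have vE x : u x = (v x)%:C.
  have := upos x; rewrite ltcE => /andP[_] /=; move: (u_real x); rewrite /v.
  by case: (u x) => c d /= -> c0; rewrite expr0n/= addr0 sqrtr_sqr gtr0_norm.
have [_ /(_ _)[|x1 [vx1 rE]]] := curve_energy_ge A0 B0 k0 k4 kl GE sb Mu lam0 hh hl.
  by rewrite -ground_energyE -Eu.
have Qv x : Q (x - x1) <= v x := profile_comparison A0 B0 k0 kl x hh pQ sb vx1 rE.
have cQ : continuous Q := is_derive_continuous (profile_derive pQ).
have cQ1 : continuous (fun x => Q (x - x1)).
  move=> x; apply: (@continuous_comp _ _ _ (fun x => x - x1) Q); last exact: cQ.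
  by apply: cvgB; [exact: cvg_id|exact: cvg_cst].
have cQ2 : continuous (fun x => Q x ^+ 2).
  by move=> x; apply: cvgM; exact: cQ.
have Qi : (\int[mu]_x (Q (x - x1) ^+ 2)%:E = lam%:E)%E.
  rewrite (@ge0_integral_translation (fun x => Q x ^+ 2) x1 cQ2); last first.
    by move=> x; exact: sqr_ge0.
  by rewrite (profile_sqr_int pQ) hl.
have Qint : mu.-integrable setT (EFin \o (fun x => Q (x - x1) ^+ 2)).
  apply/integrableP; split.
    apply/measurable_EFinP; apply: measurable_funX; exact: continuous_measurable_fun.
  under eq_integral do rewrite /= ger0_norm ?sqr_ge0//.
  by rewrite Qi ltry.
have Q0 x := profile_gt0 x.
(* The difference is continuous, nonnegative by the comparison, and has integral lam - lam. *)
have d0 x : v x ^+ 2 - Q (x - x1) ^+ 2 = 0.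
  move: x; apply: continuous_ge0_integral0.
  - move=> x; apply: cvgB; first by apply: cvgM; exact: (sb_cont sb).
    by apply: cvgM; exact: cQ1.
  - move=> x; rewrite subr_ge0 lerXn2r ?nnegrE ?(sb_ge0 sb) ?(ltW (Q0 _))//.
  - by apply: eq_integrable (integrableB _ (sb_sqr sb) Qint).
  - rewrite RintegralB//; last exact: (sb_sqr sb).
    by rewrite /Rintegral Qi [X in fine X]Mu subrr.
have vQ x : v x = Q (x - x1).
  apply/eqP; rewrite -(@eqrXn2 _ 2) ?(sb_ge0 sb) ?(ltW (Q0 _))//.
  by rewrite -subr_eq0 d0.
have x10 : x1 = 0.
  (* By evenness v also reaches h at -x1, that is, Q reaches its top at -2 x1; this happens only at
     0. *)
  have e : Q (- x1 - x1) = h by rewrite -vQ /v u_even.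
  have [x1p|x1n|//] := ltgtP 0 x1.
    have := profile_lt pQ (addr_gt0 x1p x1p).
    by rewrite -(profile_even pQ) opprD e ltxx.
  have n1 : 0 < - x1 by rewrite oppr_gt0.
  by have := profile_lt pQ (addr_gt0 n1 n1); rewrite e ltxx.
by apply/funext => x; rewrite vE vQ x10 subr0.
Qed.

End ground_state_of_profile.

End ground_state.

Theorem mainTheorem5 (R : realType) (a b p q : R)
    (a_gt0 : 0 < a) (b_gt0 : 0 < b) (p_gt2 : 2 < p) (p_lt6 : p < 6)
    (p_lt_q : p < q) (lambda : R)
    (lambda_gt : (lambda_star (double_power a b p q) < lambda%:E)%E) :
  exists! u : R -> R[i],
    [/\ ground_states (double_power a b p q) lambda u,
        H1r u &
        forall x : R, 0 < u x].
Proof.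
(* The maximum with 0 in [lambda_star] gives this even when the supremum is that of the empty
   set. *)
have lam0 : 0 < lambda.
  by rewrite -lte_fin; exact: le_lt_trans (lambda_star_ge0 _) lambda_gt.
have A0 : 0 < 2 * a by rewrite mulr_gt0.
have B0 : 0 < 2 * b by rewrite mulr_gt0.
have k0 : 0 < p - 2 by rewrite subr_gt0.
have k4 : p - 2 < 4 by lra.
have kl : p - 2 < q - 2 by rewrite ltrD2r.
have GE := double_powerE a b p_gt2 p_lt_q.
have [h [hh hl]] := exists_height A0 B0 k0 k4 kl lam0.
have [Q [dQ pQ]] := exists_profile A0 B0 k0 kl hh.
exists (fun x => (Q x)%:C%C); split; first split.
- exact: profile_ground_state pQ.
- exact: profile_H1r pQ.
- by move=> x; rewrite ltcE/= eqxx (profile_gt0 pQ).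
- move=> u [gu ru pu].
  exact: (profile_ground_state_unique A0 B0 k0 k4 kl lam0 hh hl GE pQ gu ru pu).
Qed.
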